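(* Let $H$ be a graph on the vertex set $[n]$ which is not a complete graph, and let $G=v*H$ be the cone of $v$ on $H$. Then, for all integers $i\geq 0$ and $j\geq 1$, the graded Betti number $\beta_{i,i+j}^{S}\left(\frac{S}{J_G}\right)$ is given as follows. If $j=1$: $$\beta_{i,i+1}^{S}\left(\tfrac{S}{J_G}\right)=i\left(\mathsf{k}_i(H)+\mathsf{k}_{i+1}(H)\right).$$ If $j=2$: $$\beta_{i,i+2}^{S}\left(\tfrac{S}{J_G}\right)=\beta_{i,i+2}^{S_H}\left(\tfrac{S_H}{J_H}\right)+2\beta_{i-1,i+1}^{S_H}\left(\tfrac{S_H}{J_H}\right)+\beta_{i-2,i}^{S_H}\left(\tfrac{S_H}{J_H}\right)+(i-1)\binom{n+1}{i+1}-(i-1)\mathsf{k}_i(H)-(i-1)\mathsf{k}_{i+1}(H).$$ If $j\geq 3$: $$\beta_{i,i+j}^{S}\left(\tfrac{S}{J_G}\right)=\beta_{i,i+j}^{S_H}\left(\tfrac{S_H}{J_H}\right)+2\beta_{i-1,i-1+j}^{S_H}\left(\tfrac{S_H}{J_H}\right)+\beta_{i-2,i-2+j}^{S_H}\left(\tfrac{S_H}{J_H}\right).$$ Here $\beta_{i-1,i-1+j}^{S_H}(S_H/J_H)=0$ if $i-1<0$ and $\beta_{i-2,i-2+j}^{S_H}(S_H/J_H)=0$ if $i-2<0$.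
   Context: $\mathbb{K}$ is an arbitrary field and all graphs are finite and simple; $[n]=\{1,\dots,n\}$. For a graph $\Gamma$, its binomial edge ideal $J_\Gamma$ is the ideal of the polynomial ring $\mathbb{K}[x_u,y_u : u\in V(\Gamma)]$ generated by the binomials $x_uy_w-x_wy_u$ with $\{u,w\}\in E(\Gamma)$. The cone $v*H$ has vertex set $V(H)\sqcup\{v\}$ and edge set $E(H)\sqcup\{\{v,u\} : u\in V(H)\}$. Put $S_H=\mathbb{K}[x_i,y_i : i\in V(H)]$ and $S=S_H[x_v,y_v]$, standard graded. For a finitely generated graded module $M$ over a standard graded polynomial ring $R$ over $\mathbb{K}$, $\beta_{i,i+j}^R(M)=\dim_{\mathbb{K}}\operatorname{Tor}_i^R(M,\mathbb{K})_{i+j}$ is the $(i,i+j)$-th graded Betti number. A subset $U\subseteq V(H)$ is a clique if the induced subgraph $H[U]$ is complete, and $\mathsf{k}_i(H)$ denotes the number of cliques of cardinality $i$ in $H$; the empty set counts as a clique, so $\mathsf{k}_0(H)=1$. *)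

(* Defs.v *)
From mathcomp Require Import all_boot all_order all_algebra.
From mathcomp Require Import mpoly.

Set Implicit Arguments.
Unset Strict Implicit.
Unset Printing Implicit Defensive.

Import GRing.Theory.

Local Open Scope ring_scope.

(* A simple graph on V is a symmetric irreflexive e : rel V. *)
Section Graphs.
Variable V : finType.
Implicit Types (e : rel V) (U : {set V}).

Definition is_clique e U : bool :=
  [forall u in U, forall w in U, (u != w) ==> e u w].

Definition is_complete e : bool := is_clique e [set: V].

Definition num_cliques e (i : nat) : nat :=
  #|[set U : {set V} | is_clique e U & #|U| == i]|.

(* The apex of the cone is None. *)
Definition cone e : rel (option V) := fun a b =>
  match a, b with
  | Some u, Some w => e u w
  | None, None => false
  | _, _ => true
  end.

End Graphs.

(* K[x_u, y_u : u in V]; {mpoly _[_]} numbers its variables, the x_u come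
   first and the y_u second, each block in the order of enum V. *)
Notation vertex_ring K V := {mpoly K[#|V| + #|V|]}.

Section BinomialEdgeIdeal.
Variables (K : fieldType) (V : finType).

Definition xvar (u : V) : vertex_ring K V := 'X_(lshift #|V| (enum_rank u)).
Definition yvar (u : V) : vertex_ring K V := 'X_(rshift #|V| (enum_rank u)).

(* Each edge is listed in both orientations, with opposite generators. *)
Definition binomial_edge_ideal (e : rel V) (p : vertex_ring K V) : Prop :=
  exists c : V -> V -> vertex_ring K V,
    p = \sum_u \sum_(w | e u w)
          c u w * (xvar u * yvar w - xvar w * yvar u).

End BinomialEdgeIdeal.

(* Graded free resolutions, not necessarily minimal or of finite length,
     ... -> F_2 -> F_1 -> F_0 -> R/J -> 0
   of the cyclic module R/J, with R = K[X_0, ..., X_(m-1)] standard graded: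
   F_i is the direct sum of the R(- fr_deg i a), for a < fr_rank i, an element
   of F_i is the row vector of its coordinates, and fr_diff i is the matrix of
   F_(i+1) -> F_i, acting on the right. fr_aug lifts F_0 -> R/J to R. Maps
   preserve degrees; the zero polynomial is homogeneous of every degree. *)
Record graded_free_resolution (K : fieldType) (m : nat)
    (J : {mpoly K[m]} -> Prop) := GradedFreeResolution {
  fr_rank : nat -> nat;
  fr_deg : forall i, 'I_(fr_rank i) -> nat;
  fr_diff : forall i, 'M[{mpoly K[m]}]_(fr_rank i.+1, fr_rank i);
  fr_aug : 'cV[{mpoly K[m]}]_(fr_rank 0);
  fr_diff_homog : forall i (a : 'I_(fr_rank i.+1)) (b : 'I_(fr_rank i)),
    fr_diff i a b != 0 ->
    (fr_deg b <= fr_deg a)%N /\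
    fr_diff i a b \is (fr_deg a - fr_deg b)%N.-homog;
  fr_aug_homog : forall a : 'I_(fr_rank 0),
    fr_aug a 0 \is (fr_deg a).-homog;
  fr_aug_surj : forall p : {mpoly K[m]},
    exists u : 'rV_(fr_rank 0), J (p - (u *m fr_aug) 0 0);
  fr_exact0 : forall u : 'rV_(fr_rank 0),
    J ((u *m fr_aug) 0 0) <-> exists w, u = w *m fr_diff 0;
  fr_exactS : forall i (u : 'rV_(fr_rank i.+1)),
    u *m fr_diff i = 0 <-> exists w, u = w *m fr_diff i.+1
}.

Section Tor.
Variables (K : fieldType) (m : nat) (J : {mpoly K[m]} -> Prop).
Variable F : graded_free_resolution J.

(* The differential of F (x)_R K: since K = R/(X_0, ..., X_(m-1)), every entry
   is replaced by its constant coefficient. *)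
Definition tor_diff i : 'M[K]_(fr_rank F i.+1, fr_rank F i) :=
  map_mx (mcoeff 0%MM) (fr_diff F i).

(* Subspaces of F_i (x)_R K are row spaces of square matrices. *)
Definition tor_strand i (d : nat) : 'M[K]_(fr_rank F i) :=
  diag_mx (\row_a (fr_deg a == d)%:R).

Definition tor_cycles i : 'M[K]_(fr_rank F i) :=
  match i with
  | 0 => 1%:M
  | i'.+1 => kermx (tor_diff i')
  end.

(* dim_K Tor_i(R/J, K)_d, the dimension of the degree d part of
   H_i(F (x)_R K): the boundaries form a subspace of the cycles. *)
Definition tor_dim i d : nat :=
  (\rank (tor_cycles i :&: tor_strand i d)%MS
   - \rank (tor_strand i.+1 d *m tor_diff i))%N.

(* The graded Betti number beta_(i, d)(R/J), zero for i < 0 or d < 0. *)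
Definition betti (i d : int) : nat :=
  match i, d with
  | Posz i', Posz d' => tor_dim i' d'
  | _, _ => 0%N
  end.

End Tor.

(* Main.v *)
(** Betti numbers are computed by Koszul homology: shifting along a free
    resolution identifies Tor_i(R/J, K)_(i+j) with the Koszul homology H_(i,j)
    of R/J, in exterior degree i and with coefficients of degree j.

    The ideal J_G is the intersection of J_A, for the complete graph on all the
    vertices, and of J_B = (x_v, y_v) + J_H; moreover J_A + J_B is J_Q, which is
    (x_v, y_v) + J_K for the complete graph K on V(H). The Betti numbers of
    S/J_B and S/J_Q come from those over S_H by tensoring with the Koszul
    complex of x_v, y_v. As S/J_A and S/J_Q have regularity 1, the
    Mayer-Vietoris sequence gives H_(i,j)(J_G) = H_(i,j)(J_B) for j >= 3, and an
    exact sequence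
      0 -> H_(i+1,1)(J_G) -> H_(i+1,1)(J_A) (+) H_(i+1,1)(J_B)
        -> H_(i+1,1)(J_Q) -> H_(i,2)(J_G) -> H_(i,2)(J_B) -> 0.
    All the linear strands in it are known: for every graph, H_(i,1) is the space
    of Koszul cycles with values in the quadrics of the ideal; the coefficients
    of such a cycle alternate in all the vertices involved, so that they are
    supported on cliques of cardinality i+1, each of which contributes
    dimension i. *)

Require Import Defs.
From HB Require Import structures.
From Stdlib Require Import Classical.
From mathcomp Require Import all_boot all_order all_algebra.
From mathcomp Require Import mpoly zify ring.

Set Implicit Arguments.
Unset Strict Implicit.
Unset Printing Implicit Defensive.

Import GRing.Theory.
Local Open Scope ring_scope.

(** * Dimensions of subquotients *)

(** Chains with polynomial coefficients form infinite-dimensional spaces and the ideals are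
    [Prop]-valued, so the dimension of a subquotient is a relation, proved functional, and maps on
    homology are linear relations between cycles, which spares the choice of liftings in connecting
    maps. The given resolution may be infinite and non-minimal, so its ranks say little; the Koszul
    side depends on the ideal alone. The five-term sequence is exact on the left because J_B and J_Q
    contain the same linear forms: the connecting map out of H_(i+2,0)(J_Q) is zero. Two arguments
    are toric. J of a complete graph is the kernel of x_u -> s a_u, y_u -> t a_u; being prime, it
    supplies the nonzerodivisors behind the regularity bound. And an element of this kernel all of
    whose monomials involve v lies in J_G, since x_v (x_a y_b - x_b y_a), and likewise with y_v, is
    a combination of the generators of the edges va and vb; this yields the intersection formula.
    The term (i-1) binom(n+1, i+1) is what Pascal's rule leaves of the linear strands of J_A and
    J_Q. *)

Section Subquotients.
Variable K : fieldType.

Definition subspace (V : lmodType K) (U : V -> Prop) :=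
  U 0 /\ forall a u v, U u -> U v -> U (a *: u + v).

(** For subspaces, the dimension of [U] modulo its intersection with [W]: [f] is a basis of the
    quotient. [W] need not lie in [U]. *)
Definition dimq (V : lmodType K) (U W : V -> Prop) (n : nat) :=
  exists f : 'I_n -> V,
    [/\ forall i, U (f i),
        forall u, U u -> exists c : 'I_n -> K, W (u - \sum_i c i *: f i)
      & forall c : 'I_n -> K, W (\sum_i c i *: f i) -> forall i, c i = 0].

Section SubspaceTheory.
Variables (V : lmodType K) (U : V -> Prop).
Hypothesis hU : subspace U.

Lemma subspace0 : U 0. Proof. by case: hU. Qed.

Lemma subspaceZ a u : U u -> U (a *: u).
Proof. by case: hU => h0 h hu; rewrite -[_ *: _]addr0; apply: h. Qed.

Lemma subspaceD u v : U u -> U v -> U (u + v).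
Proof. by case: hU => h0 h hu hv; rewrite -[u]scale1r; apply: h. Qed.

Lemma subspaceN u : U u -> U (- u).
Proof. by move=> hu; rewrite -scaleN1r; apply: subspaceZ. Qed.

Lemma subspaceB u v : U u -> U v -> U (u - v).
Proof. by move=> hu hv; apply: subspaceD => //; apply: subspaceN. Qed.

Lemma subspace_sum (I : Type) (r : seq I) (P : pred I) (F : I -> V) :
  (forall i, P i -> U (F i)) -> U (\sum_(i <- r | P i) F i).
Proof.
by move=> h; apply: big_ind => //; [exact: subspace0 | exact: subspaceD].
Qed.

Lemma subspace_subr u v : U v -> U (u - v) -> U u.
Proof. by move=> hv huv; rewrite -(subrK v u); apply: subspaceD. Qed.

End SubspaceTheory.

(** The [n'] elements of one basis are written modulo [W] in the [n] elements of the other. If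
    [n < n'], the matrix of coefficients has a nonzero left kernel vector, which is a forbidden
    relation. *)
Lemma dimq_le (V : lmodType K) (U W : V -> Prop) n n' :
  subspace W -> dimq U W n -> dimq U W n' -> (n' <= n)%N.
Proof.
move=> hW [f [fU fs fi]] [g [gU gs gi]].
have /fin_all_exists [A hA] : forall i : 'I_n', exists c : 'I_n -> K,
  W (g i - \sum_j c j *: f j) by move=> i; apply: fs.
pose M : 'M[K]_(n', n) := \matrix_(i, j) A i j.
rewrite leqNgt; apply/negP => ltnn'.
have : kermx M != 0.
  rewrite kermx_eq0 /row_free neq_ltn.
  by rewrite (leq_ltn_trans (rank_leq_col M)).
case/rowV0Pn => v /sub_kermxP vM /negP; apply; apply/eqP/rowP => i.
rewrite mxE; apply: (gi (fun i => v 0 i)).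
have -> : \sum_i v 0 i *: g i = \sum_i v 0 i *: (g i - \sum_j A i j *: f j).
  under [RHS]eq_bigr do rewrite scalerBr.
  rewrite sumrB [X in _ - X](_ : _ = 0) ?subr0 //.
  under eq_bigr do rewrite scaler_sumr.
  rewrite exchange_big big1 //= => j _.
  under eq_bigr do rewrite scalerA.
  rewrite -scaler_suml; have /rowP/(_ j) := vM; rewrite !mxE => e.
  by rewrite (_ : \sum_i _ = 0) ?scale0r // -[RHS]e; apply: eq_bigr => k _; rewrite mxE.
by apply: subspace_sum => // k _; apply: subspaceZ.
Qed.

Lemma dimq_uniq (V : lmodType K) (U W : V -> Prop) n n' :
  subspace W -> dimq U W n -> dimq U W n' -> n = n'.
Proof.
by move=> hW h h'; apply/eqP; rewrite eqn_leq (dimq_le hW h h') (dimq_le hW h' h).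
Qed.

Definition glue_ord T n1 n2 (c1 : 'I_n1 -> T) (c2 : 'I_n2 -> T) (i : 'I_(n1 + n2)) :=
  match split i with inl j => c1 j | inr j => c2 j end.

Lemma glue_ordl T n1 n2 (c1 : 'I_n1 -> T) (c2 : 'I_n2 -> T) i :
  glue_ord c1 c2 (lshift n2 i) = c1 i.
Proof. by rewrite /glue_ord (unsplitK (inl i)). Qed.

Lemma glue_ordr T n1 n2 (c1 : 'I_n1 -> T) (c2 : 'I_n2 -> T) i :
  glue_ord c1 c2 (rshift n1 i) = c2 i.
Proof. by rewrite /glue_ord (unsplitK (inr i)). Qed.

Lemma sum_glue_ord (V : lmodType K) n1 n2 (c : 'I_(n1 + n2) -> K)
    (f1 : 'I_n1 -> V) (f2 : 'I_n2 -> V) :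
  \sum_i c i *: glue_ord f1 f2 i =
  \sum_i c (lshift n2 i) *: f1 i + \sum_i c (rshift n1 i) *: f2 i.
Proof.
by rewrite big_split_ord /=; congr (_ + _); apply: eq_bigr => i _;
  rewrite (glue_ordl, glue_ordr).
Qed.

Lemma dimq_chain (V : lmodType K) (U N W : V -> Prop) n1 n2 :
  subspace N -> (forall v, N v -> U v) -> (forall v, U v -> W v -> N v) ->
  subspace U -> dimq N W n1 -> dimq U N n2 -> dimq U W (n1 + n2).
Proof.
move=> hN NU UWN hU [f1 [f1N f1s f1i]] [f2 [f2U f2s f2i]].
exists (glue_ord f1 f2); split.
- move=> i; rewrite /glue_ord; case: (split i) => j //; exact: NU.
- move=> u /[dup] Uu /f2s [c2 h2]; have [c1 h1] := f1s _ h2.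
  exists (glue_ord c1 c2); rewrite sum_glue_ord.
  under eq_bigr do rewrite glue_ordl.
  under [in X in _ - (_ + X)]eq_bigr do rewrite glue_ordr.
  by rewrite opprD addrA addrAC.
- move=> c; rewrite sum_glue_ord => hc.
  have s1 : N (\sum_i c (lshift n2 i) *: f1 i).
    by apply: subspace_sum => // i _; apply: subspaceZ.
  have c2 : forall i, c (rshift n1 i) = 0.
    apply: (f2i (fun i => c (rshift n1 i))).
    rewrite -[X in N X](addKr (\sum_i c (lshift n2 i) *: f1 i)).
    apply: subspaceD => //; first exact: subspaceN.
    apply: UWN hc; apply: subspaceD => //; first exact: NU.
    by apply: subspace_sum => // i _; apply: subspaceZ.
  move=> i; rewrite -(splitK i); case: (split i) => j //=.
  apply: (f1i (fun i => c (lshift n2 i))).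
  by move: hc; rewrite [X in _ + X]big1 ?addr0 // => k _; rewrite c2 scale0r.
Qed.

(** A free family inside [Q] is enlarged until it spans, excluded middle deciding at each stage
    whether it does; [k] bounds the number of rows that can still be added. *)
Lemma subspace_row_basis n (Q : 'rV[K]_n -> Prop) : subspace Q ->
  exists r (A : 'M[K]_(r, n)), row_free A /\ forall v, Q v <-> (v <= A)%MS.
Proof.
move=> hQ.
have step : forall k r (A : 'M[K]_(r, n)), (n - r <= k)%N -> row_free A ->
   (forall v, (v <= A)%MS -> Q v) ->
   exists r (A : 'M[K]_(r, n)), row_free A /\ forall v, Q v <-> (v <= A)%MS.
  elim=> [|k IH] r A le_k fA AQ.
    exists r, A; split=> // v; split=> [_|]; last exact: AQ.
    apply: submx_full; rewrite /row_full eqn_leq rank_leq_col.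
    by move: le_k fA; rewrite leqn0 subn_eq0 /row_free => le_nr /eqP ->.
  case: (classic (forall v, Q v -> (v <= A)%MS)) => [QA|].
    by exists r, A; split=> // v; split; [exact: QA | exact: AQ].
  move/not_all_ex_not => [v /(imply_to_and (Q v)) [Qv /negP nvA]].
  have rk : \rank (col_mx v A) = (1 + r)%N.
    rewrite -addsmxE; have := mxrank_sum_cap v A.
    have v0 : v != 0 by apply: contraNneq nvA => ->; apply: sub0mx.
    have -> : (v :&: A)%MS = 0.
      apply/eqP; rewrite -mxrank_eq0 -leqn0 -ltnS.
      have := mxrankS (capmxSl v A); rewrite rank_rV v0 leq_eqVlt => /orP[/eqP e|//].
      have /andP[_ h] : (v :&: A == v)%MS by rewrite -mxrank_leqif_eq ?capmxSl // e rank_rV v0.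
      by rewrite (submx_trans h (capmxSr _ _)) in nvA.
    by rewrite mxrank0 addn0 rank_rV v0 => ->; congr addn; apply/eqP.
  apply: (IH (1 + r)%N (col_mx v A)); last 2 first.
  - by rewrite /row_free rk.
  - move=> w; rewrite -addsmxE => /sub_addsmxP [[a b] /= ->].
    apply: subspaceD => //; last by apply: AQ; apply: submxMl.
    by rewrite [a]mx11_scalar mul_scalar_mx; apply: subspaceZ.
  - by rewrite addnC subnDA leq_subLR add1n.
apply: (step n 0%N 0); rewrite ?subn0 //.
  by rewrite /row_free mxrank0.
by move=> v /submxP [D ->]; rewrite mulmx0; apply: subspace0.
Qed.

(** The converse of [dimq_chain]: it provides dimensions for kernels and images that are not known
    beforehand. A basis of [U] modulo [W] identifies [N] with a subspace of [K^n], where a row basis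
    and a complement exist. *)
Lemma dimq_between (V : lmodType K) (U N W : V -> Prop) n :
  subspace U -> subspace N -> subspace W -> (forall v, N v -> U v) ->
  (forall v, U v -> W v -> N v) -> dimq U W n ->
  exists n1 n2, [/\ dimq N W n1, dimq U N n2 & n = (n1 + n2)%N].
Proof.
move=> hU hN hW NU UWN h; have [f [fU fs fi]] := h.
pose comb (v : 'rV[K]_n) := \sum_i v 0 i *: f i.
have combD a u v : comb (a *: u + v) = a *: comb u + comb v.
  rewrite /comb scaler_sumr -big_split; apply: eq_bigr => i _ /=.
  by rewrite !mxE scalerDl scalerA.
have combU v : U (comb v).
  by apply: subspace_sum => // i _; apply: subspaceZ.
have comb0 : comb 0 = 0 by rewrite /comb big1 // => i _; rewrite mxE scale0r.
have [|r1 [A [fA QA]]] := @subspace_row_basis n (fun v => N (comb v)).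
  split; first by rewrite comb0; apply: subspace0.
  by move=> a u v hu hv; rewrite combD; apply: subspaceD => //; apply: subspaceZ.
have comb_sum m (c : 'I_m -> K) (M : 'M[K]_(m, n)) :
   \sum_i c i *: comb (row i M) = comb ((\row_i c i) *m M).
  rewrite /comb; under eq_bigr do rewrite scaler_sumr.
  rewrite exchange_big; apply: eq_bigr => j _ /=.
  by rewrite mxE scaler_suml; apply: eq_bigr => i _; rewrite !mxE scalerA.
have comb_inj v : W (comb v) -> v = 0.
  by move=> /fi hv; apply/rowP => i; rewrite mxE hv.
have combP u : U u -> exists v, W (u - comb v).
  move=> /fs [c hc]; exists (\row_i c i).
  by rewrite /comb; under eq_bigr do rewrite mxE.
have h1 : dimq N W r1.
  exists (fun i => comb (row i A)); split.
  - by move=> i; apply/QA; apply: row_sub.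
  - move=> u Nu; have [v hv] := combP _ (NU _ Nu).
    have /QA/submxP [D eD] : N (comb v).
      rewrite -[comb v](subKr u); apply: subspaceB => //; apply: UWN hv.
      by apply: subspaceB => //; exact: NU.
    exists (fun i => D 0 i); rewrite comb_sum (_ : \row_i _ = D) -?eD //.
    by apply/rowP => i; rewrite mxE.
  - move=> c; rewrite comb_sum => /comb_inj /(congr1 (mulmx^~ (pinvmx A))).
    rewrite mul0mx mulmxKp // => e i.
    by have /rowP/(_ i) := e; rewrite !mxE.
pose C := row_base (A^C)%MS.
have h2 : dimq U N (\rank (A^C)%MS).
  exists (fun i => comb (row i C)); split=> //.
  - move=> u /[dup] Uu /combP [v hv].
    have : (v <= A + A^C)%MS by apply: submx_full; rewrite addsmx_compl_full.
    case/sub_addsmxP => [[D E] /= eDE].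
    have : (E *m A^C <= C)%MS.
      by apply: submx_trans (submxMl _ _) _; rewrite eq_row_base.
    case/submxP => E' eE.
    exists (fun i => E' 0 i); rewrite comb_sum (_ : \row_i _ = E'); last first.
      by apply/rowP => i; rewrite mxE.
    rewrite -eE -(subrK (comb v) u) -addrA; apply: subspaceD => //.
      by apply: UWN hv; apply: subspaceB.
    rewrite eDE -[comb (_ *m A^C)%MS]scale1r -scalerN.
    rewrite -[comb (_ + _)]scale1r -scaleN1r scale1r scale1r addrC -combD.
    by rewrite scaleN1r addrCA addNr addr0; apply/QA; apply: submxMl.
  - move=> c; rewrite comb_sum => /QA.
    set w := _ *m C => hw.
    have : (w <= A :&: A^C)%MS.
      rewrite sub_capmx hw /=; apply: submx_trans (submxMl _ _) _.
      by rewrite eq_row_base.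
    rewrite capmx_compl submx0 => /eqP /(congr1 (mulmx^~ (pinvmx C))).
    rewrite mul0mx mulmxKp ?row_base_free // => e i.
    by have /rowP/(_ i) := e; rewrite !mxE.
exists r1, (\rank (A^C)%MS); split=> //.
exact: (dimq_uniq hW h (dimq_chain hN NU UWN hU h1 h2)).
Qed.

(** A linear relation, total on both sides, for which related elements vanish simultaneously in the
    quotients, induces an isomorphism of the quotients. Every isomorphism of homology below is
    obtained in this form. *)
Lemma dimq_rel (V V' : lmodType K) (U W : V -> Prop) (U' W' : V' -> Prop)
    (r : V -> V' -> Prop) n :
  subspace U -> subspace U' ->
  (forall a u v u' v', r u u' -> r v v' -> r (a *: u + v) (a *: u' + v')) ->
  (forall u, U u -> exists2 u', U' u' & r u u') ->
  (forall u', U' u' -> exists2 u, U u & r u u') ->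
  (forall u u', U u -> U' u' -> r u u' -> W u <-> W' u') ->
  dimq U W n -> dimq U' W' n.
Proof.
move=> hU hU' rlin rtot rsur rW [f [fU fs fi]].
have r0 : r 0 0.
  have [u' _ h] := rtot _ (subspace0 hU).
  by have := rlin (-1) _ _ _ _ h h; rewrite !scaleN1r !addNr.
have /fin_all_exists [g hg] : forall i : 'I_n, exists u', U' u' /\ r (f i) u'.
  by move=> i; have [u' ? ?] := rtot _ (fU i); exists u'.
have rcomb c v v' : r v v' -> r (v - \sum_i c i *: f i) (v' - \sum_i c i *: g i).
  rewrite -!sumrN; elim/big_rec2: _ => [|i y y' _ IH h]; first by rewrite !addr0.
  rewrite !(addrCA _ (- _)) -!scaleNr; apply: rlin; first by case: (hg i).
  exact: IH.
have combU c : U (\sum_i c i *: f i).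
  by apply: subspace_sum => // i _; apply: subspaceZ.
have combU' c : U' (\sum_i c i *: g i).
  by apply: subspace_sum => // i _; apply: subspaceZ => //; case: (hg i).
exists g; split.
- by move=> i; case: (hg i).
- move=> u' /[dup] Uu' /rsur [u Uu ruu']; have [c hc] := fs _ Uu.
  by exists c; apply/(rW _ _ _ _ (rcomb c _ _ ruu')) => //; apply: subspaceB.
- move=> c hc; apply: (fi c); apply/(rW _ _ (combU c) (combU' c)) => //.
  have := rcomb (fun i => - c i) _ _ r0.
  rewrite !sub0r -!sumrN; under eq_bigr do rewrite scaleNr opprK.
  by under [X in r _ X]eq_bigr do rewrite scaleNr opprK.
Qed.

Lemma dimq_rel_iff (V V' : lmodType K) (U W : V -> Prop) (U' W' : V' -> Prop)
    (r : V -> V' -> Prop) n :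
  subspace U -> subspace U' ->
  (forall a u v u' v', r u u' -> r v v' -> r (a *: u + v) (a *: u' + v')) ->
  (forall u, U u -> exists2 u', U' u' & r u u') ->
  (forall u', U' u' -> exists2 u, U u & r u u') ->
  (forall u u', U u -> U' u' -> r u u' -> W u <-> W' u') ->
  dimq U W n <-> dimq U' W' n.
Proof.
move=> hU hU' rlin rtot rsur rW; split; first exact: (dimq_rel (r := r)).
apply: (dimq_rel (r := fun u' u => r u u')) => //; first by move=> *; apply: rlin.
by move=> u' u hu' hu h; split=> /(rW _ _ hu hu' h).
Qed.

Lemma dimq_pair (V1 V2 : lmodType K) (U1 W1 : V1 -> Prop) (U2 W2 : V2 -> Prop) n1 n2 :
  subspace U1 -> subspace U2 ->
  dimq U1 W1 n1 -> dimq U2 W2 n2 ->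
  dimq (fun v : V1 * V2 => U1 v.1 /\ U2 v.2) (fun v => W1 v.1 /\ W2 v.2) (n1 + n2).
Proof.
move=> hU1 hU2 [f1 [f1U f1s f1i]] [f2 [f2U f2s f2i]].
pose f := glue_ord (fun i => (f1 i, 0 : V2)) (fun i => (0 : V1, f2 i)).
have combE c : \sum_i c i *: f i =
    (\sum_i c (lshift n2 i) *: f1 i, \sum_i c (rshift n1 i) *: f2 i).
  rewrite /f sum_glue_ord; apply/eqP; rewrite -pair_eqE /pair_eq /= !raddf_sum /=.
  under [X in _ + X == _]eq_bigr do rewrite scaler0.
  under [X in X + _ == \sum_i c (rshift n1 i) *: f2 i]eq_bigr do rewrite scaler0.
  by rewrite !big1_eq addr0 add0r !eqxx.
exists f; split.
- move=> i; rewrite /f /glue_ord; case: (split i) => j /=; split=> //; exact: subspace0.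
- move=> [u v] /= [/f1s [c1 h1] /f2s [c2 h2]].
  exists (glue_ord c1 c2); rewrite combE /=.
  under eq_bigr do rewrite glue_ordl.
  by under [X in _ /\ W2 (v - X)]eq_bigr do rewrite glue_ordr.
- move=> c; rewrite combE /= => [[h1 h2]] i.
  rewrite -(splitK i); case: (split i) => j /=.
    exact: (f1i (fun j => c (lshift n2 j))).
  exact: (f2i (fun j => c (rshift n1 j))).
Qed.

Lemma dimq_ext (V : lmodType K) (U W U' W' : V -> Prop) n :
  (forall v, U v <-> U' v) -> (forall v, U v -> W v <-> W' v) -> subspace U ->
  dimq U W n -> dimq U' W' n.
Proof.
move=> e1 e2 hU [f [fU fs fi]]; exists f; split.
- by move=> i; apply/e1.
- move=> u /e1 /[dup] Uu /fs [c hc]; exists c; apply/e2 => //.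
  by apply: subspaceB => //; apply: subspace_sum => // i _; apply: subspaceZ.
- move=> c hc; apply: fi; apply/e2 => //.
  by apply: subspace_sum => // i _; apply: subspaceZ.
Qed.

Lemma dimq0 (V : lmodType K) (U W : V -> Prop) :
  (forall v, U v -> W v) -> W 0 -> dimq U W 0.
Proof.
move=> UW W0; exists (fun=> 0); split=> [[]//| |c _ []//].
by move=> u Uu; exists (fun=> 0); rewrite big_ord0 subr0; apply: UW.
Qed.

Lemma dimq0P (V : lmodType K) (U W : V -> Prop) :
  dimq U W 0 -> forall v, U v -> W v.
Proof. by move=> [f [_ fs _]] v /fs [c]; rewrite big_ord0 subr0. Qed.

Lemma dimq_rowspace m n1 n2 (A : 'M[K]_(n1, m)) (B : 'M[K]_(n2, m)) :
  (B <= A)%MS ->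
  dimq (fun v : 'rV_m => (v <= A)%MS) (fun v => (v <= B)%MS) (\rank A - \rank B).
Proof.
move=> BA; pose C := row_base (A :\: B)%MS.
have -> : (\rank A - \rank B)%N = \rank (A :\: B)%MS.
  by rewrite -(mxrank_cap_compl A B) (capmx_idPr BA) addKn.
have combE (c : 'I_(\rank (A :\: B)%MS) -> K) :
    \sum_i c i *: row i C = (\row_i c i) *m C.
  by rewrite mulmx_sum_row; apply: eq_bigr => i _; rewrite mxE.
exists (fun i => row i C); split.
- by move=> i; apply: submx_trans (row_sub _ _) _; rewrite eq_row_base diffmxSl.
- move=> u uA; have : (u <= A :\: B + A :&: B)%MS by rewrite addsmx_diff_cap_eq.
  case/sub_addsmxP => [[D E] /= eu].
  have : (D *m (A :\: B) <= C)%MS.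
    by apply: submx_trans (submxMl _ _) _; rewrite eq_row_base.
  case/submxP => D' eD; exists (fun i => D' 0 i); rewrite combE.
  rewrite (_ : \row_i _ = D'); last by apply/rowP => i; rewrite mxE.
  rewrite -eD eu addrAC subrr add0r; apply: submx_trans (submxMl _ _) _.
  exact: capmxSr.
- move=> c; rewrite combE; set w := _ *m C => hw.
  have : (w <= (A :\: B) :&: B)%MS.
    rewrite sub_capmx hw andbT; apply: submx_trans (submxMl _ _) _.
    by rewrite eq_row_base.
  rewrite capmx_diff submx0 => /eqP /(congr1 (mulmx^~ (pinvmx C))).
  rewrite mul0mx mulmxKp ?row_base_free // => e i.
  by have /rowP/(_ i) := e; rewrite !mxE.
Qed.

End Subquotients.

(** The pairs (k, l) and (l, k) are cancelled against each other. The diagonal is a separate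
    hypothesis, because antisymmetry does not make it vanish in characteristic 2. *)
Lemma sum_antisym (V : zmodType) (I : finType) (F : I -> I -> V) :
  (forall k, F k k = 0) -> (forall k l, F k l = - F l k) ->
  \sum_k \sum_l F k l = 0.
Proof.
move=> F0 FN; rewrite pair_bigA /=.
pose lt (p : I * I) := (enum_rank p.1 < enum_rank p.2)%N.
rewrite (bigID lt) /= [X in _ + X](bigID (fun p => p.1 == p.2)) /=.
rewrite [X in _ + (X + _)]big1 ?add0r; last first.
  by move=> [k l] /= /andP[_ /eqP ->].
have swap_inj : injective (fun p : I * I => (p.2, p.1)) by move=> [? ?] [? ?] [-> ->].
rewrite [X in _ + X](reindex_inj swap_inj) /=.
rewrite [X in _ + X](eq_big lt (fun p => - F p.1 p.2)) /=.
- by rewrite sumrN subrr.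
- move=> [k l]; rewrite /lt /= -leqNgt [RHS]ltn_neqAle andbC.
  by rewrite eq_sym (inj_eq val_inj) (inj_eq enum_rank_inj).
- by move=> [k l] _ /=.
Qed.

(** * Koszul homology *)

(* A graded vector space, the grading being given by the projections [gm_p],
   with commuting operators of degree 1, one for each element of I. *)
Record gmod (K : fieldType) (I : finType) := GMod {
  gm_car :> lmodType K;
  gm_X : I -> {linear gm_car -> gm_car};
  gm_p : nat -> {linear gm_car -> gm_car};
  gm_XC : forall k l m, gm_X k (gm_X l m) = gm_X l (gm_X k m);
  gm_pX : forall e k m, gm_p e.+1 (gm_X k m) = gm_X k (gm_p e m);
  gm_p0X : forall k m, gm_p 0 (gm_X k m) = 0;
  gm_pp : forall e m, gm_p e (gm_p e m) = gm_p e m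
}.

Record gsub (K : fieldType) (I : finType) (M : gmod K I) (B : M -> Prop) := GSub {
  gs_sub : subspace B;
  gs_X : forall k m, B m -> B (gm_X M k m);
  gs_p : forall e m, B m -> B (gm_p M e m)
}.

Section Koszul.
Variables (K : fieldType) (I : finType).

Definition before (k l : I) : bool := (enum_rank k < enum_rank l)%N.

Lemma before_total k l : k != l -> before l k = ~~ before k l.
Proof.
move=> nkl; rewrite /before -leqNgt [RHS]leq_eqVlt orbC.
by case: eqP => [/val_inj/enum_rank_inj e|_]; [rewrite e eqxx in nkl|rewrite orbF].
Qed.

Lemma before_irr k : before k k = false. Proof. exact: ltnn. Qed.

(** The sign s in e_k ^ e_T = s e_(k |: T), for k outside T, where monomials are ordered along
    [enum I]. *)
Definition sg (k : I) (T : {set I}) : K :=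
  \prod_(l in T) (if before l k then -1 else 1).

Lemma sgU k l (T : {set I}) : l \notin T -> sg k (l |: T) = (if before l k then -1 else 1) * sg k T.
Proof. by move=> h; rewrite /sg big_setU1. Qed.

Lemma sg_sq k T : sg k T * sg k T = 1.
Proof.
rewrite /sg -big_split big1 //= => l _.
by case: ifP; rewrite ?mulr1 // mulrNN mulr1.
Qed.

Lemma sg_swap k l (T : {set I}) : k != l -> k \notin T -> l \notin T ->
  sg k T * sg l (k |: T) = - (sg l T * sg k (l |: T)).
Proof.
move=> nkl nk nl; rewrite !sgU // (before_total nkl).
by case: (before k l); rewrite /= ?mulN1r ?mul1r ?mulrN ?opprK mulrC.
Qed.

Section Chains.
Variable M : gmod K I.
Notation X := (gm_X M).
Notation p := (gm_p M).
Definition chain := {ffun {set I} -> M}.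
Implicit Types (c d : chain) (T W : {set I}).

(* c T is the coefficient of the exterior monomial e_T. *)
Definition kd c : chain :=
  [ffun T : {set I} => \sum_(k | k \notin T) sg k T *: X k (c (k |: T))].

Definition wedge z c : chain :=
  [ffun T : {set I} => if z \in T then sg z (T :\ z) *: c (T :\ z) else 0].

Definition contr z c : chain :=
  [ffun T : {set I} => if z \in T then 0 else sg z T *: c (z |: T)].

Definition kdrop z c : chain := [ffun T : {set I} => if z \in T then 0 else c T].

Definition cX z c : chain := [ffun T => X z (c T)].

Definition cP i j c : chain := [ffun T : {set I} => if #|T| == i then p j (c T) else 0].

(** Restricting the Koszul complex to the variables in [W] is a condition on the support, so that a
    single space of chains serves for all [W]. *)
Definition ws W c := forall T, ~~ (T \subset W) -> c T = 0.

Lemma kd_linear a c d : kd (a *: c + d) = a *: kd c + kd d.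
Proof.
apply/ffunP => T; rewrite !ffunE scaler_sumr -big_split; apply: eq_bigr => k _ /=.
by rewrite !ffunE linearP scalerDr !scalerA mulrC.
Qed.

Lemma kd0 : kd 0 = 0.
Proof. by apply/ffunP => T; rewrite !ffunE big1 // => k _; rewrite ffunE linear0 scaler0. Qed.

Lemma kdD c d : kd (c + d) = kd c + kd d.
Proof. by rewrite -[c]scale1r kd_linear !scale1r. Qed.

Lemma kdN c : kd (- c) = - kd c.
Proof. by apply/eqP; rewrite -subr_eq0 opprK -kdD addNr kd0. Qed.

Lemma kdB c d : kd (c - d) = kd c - kd d.
Proof. by rewrite kdD kdN. Qed.

Lemma kdd c : kd (kd c) = 0.
Proof.
apply/ffunP => T; rewrite !ffunE.
pose F k l := if [&& k \notin T, l \notin T & k != l] then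
   (sg k T * sg l (k |: T)) *: X k (X l (c (l |: (k |: T)))) else 0.
transitivity (\sum_k \sum_l F k l); last first.
  apply: sum_antisym => k; first by rewrite /F eqxx !andbF.
  move=> l; rewrite /F eq_sym andbCA; case: ifP => [/and3P[nl nk nkl]|]; last by rewrite oppr0.
  by rewrite gm_XC sg_swap // 1?eq_sym // scaleNr setUCA.
rewrite big_mkcond; apply: eq_bigr => k _; case: ifP => nk; last first.
  by rewrite big1 // => l _; rewrite /F nk.
rewrite ffunE linear_sum scaler_sumr big_mkcond; apply: eq_bigr => l _.
rewrite /F nk !inE negb_or eq_sym /= andbC; case: ifP => // _.
by rewrite linearZ scalerA.
Qed.

Lemma wedge_linear z a c d : wedge z (a *: c + d) = a *: wedge z c + wedge z d.
Proof.
apply/ffunP => T; rewrite !ffunE; case: ifP => _; last by rewrite scaler0 addr0.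
by rewrite scalerDr !scalerA mulrC.
Qed.

Lemma contr_linear z a c d : contr z (a *: c + d) = a *: contr z c + contr z d.
Proof.
apply/ffunP => T; rewrite !ffunE; case: ifP => _; first by rewrite scaler0 addr0.
by rewrite scalerDr !scalerA mulrC.
Qed.

Lemma cP_linear i j a c d : cP i j (a *: c + d) = a *: cP i j c + cP i j d.
Proof.
by apply/ffunP => T; rewrite !ffunE; case: ifP => _; rewrite ?linearP // scaler0 addr0.
Qed.

Lemma cPD i j c d : cP i j (c + d) = cP i j c + cP i j d.
Proof. by rewrite -[c]scale1r cP_linear !scale1r. Qed.

Lemma cPN i j c : cP i j (- c) = - cP i j c.
Proof. by apply/ffunP => T; rewrite !ffunE; case: ifP => _; rewrite ?linearN // oppr0. Qed.

Lemma cPB i j c d : cP i j (c - d) = cP i j c - cP i j d.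
Proof. by rewrite cPD cPN. Qed.

Lemma cP_0 i j : cP i j 0 = 0.
Proof. by apply/ffunP => T; rewrite !ffunE linear0 if_same. Qed.

Lemma cP_id i j c : cP i j (cP i j c) = cP i j c.
Proof. by apply/ffunP => T; rewrite !ffunE; case: ifP => // ->; rewrite gm_pp. Qed.

Lemma kd_cP i j c : kd (cP i.+1 j c) = cP i j.+1 (kd c).
Proof.
apply/ffunP => T; rewrite !ffunE; case: ifP => cT.
  rewrite linear_sum; apply: eq_bigr => k nk /=.
  by rewrite ffunE cardsU1 nk add1n eqSS cT linearZ /= gm_pX.
by rewrite big1 // => k nk; rewrite ffunE cardsU1 nk add1n eqSS cT linear0 scaler0.
Qed.

Lemma kd_cP0 j c : kd (cP 0 j c) = 0.
Proof.
apply/ffunP => T; rewrite !ffunE big1 // => k nk.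
by rewrite ffunE cardsU1 nk linear0 scaler0.
Qed.

Lemma cX_cP z i j c : cX z (cP i j c) = cP i j.+1 (cX z c).
Proof. by apply/ffunP => T; rewrite !ffunE; case: ifP => _; rewrite ?gm_pX ?linear0. Qed.

Lemma kd_cX z c : kd (cX z c) = cX z (kd c).
Proof.
apply/ffunP => T; rewrite !ffunE linear_sum; apply: eq_bigr => k _.
by rewrite ffunE linearZ /= gm_XC.
Qed.

Lemma wedge_cP z i j c : wedge z (cP i j c) = cP i.+1 j (wedge z c).
Proof.
apply/ffunP => T; rewrite !ffunE; case: ifP => zT; last by rewrite linear0 if_same.
rewrite [in RHS](cardsD1 z T) zT add1n eqSS.
by case: ifP => _; rewrite ?linearZ // scaler0.
Qed.

Lemma contr_cP z i j c : contr z (cP i.+1 j c) = cP i j (contr z c).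
Proof.
apply/ffunP => T; rewrite !ffunE; case: ifP => zT; first by rewrite linear0 if_same.
by rewrite cardsU1 zT add1n eqSS; case: ifP => _; rewrite ?linearZ // scaler0.
Qed.

Lemma contr_cP0 z j c : contr z (cP 0 j c) = 0.
Proof.
by apply/ffunP => T; rewrite !ffunE; case: ifP => zT //; rewrite cardsU1 zT scaler0.
Qed.

Lemma drop_cP z i j c : kdrop z (cP i j c) = cP i j (kdrop z c).
Proof. by apply/ffunP => T; rewrite !ffunE; case: ifP => // _; rewrite linear0 if_same. Qed.

(** For [z] outside [T] only the term [k = z] of the differential survives. For [z] in [T] that term
    of [wedge z (kd c)] cancels [X z (c T)], and the remaining terms agree up to the sign of
    exchanging [k] and [z]. *)
Lemma kd_wedge z c : kd (wedge z c) = cX z c - wedge z (kd c).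
Proof.
apply/ffunP => T; rewrite !ffunE; case: ifP => zT; last first.
  rewrite subr0 (bigD1 z) ?zT //= big1 ?addr0.
    by rewrite ffunE setU11 setU1K ?zT // linearZ scalerA sg_sq scale1r.
  move=> k /andP[kT kz]; rewrite ffunE !inE eq_sym (negbTE kz) zT.
  by rewrite linear0 scaler0.
have zTz : z \notin T :\ z by rewrite !inE eqxx.
rewrite [X in _ = _ - _ *: X](bigD1 z) //= scalerDr scalerA sg_sq scale1r setD1K // opprD addrA
  subrr sub0r.
rewrite scaler_sumr -sumrN; apply: eq_big => k.
  by rewrite !inE; case: eqP => [->|]; rewrite ?zT //= andbT.
move=> kT; have nkz : k != z by apply: contraNneq kT => ->.
have kTz : k \notin T :\ z by rewrite !inE negb_and kT orbT.
have e : (k |: T) :\ z = k |: (T :\ z).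
  by apply/setP => x; rewrite !inE; case: (eqVneq x k) => [->|]; rewrite /= ?nkz ?andbT.
rewrite ffunE !inE zT orbT e linearZ /= !scalerA -scaleNr; congr (_ *: _).
rewrite -[in sg k T](setD1K zT) !sgU // (before_total nkz).
by case: (before k z); rewrite /= ?mulN1r ?mul1r ?mulrN ?mulNr mulrC.
Qed.

Lemma kd_ws W c : ws W c -> ws W (kd c).
Proof.
move=> h T nT; rewrite ffunE big1 // => k _; rewrite h ?linear0 ?scaler0 //.
by apply: contra nT; apply: subset_trans; apply: subsetUr.
Qed.

Lemma cX_ws W z c : ws W c -> ws W (cX z c).
Proof. by move=> h T nT; rewrite ffunE h // linear0. Qed.

Lemma cP_ws W i j c : ws W c -> ws W (cP i j c).
Proof. by move=> h T nT; rewrite ffunE h // linear0 if_same. Qed.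

Lemma wedge_ws W z c : z \in W -> ws W c -> ws W (wedge z c).
Proof.
move=> zW h T nT; rewrite ffunE; case: ifP => // zT; rewrite h ?scaler0 //.
by apply: contra nT => hT; rewrite -(setD1K zT) subUset sub1set zW.
Qed.

Lemma ws_sub W W' c : W \subset W' -> ws W c -> ws W' c.
Proof. by move=> s h T nT; apply: h; apply: contra nT => /subset_trans; apply. Qed.

Lemma drop_ws W z c : ws (z |: W) c -> ws W (kdrop z c).
Proof.
move=> h T nT; rewrite ffunE; case: ifP => // zT; apply: h; apply: contra nT.
by move=> /subsetP s; apply/subsetP => x xT; have := s x xT; rewrite !inE; case: eqP => // e;
  rewrite -e xT in zT.
Qed.

Lemma contr_ws W z c : ws (z |: W) c -> ws W (contr z c).
Proof.
move=> h T nT; rewrite ffunE; case: ifP => // zT; rewrite h ?scaler0 //; apply: contra nT.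
move=> /subsetP s; apply/subsetP => x xT; have := s x; rewrite !inE xT orbT => /(_ isT).
by case: eqP => // e; rewrite -e xT in zT.
Qed.

Lemma drop_contr z c : c = kdrop z c + wedge z (contr z c).
Proof.
apply/ffunP => T; rewrite !ffunE; case: ifP => zT; last by rewrite addr0.
by rewrite !inE eqxx add0r scalerA sg_sq scale1r setD1K.
Qed.

Lemma contr_wedge W z c : z \notin W -> ws W c -> contr z (wedge z c) = c.
Proof.
move=> zW h; apply/ffunP => T; rewrite !ffunE; case: ifP => zT.
  by rewrite h //; apply: contra zW => /subsetP; apply.
by rewrite setU11 setU1K ?zT // scalerA sg_sq scale1r.
Qed.

Lemma contr_0 W z c : z \notin W -> ws W c -> contr z c = 0.
Proof.
move=> zW h; apply/ffunP => T; rewrite !ffunE; case: ifP => zT //.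
by rewrite h ?scaler0 // subUset sub1set (negbTE zW).
Qed.

Definition cin (B : M -> Prop) c := forall T, B (c T).

(* The Koszul complex on the variables in W of M / B: exterior degree i,
   coefficients of degree j. Boundaries need not be homogeneous, see [BndP]. *)
Definition Cyc B W i j c := [/\ ws W c, cP i j c = c & cin B (kd c)].
Definition Bnd B W c := exists2 c', ws W c' & cin B (c - kd c').
Definition hdim B W i j n := dimq (Cyc B W i j) (Bnd B W) n.

Lemma ws_subspace W : subspace (ws W).
Proof.
split=> [T _|a u v hu hv T nT]; first by rewrite ffunE.
by rewrite !ffunE hu // hv // scaler0 addr0.
Qed.

Section Cin.
Variable B : M -> Prop.
Hypothesis hB : gsub B.
Let sB := gs_sub hB.

Lemma cin_subspace : subspace (cin B).
Proof.
split=> [T|a u v hu hv T]; first by rewrite ffunE; apply: subspace0.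
by rewrite !ffunE; apply: sB.2.
Qed.

Lemma cin_kd c : cin B c -> cin B (kd c).
Proof.
move=> h T; rewrite ffunE; apply: subspace_sum => // k _; apply: subspaceZ => //.
exact: (gs_X hB).
Qed.

Lemma cin_cP i j c : cin B c -> cin B (cP i j c).
Proof. by move=> h T; rewrite ffunE; case: ifP => _; [apply: (gs_p hB) | apply: subspace0]. Qed.

Lemma cin_wedge z c : cin B c -> cin B (wedge z c).
Proof.
by move=> h T; rewrite ffunE; case: ifP => _; [apply: subspaceZ | apply: subspace0].
Qed.

Lemma Cyc_subspace W i j : subspace (Cyc B W i j).
Proof.
split; first split.
- by move=> T _; rewrite ffunE.
- by apply/ffunP => T; rewrite !ffunE linear0 if_same.
- by rewrite kd0; apply: subspace0 cin_subspace.
move=> a u v [wu pu ku] [wv pv kv]; split.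
- exact: (ws_subspace W).2.
- by rewrite cP_linear pu pv.
- by rewrite kd_linear; apply: cin_subspace.2.
Qed.

Lemma Bnd_subspace W : subspace (Bnd B W).
Proof.
split.
  by exists 0; [apply: subspace0 (ws_subspace W)|rewrite kd0 subr0; apply: subspace0 cin_subspace].
move=> a u v [u' wu hu] [v' wv hv]; exists (a *: u' + v').
  exact: (ws_subspace W).2.
rewrite kd_linear opprD addrACA -scalerBr; exact: cin_subspace.2.
Qed.

Lemma BndP W i j c : cP i j.+1 c = c ->
  Bnd B W c <-> exists c', [/\ ws W c', cP i.+1 j c' = c' & cin B (c - kd c')].
Proof.
move=> pc; split=> [[c' w' h]|[c' [w' _ h]]]; last by exists c'.
exists (cP i.+1 j c'); split; [exact: cP_ws | exact: cP_id |].
by rewrite kd_cP -[c in c - _]pc -cPB; apply: cin_cP.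
Qed.

End Cin.
End Chains.

Definition vanishing (M : gmod K I) (B : M -> Prop) W i j :=
  forall c, Cyc B W i j c -> Bnd B W c.

Lemma hdim0P (M : gmod K I) (B : M -> Prop) W i j : gsub B ->
  hdim B W i j 0 <-> vanishing B W i j.
Proof.
move=> hB; split=> h; first exact: dimq0P h.
by apply: dimq0 => //; apply: subspace0; apply: Bnd_subspace.
Qed.

Definition addX (M : gmod K I) (B : M -> Prop) z (m : M) :=
  exists b m', B b /\ m = b + gm_X M z m'.

Definition colonX (M : gmod K I) (B : M -> Prop) z (m : M) := B (gm_X M z m).

(** * Vanishing of Koszul homology along nonzerodivisors and colon submodules *)

Section Vanishing.
Implicit Type W : {set I}.
Variables (M : gmod K I) (B : M -> Prop).
Hypothesis hB : gsub B.
Let sB := gs_sub hB.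

Lemma addX_gsub z : gsub (addX B z).
Proof.
split.
- split; first by exists 0, 0; split; [exact: subspace0|rewrite linear0 addr0].
  move=> a _ _ [b [m [hb ->]]] [b' [m' [hb' ->]]]; exists (a *: b + b'), (a *: m + m'); split.
    exact: sB.2.
  by rewrite linearP scalerDr addrACA.
- move=> k _ [b [m [hb ->]]]; exists (gm_X M k b), (gm_X M k m); split.
    exact: gs_X.
  by rewrite linearD /= gm_XC.
- move=> [|e] _ [b [m [hb ->]]].
    by exists (gm_p M 0 b), 0; split; [exact: gs_p|rewrite linearD /= gm_p0X linear0].
  by exists (gm_p M e.+1 b), (gm_p M e m); split; [exact: gs_p|rewrite linearD /= gm_pX].
Qed.

Lemma colonX_gsub z : gsub (colonX B z).
Proof.
rewrite /colonX; split.
- by split; [rewrite linear0; exact: subspace0|move=> a u v hu hv; rewrite linearP; exact: sB.2].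
- by move=> k m hm; rewrite gm_XC; apply: gs_X.
- by move=> e m hm; rewrite -gm_pX; apply: gs_p.
Qed.

Lemma cin_addX W z c : ws W c -> cin (addX B z) c -> exists b m, [/\ ws W b, ws W m,
  cin B b & c = b + cX z m].
Proof.
move=> wc h; have /fin_all_exists [f hf] : forall T, exists bm,
  B bm.1 /\ c T = bm.1 + gm_X M z bm.2.
  by move=> T; have [b [m [hb e]]] := h T; exists (b, m).
exists [ffun T : {set I} => if T \subset W then (f T).1 else 0],
  [ffun T : {set I} => if T \subset W then (f T).2 else 0].
split.
- by move=> T /negbTE nT; rewrite ffunE nT.
- by move=> T /negbTE nT; rewrite ffunE nT.
- by move=> T; rewrite ffunE; case: ifP => _; [case: (hf T)|exact: subspace0].
- apply/ffunP => T; rewrite !ffunE; case: ifP => sT; first by case: (hf T).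
  by rewrite linear0 addr0 wc ?sT.
Qed.

(* wedge z is a null-homotopy of the multiplication by X z. *)
Lemma vanishing_nzd W z i j : z \in W -> (forall m, colonX B z m -> B m) ->
  vanishing (addX B z) W i.+1 j -> vanishing B W i j.
Proof.
move=> zW nzd van c [wc pc hc].
have sC := cin_subspace hB.
have hC : Cyc (addX B z) W i.+1 j (wedge z c).
  split; first exact: wedge_ws.
    by rewrite -wedge_cP pc.
  move=> T; rewrite kd_wedge; exists (- wedge z (kd c) T), (c T).
  split; last by rewrite [in LHS]ffunE [X in X + _]ffunE [X in _ + X]ffunE addrC.
  by apply: subspaceN => //; apply: cin_wedge.
have [c' wc' h] := van _ hC.
have [|b [m [wb wm hb e]]] := @cin_addX W z _ _ h.
  by apply: (subspaceB (ws_subspace M W)); [exact: wedge_ws|exact: kd_ws].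
(* With [wedge z c - kd c' = b + X z m], applying [kd] shows that [X z (c - kd m)] has coefficients
   in [B]; so [m] bounds [c]. *)
exists m => // T; apply: nzd; rewrite /colonX.
have : kd (wedge z c - kd c') = kd (b + cX z m) by rewrite e.
rewrite kdB kdd subr0 kd_wedge kdD kd_cX => /ffunP/(_ T).
have hw : cin B (kd b + wedge z (kd c)).
  by apply: (subspaceD sC); [exact: cin_kd | exact: cin_wedge].
have := hw T; rewrite !ffunE => hw' e'.
rewrite linearB /=; move: e' => /eqP; rewrite subr_eq addrAC -subr_eq => /eqP ->; exact: hw'.
Qed.

(** The outer terms of 0 -> M/(B : X z)(-1) -> M/B -> M/(B + X z M) -> 0 have no homology in the
    bidegree considered. The twist is the reason for [j] on the left against [j.+1]. *)
Lemma vanishing_colon W z i j :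
  vanishing (colonX B z) W i j -> vanishing (addX B z) W i j.+1 -> vanishing B W i j.+1.
Proof.
move=> van1 van2 c [wc pc hc].
have hC : Cyc (addX B z) W i j.+1 c.
  split=> // T; exists (kd c T), 0; split=> //; by rewrite linear0 addr0.
have [c' wc' h] := van2 _ hC.
have [|b [m [wb wm hb e]]] := @cin_addX W z _ _ h.
  by apply: (subspaceB (ws_subspace M W)) => //; exact: kd_ws.
have hm : Cyc (colonX B z) W i j (cP i j m).
  split; [exact: cP_ws|exact: cP_id|].
  move=> T; rewrite /colonX.
  have : cin B (kd (cP i j.+1 (c - kd c' - b))).
    rewrite !cPB !kdB pc; apply: (subspaceB (cin_subspace hB)); last first.
      exact: (cin_kd hB (cin_cP hB _ _ hb)).
    apply: (subspaceB (cin_subspace hB)) => //.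
    by rewrite -kd_cP kdd; apply: subspace0 (cin_subspace hB).
  rewrite e addrAC subrr add0r -cX_cP kd_cX => /(_ T).
  by rewrite [X in B X -> _]ffunE.
have [m' wm' h'] := van1 _ hm.
exists (cP i.+1 j c' + cX z m').
  by apply: (subspaceD (ws_subspace M W)); [exact: cP_ws|exact: cX_ws].
have -> : c = cP i j.+1 (kd c') + (cP i j.+1 b + cX z (cP i j m)).
  by rewrite cX_cP -!cPD -e addrC subrK.
rewrite kdD kd_cP kd_cX opprD addrACA subrr add0r -addrA.
apply: (subspaceD (cin_subspace hB)); first exact: (cin_cP hB).
by move=> T; have := h' T; rewrite /colonX !ffunE linearB.
Qed.

End Vanishing.
End Koszul.

(** * Variables acting by zero, and the Mayer-Vietoris sequence *)

Section Kill.
Variables (K : fieldType) (I : finType) (M : gmod K I) (B : M -> Prop).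
Hypothesis hB : gsub B.
Variables (W : {set I}) (z : I).
Hypotheses (zW : z \notin W) (zB : forall m, B (gm_X M z m)).
Let sB := gs_sub hB.
Let sC := cin_subspace hB.

Lemma contrD (c d : chain M) : contr z (c + d) = contr z c + contr z d.
Proof. by rewrite -[c]scale1r contr_linear !scale1r. Qed.

Lemma cin_contr (c : chain M) : cin B c -> cin B (contr z c).
Proof.
by move=> h T; rewrite ffunE; case: ifP => _; [apply: subspace0 | apply: subspaceZ].
Qed.

Lemma cin_drop_wedge (a b : chain M) : ws W a -> ws W b ->
  cin B (a + wedge z b) <-> cin B a /\ cin B b.
Proof.
move=> wa wb; split=> [h|[ha hb]]; last first.
  by apply: (subspaceD sC) => //; apply: cin_wedge.
have hb : cin B b.
  by have := cin_contr h; rewrite contrD (contr_0 zW wa) add0r (contr_wedge zW wb).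
split=> //; rewrite -[a](addrK (wedge z b)); apply: (subspaceB sC) => //.
exact: cin_wedge.
Qed.

Lemma cin_killed c : cin B (cX z c).
Proof. by move=> T; rewrite ffunE. Qed.

Lemma wedgeB (c d : chain M) : wedge z (c - d) = wedge z c - wedge z d.
Proof. by rewrite addrC -scaleN1r wedge_linear scaleN1r addrC. Qed.

Lemma wedge0 : wedge z (0 : chain M) = 0.
Proof. by apply/ffunP => T; rewrite !ffunE scaler0 if_same. Qed.

Lemma wedgeN (c : chain M) : wedge z (- c) = - wedge z c.
Proof. by rewrite -sub0r wedgeB wedge0 sub0r. Qed.

(** Modulo [B] the term [X z b] of [kd_wedge] disappears and [kd (a + wedge z b)] becomes
    [kd a - wedge z (kd b)]: the complex on [z |: W] is the direct sum of the complex on [W] and a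
    shifted copy of it. *)
Lemma kd_drop_wedge (a b : chain M) : ws W a -> ws W b ->
  cin B (kd (a + wedge z b)) <-> cin B (kd a) /\ cin B (kd b).
Proof.
move=> wa wb; have wb' : ws W (- kd b).
  by apply: (subspaceN (ws_subspace M W)); apply: kd_ws.
have e : kd (a + wedge z b) = (kd a + wedge z (- kd b)) + cX z b.
  by rewrite kdD kd_wedge wedgeN addrA addrAC.
have e2 : cin B (- kd b) <-> cin B (kd b).
  by split=> h; [rewrite -[kd b]opprK|]; apply: (subspaceN sC).
rewrite e -e2 -(cin_drop_wedge (kd_ws wa) wb'); split=> h.
  rewrite -[X in cin _ X](addrK (cX z b)); apply: (subspaceB sC) => //.
  exact: cin_killed.
by apply: (subspaceD sC) => //; exact: cin_killed.
Qed.

Lemma Bnd_drop_wedge (a b : chain M) : ws W a -> ws W b ->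
  Bnd B (z |: W) (a + wedge z b) <-> Bnd B W a /\ Bnd B W b.
Proof.
move=> wa wb.
(* The minus sign makes [d1] bound [b] itself: [kd (d0 - wedge z d1)] is [kd d0 + wedge z (kd d1)]
   modulo [B]. *)
have key d0 d1 : ws W d0 -> ws W d1 ->
   cin B (a + wedge z b - kd (d0 - wedge z d1)) <-> cin B (a - kd d0) /\ cin B (b - kd d1).
  move=> w0 w1.
  have wa' : ws W (a - kd d0) by apply: (subspaceB (ws_subspace M W)) => //; apply: kd_ws.
  have wb' : ws W (b - kd d1) by apply: (subspaceB (ws_subspace M W)) => //; apply: kd_ws.
  rewrite -(cin_drop_wedge wa' wb') wedgeB kdB kd_wedge.
  have -> : a + wedge z b - (kd d0 - (cX z d1 - wedge z (kd d1))) =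
     (a - kd d0 + (wedge z b - wedge z (kd d1))) + cX z d1.
    rewrite opprB -!addrA; congr (_ + _); rewrite [RHS]addrC -!addrA.
    by congr (_ + _); rewrite addrCA.
  split=> h; last by apply: (subspaceD sC) => //; exact: cin_killed.
  rewrite -[X in cin _ X](addrK (cX z d1)); apply: (subspaceB sC) => //.
  exact: cin_killed.
split=> [[d wd]|[[d0 w0 h0] [d1 w1 h1]]].
  pose d1 := - contr z d.
  have w1 : ws W d1.
    by apply: (subspaceN (ws_subspace M W)); apply: contr_ws.
  have ed : d = kdrop z d - wedge z d1.
    by rewrite {1}(drop_contr z d) /d1 wedgeN opprK.
  rewrite ed => /(key _ _ (drop_ws wd) w1) [h0 h1].
  by split; [exists (kdrop z d) => //; exact: drop_ws | exists d1].
exists (d0 - wedge z d1); last by apply/key.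
apply: (subspaceB (ws_subspace M _)); first exact: ws_sub (subsetUr _ _) w0.
by apply: wedge_ws; [rewrite setU11 | exact: ws_sub (subsetUr _ _) w1].
Qed.

Lemma hdim_kill i j n1 n2 :
  hdim B W i.+1 j n1 -> hdim B W i j n2 -> hdim B (z |: W) i.+1 j (n1 + n2).
Proof.
move=> h1 h2; have := dimq_pair (Cyc_subspace hB W _ _) (Cyc_subspace hB W _ _) h1 h2.
have s1 := Cyc_subspace hB W i.+1 j; have s2 := Cyc_subspace hB W i j.
apply: (@dimq_rel _ _ _ _ _ _ _ (fun u (c : chain M) => c = u.1 + wedge z u.2)).
- split; first by split; apply: subspace0.
  by move=> a u v [? ?] [? ?]; split; [apply: s1.2|apply: s2.2].
- exact: Cyc_subspace.
- move=> a u v u' v' -> ->; rewrite /= wedge_linear scalerDr addrACA //.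
- move=> [a b] /= [[wa pa ka] [wb pb kb]]; exists (a + wedge z b) => //; split.
  + apply: (subspaceD (ws_subspace M _)); first exact: ws_sub (subsetUr _ _) wa.
    by apply: wedge_ws; [rewrite setU11 | exact: ws_sub (subsetUr _ _) wb].
  + by rewrite cPD -wedge_cP pa pb.
  + exact/kd_drop_wedge.
- move=> c [wc pc kc]; exists (kdrop z c, contr z c) => /=; last exact: drop_contr.
  move: kc; rewrite {1}(drop_contr z c) => /(kd_drop_wedge (drop_ws wc) (contr_ws wc)) [k1 k2].
  split; split=> //; [exact: drop_ws | | exact: contr_ws |].
    by rewrite -drop_cP pc.
  by rewrite -contr_cP pc.
- move=> [a b] c /= [[wa _ _] [wb _ _]] _ ->.
  by rewrite Bnd_drop_wedge.
Qed.

Lemma hdim_kill0 j n : hdim B W 0 j n -> hdim B (z |: W) 0 j n.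
Proof.
have e0 : wedge z 0 = 0 :> chain M.
  by apply/ffunP => T; rewrite !ffunE scaler0 if_same.
have w0 : ws W (0 : chain M) by move=> T _; rewrite ffunE.
apply: dimq_ext; last exact: Cyc_subspace.
- move=> c; split=> [[wc pc kc]|[wc pc kc]]; split=> //.
    exact: ws_sub (subsetUr _ _) wc.
  have : contr z c = 0 by rewrite -pc contr_cP0.
  by move=> ec; rewrite (drop_contr z c) ec e0 addr0; apply: drop_ws.
- move=> c [wc _ _]; rewrite -[c in Bnd _ (_ |: _) c]addr0 -e0 Bnd_drop_wedge //.
  split=> [h|[]//]; split=> //; exists 0 => //.
  by rewrite kd0 subr0; apply: subspace0 sC.
Qed.

End Kill.

(** * Koszul homology under maps inducing an isomorphism of quotients *)

Section PairIso.
Variables (K : fieldType) (I : finType) (M M' : gmod K I).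
Variables (B : M -> Prop) (B' : M' -> Prop) (g : {linear M -> M'}).
Hypotheses (hB : gsub B) (hB' : gsub B').
Hypothesis gX : forall k m, g (gm_X M k m) = gm_X M' k (g m).
Hypothesis gp : forall e m, g (gm_p M e m) = gm_p M' e (g m).
Hypothesis gB : forall m, B m <-> B' (g m).
Hypothesis gsurj : forall m', exists m, B' (m' - g m).

Definition cmap (c : chain M) : chain M' := [ffun T => g (c T)].

Lemma cmap_kd c : cmap (kd c) = kd (cmap c).
Proof.
apply/ffunP => T; rewrite !ffunE linear_sum; apply: eq_bigr => k _.
by rewrite ffunE linearZ gX.
Qed.

Lemma cmap_cP i j c : cmap (cP i j c) = cP i j (cmap c).
Proof. by apply/ffunP => T; rewrite !ffunE; case: ifP => _; rewrite ?gp ?linear0. Qed.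

Lemma cmap_ws W c : ws W c -> ws W (cmap c).
Proof. by move=> h T nT; rewrite ffunE h // linear0. Qed.

Lemma cmap_linear a c d : cmap (a *: c + d) = a *: cmap c + cmap d.
Proof. by apply/ffunP => T; rewrite !ffunE linearP. Qed.

Lemma cmapB c d : cmap (c - d) = cmap c - cmap d.
Proof. by apply/ffunP => T; rewrite !ffunE linearB. Qed.

Lemma cmap_cin c : cin B c <-> cin B' (cmap c).
Proof. by split=> h T; have := h T; rewrite ffunE gB. Qed.

Lemma cmap_lift W c' : ws W c' -> exists2 c, ws W c & cin B' (c' - cmap c).
Proof.
move=> wc; have /fin_all_exists [f hf] : forall T, exists m, B' (c' T - g m) by move=> T.
exists [ffun T : {set I} => if T \subset W then f T else 0].
  by move=> T /negbTE nT; rewrite ffunE nT.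
move=> T; rewrite !ffunE; case: ifP => // nT.
by rewrite linear0 subr0 wc ?nT //; apply: subspace0; exact: gs_sub.
Qed.

Lemma hdim_iso W i j n : hdim B W i j n <-> hdim B' W i j n.
Proof.
have sC' := cin_subspace hB'.
apply: (@dimq_rel_iff _ _ _ _ _ _ _ (fun c c' => cin B' (c' - cmap c))).
- exact: Cyc_subspace.
- exact: Cyc_subspace.
- move=> a u v u' v' h h'; rewrite cmap_linear opprD addrACA -scalerBr.
  exact: sC'.2.
- move=> c [wc pc kc]; exists (cmap c); last by rewrite subrr; apply: subspace0 sC'.
  by split; [exact: cmap_ws|rewrite -cmap_cP pc|rewrite -cmap_kd; apply/cmap_cin].
- move=> c' [wc pc kc]; have [c wc' h] := cmap_lift wc.
  have h' : cin B' (c' - cmap (cP i j c)).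
    by rewrite cmap_cP -{1}pc -cPB; apply: cin_cP.
  exists (cP i j c) => //; split; [exact: cP_ws|exact: cP_id|].
  apply/cmap_cin; rewrite cmap_kd -[cmap _](subKr c') kdB.
  by apply: (subspaceB sC') => //; apply: cin_kd.
- move=> c c' _ _ h; split=> [[d wd hd]|[d' wd' hd']].
    exists (cmap d); first exact: cmap_ws.
    rewrite -(subrK (cmap c) c') -addrA; apply: (subspaceD sC') => //.
    by rewrite -cmap_kd -cmapB; apply/cmap_cin.
  have [d wd hd] := cmap_lift wd'.
  exists d => //; apply/cmap_cin; rewrite cmapB cmap_kd.
  have -> : cmap c - kd (cmap d) =
      (c' - kd d') - (c' - cmap c) + kd (d' - cmap d).
    by rewrite kdB opprB [_ + (cmap c - c')]addrC !addrA !subrK.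
  apply: (subspaceD sC'); last exact: cin_kd.
  exact: (subspaceB sC').
Qed.

End PairIso.

(** * The exact sequence of G = A meet B and Q = A + B *)

Section MayerVietoris.
Variables (K : fieldType) (I : finType) (M : gmod K I).
Variables (G A B Q : M -> Prop) (W : {set I}).
Hypotheses (hG : gsub G) (hA : gsub A) (hB : gsub B) (hQ : gsub Q).
Hypothesis GE : forall m, G m <-> A m /\ B m.
Hypothesis QE : forall m, Q m <-> exists a b, [/\ A a, B b & m = a + b].
Let sA := cin_subspace hA.
Let sB := cin_subspace hB.
Let sQ := cin_subspace hQ.
Let sW := ws_subspace M W.

Lemma cinG c : cin G c <-> cin A c /\ cin B c.
Proof.
split=> [h|[ha hb] T]; last by apply/GE.
by split=> T; have /GE [] := h T.
Qed.

Lemma cinAQ c : cin A c -> cin Q c.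
Proof.
move=> h T; apply/QE; exists (c T), 0; split; rewrite ?addr0 //.
by apply: subspace0; apply: gs_sub.
Qed.

Lemma cinBQ c : cin B c -> cin Q c.
Proof.
move=> h T; apply/QE; exists 0, (c T); split; rewrite ?add0r //.
by apply: subspace0; apply: gs_sub.
Qed.

Lemma cinQ_split i j c : ws W c -> cP i j c = c -> cin Q c ->
  exists a b, [/\ ws W a, cP i j a = a, cin A a, cin B b & c = a + b].
Proof.
move=> wc pc h.
have /fin_all_exists [f hf] : forall T, exists ab, [/\ A ab.1, B ab.2 & c T = ab.1 + ab.2].
  by move=> T; have /QE [a [b ?]] := h T; exists (a, b).
pose a : chain M := [ffun T : {set I} => if T \subset W then (f T).1 else 0].
pose b : chain M := [ffun T : {set I} => if T \subset W then (f T).2 else 0].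
have wa : ws W a by move=> T /negbTE nT; rewrite ffunE nT.
have ha : cin A a.
  by move=> T; rewrite ffunE; case: ifP => _; [case: (hf T)|apply: subspace0; apply: gs_sub].
have hb : cin B b.
  by move=> T; rewrite ffunE; case: ifP => _; [case: (hf T)|apply: subspace0; apply: gs_sub].
have e : c = a + b.
  apply/ffunP => T; rewrite !ffunE; case: ifP => sT; first by case: (hf T).
  by rewrite addr0 wc ?sT.
exists (cP i j a), (cP i j b); split.
- exact: cP_ws.
- exact: cP_id.
- exact: cin_cP.
- exact: cin_cP.
- by rewrite -cPD -e pc.
Qed.

Lemma CycGA i j c : Cyc G W i j c -> Cyc A W i j c.
Proof. by case=> ? ? /cinG[]. Qed.

Lemma CycGB i j c : Cyc G W i j c -> Cyc B W i j c.
Proof. by case=> ? ? /cinG[]. Qed.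

Lemma CycAQ i j c : Cyc A W i j c -> Cyc Q W i j c.
Proof. by case=> ? ? /cinAQ. Qed.

Lemma CycBQ i j c : Cyc B W i j c -> Cyc Q W i j c.
Proof. by case=> ? ? /cinBQ. Qed.

Lemma BndGA c : Bnd G W c -> Bnd A W c.
Proof. by case=> d wd /cinG[ha _]; exists d. Qed.

Lemma BndGB c : Bnd G W c -> Bnd B W c.
Proof. by case=> d wd /cinG[_ hb]; exists d. Qed.

Lemma Bnd_cin (C : M -> Prop) c : cin C c -> Bnd C W c.
Proof. by move=> h; exists 0; [apply: subspace0 sW | rewrite kd0 subr0]. Qed.

Lemma Bnd_kd (C : M -> Prop) c : gsub C -> ws W c -> Bnd C W (kd c).
Proof. by move=> hC h; exists c => //; rewrite subrr; apply: subspace0; apply: cin_subspace. Qed.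

(* Surjectivity of H(G) -> H(A) (+) H(B) on the classes (0, b). *)
Lemma mv_surj i j b : vanishing Q W i j.+1 -> Cyc B W i j.+1 b ->
  exists c, [/\ Cyc G W i j.+1 c, cin A c & Bnd B W (c - b)].
Proof.
move=> vQ /[dup] hb [wb pb kb].
have /(BndP hQ _ pb) [d [wd pd hd]] := vQ _ (CycBQ hb).
have [||a [b' [wa pa ha hb' e]]] := cinQ_split (i := i) (j := j.+1) _ _ hd.
- by apply: (subspaceB sW) => //; apply: kd_ws.
- by rewrite cPB pb -kd_cP pd.
have ea : a = b - kd d - b' by rewrite e addrK.
(* The lift is [a]: its coefficients are in [A], and it differs from [b] by the boundary of [d] and
   a chain with coefficients in [B]. *)
exists a; split=> //.
  split=> //; apply/cinG; split; first exact: cin_kd.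
  rewrite ea !kdB kdd subr0; apply: (subspaceB sB) => //; exact: cin_kd.
rewrite ea addrAC [b - _ - b]addrAC subrr sub0r -opprD.
apply: (subspaceN (Bnd_subspace hB W)); apply: (subspaceD (Bnd_subspace hB W)).
  exact: Bnd_kd.
exact: Bnd_cin.
Qed.

(** In H_(i+1,j)(Q) -> H_(i,j+1)(G) -> H_(i,j+1)(A) (+) H_(i,j+1)(B) -> H_(i,j+1)(Q) the outer terms
    and the summand of [A] vanish. *)
Lemma mv_iso i j n :
  vanishing Q W i.+1 j -> vanishing Q W i j.+1 -> vanishing A W i j.+1 ->
  hdim B W i j.+1 n -> hdim G W i j.+1 n.
Proof.
move=> vQ1 vQ vA.
apply: (@dimq_rel _ _ _ _ _ _ _ (fun b c => Bnd B W (c - b))).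
- exact: Cyc_subspace.
- exact: Cyc_subspace.
- move=> a u v u' v' h h'; rewrite opprD addrACA -scalerBr.
  exact: (Bnd_subspace hB W).2.
- by move=> b /(mv_surj vQ) [c [hc _ h]]; exists c.
- move=> c hc; exists c; first exact: CycGB.
  by rewrite subrr; apply: subspace0; apply: Bnd_subspace.
move=> b c _ hc hbc; have hcb : Bnd B W c <-> Bnd B W b.
  split=> h; first by rewrite -[b](subKr c); apply: (subspaceB (Bnd_subspace hB W)).
  by apply: (subspace_subr (Bnd_subspace hB W) h hbc).
rewrite -hcb; split; last exact: BndGB.
have pc : cP i j.+1 c = c by case: hc.
move=> /(BndP hB _ pc) [e [we pe he]].
have /(BndP hA _ pc) [d [wd pd hd]] := vA _ (CycGA hc).
(* [c] is bounded by [d] modulo [A] and by [e] modulo [B], so [d - e] is a cycle modulo [Q]. It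
   bounds, hence up to a boundary it is [a + b'] with [a] in [A] and [b'] in [B]; then [d - a]
   bounds [c] modulo both. *)
have wde : ws W (d - e) by apply: (subspaceB sW).
have hde : kd (d - e) = (c - kd e) - (c - kd d).
  by rewrite kdB opprB [RHS]addrC addrA subrK.
have : Cyc Q W i.+1 j (d - e).
  split=> //; first by rewrite cPB pd pe.
  by rewrite hde; apply: (subspaceB sQ); [apply: cinBQ|apply: cinAQ].
move/vQ1 => [f wf hf].
have [|a [b' [wa pa ha hb' ee]]] := cinQ_split (i := i.+1) (j :=
  j) _ (cP_id _ _ _) (cin_cP hQ i.+1 j hf).
  by apply: cP_ws; apply: (subspaceB sW) => //; apply: kd_ws.
have hk : kd (d - e) = kd a + kd b'.
  by rewrite -kdD -ee !cPB pd pe [RHS]kdB kd_cP kdd cP_0 subr0.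
exists (d - a); first exact: (subspaceB sW).
apply/cinG; split.
  by rewrite kdB opprB addrCA addrC; apply: (subspaceD sA) => //; apply: cin_kd.
have -> : c - kd (d - a) = (c - kd e) - kd b'.
  have ed : kd d = kd a + kd b' + kd e by rewrite -hk -kdD subrK.
  by rewrite kdB ed -[kd a + _ + _]addrA [kd a + _]addrC addrK opprD addrA addrAC.
by apply: (subspaceB sB) => //; apply: cin_kd.
Qed.


Lemma hdim_eq (C : M -> Prop) i j n n' : gsub C ->
  hdim C W i j n -> hdim C W i j n' -> n = n'.
Proof. by move=> hC; apply: dimq_uniq; apply: Bnd_subspace. Qed.

Section FiveTerms.
Variable i : nat.
Hypothesis vA : vanishing A W i 2.
Hypothesis vQ : vanishing Q W i 2.
Hypothesis Q0 : forall c, Cyc Q W i.+2 0 c -> Cyc B W i.+2 0 c.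

Lemma Bnd_homog (C : M -> Prop) l j c : gsub C -> cP l j.+1 c = c -> Bnd C W c ->
  exists d e, [/\ ws W d, cP l.+1 j d = d, cin C e & c = kd d + e].
Proof.
move=> hC pc /(BndP hC _ pc) [d [wd pd hd]]; exists d, (c - kd d); split=> //.
by rewrite addrC subrK.
Qed.

(** Exactness on the left. The obstruction is the class of [d - e] in H_(i+2,0)(Q); by [Q0] this
    cycle of [Q] is already one of [B], so [d], which bounds [c] modulo [A], also bounds it modulo
    [B]. *)
Lemma mv_kernel_AB c : Cyc G W i.+1 1 c -> Bnd A W c -> Bnd B W c -> Bnd G W c.
Proof.
move=> [wc pc kc] /(Bnd_homog hA pc) [d [a [wd pd ha ea]]].
move=> /(Bnd_homog hB pc) [e [b [we pe hb eb]]].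
exists d => //; apply/cinG; split.
  by rewrite {1}ea addrAC subrr add0r.
have ede : kd (d - e) = b - a.
  by rewrite kdB -[kd d](addrK a) -ea eb addrAC [kd e + b]addrC addrK.
have /Q0 [_ _ hk] : Cyc Q W i.+2 0 (d - e).
  split; [exact: (subspaceB sW)|by rewrite cPB pd pe|].
  by rewrite ede; apply: (subspaceB sQ); [apply: cinBQ|apply: cinAQ].
have -> : c - kd d = b - kd (d - e).
  by rewrite eb kdB opprB addrA [b + _]addrC.
exact: (subspaceB sB).
Qed.

(** The spaces between which the sequence is cut: [NAB] is the kernel of the difference map from
    H(A) (+) H(B) to H(Q), [NQ] its image, and [NG] the kernel of H_(i,2)(G) -> H_(i,2)(B). *)
Let UAB (u : chain M * chain M) := Cyc A W i.+1 1 u.1 /\ Cyc B W i.+1 1 u.2.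
Let WAB (u : chain M * chain M) := Bnd A W u.1 /\ Bnd B W u.2.
Let NAB (u : chain M * chain M) := UAB u /\ Bnd Q W (u.1 - u.2).
Let NQ c := Cyc Q W i.+1 1 c /\ exists u, UAB u /\ Bnd Q W (c - (u.1 - u.2)).
Let NG c := Cyc G W i 2 c /\ Bnd B W c.

Let BA := Bnd_subspace hA W.
Let BB := Bnd_subspace hB W.
Let BQ := Bnd_subspace hQ W.
Let BG := Bnd_subspace hG W.

Lemma UAB_subspace : subspace UAB.
Proof.
split; first by split; apply: subspace0; apply: Cyc_subspace.
by move=> a u v [? ?] [? ?]; split;
  [apply: (Cyc_subspace hA W _ _).2 | apply: (Cyc_subspace hB W _ _).2].
Qed.

Lemma lin_sub (a : K) (u v u' v' : chain M) :
  (a *: u + v) - (a *: u' + v') = a *: (u - u') + (v - v').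
Proof. by rewrite opprD addrACA -scalerBr. Qed.

Lemma NAB_subspace : subspace NAB.
Proof.
split; first by split; [exact: subspace0 UAB_subspace | rewrite subrr; exact: subspace0].
move=> a u v [hu bu] [hv bv]; split; first exact: UAB_subspace.2.
by rewrite /= lin_sub; apply: BQ.2.
Qed.

Lemma BndAQ c : Bnd A W c -> Bnd Q W c.
Proof. by case=> d wd /cinAQ; exists d. Qed.

Lemma BndBQ c : Bnd B W c -> Bnd Q W c.
Proof. by case=> d wd /cinBQ; exists d. Qed.

Lemma UAB_Q u : UAB u -> Cyc Q W i.+1 1 (u.1 - u.2).
Proof.
move=> [/CycAQ ha /CycBQ hb]; exact: (subspaceB (Cyc_subspace hQ W _ _)).
Qed.

Lemma NQ_subspace : subspace NQ.
Proof.
split.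
  split; first by apply: subspace0; apply: Cyc_subspace.
  by exists 0; split; [exact: subspace0 UAB_subspace | rewrite /= !subrr; exact: subspace0].
move=> a c d [hc [u [hu bu]]] [hd [v [hv bv]]]; split; first exact: (Cyc_subspace hQ W _ _).2.
exists (a *: u + v); split; first exact: UAB_subspace.2.
by rewrite /= lin_sub lin_sub; apply: BQ.2.
Qed.

Lemma NG_subspace : subspace NG.
Proof.
split; first by split; [apply: subspace0; apply: Cyc_subspace|exact: subspace0].
by move=> a u v [hu bu] [hv bv]; split; [exact: (Cyc_subspace hG W _ _).2|exact: BB.2].
Qed.

Lemma cinQ_split2 l j c : Cyc Q W l j c ->
  exists a b, [/\ ws W a, cP l.-1 j.+1 a = a, cin A a, cin B b & kd c = a + b].
Proof.
move=> [wc pc kc]; apply: cinQ_split => //; first exact: kd_ws.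
by case: l pc => [|l] pc; rewrite -{}pc ?kd_cP0 ?cP_0 // kd_cP cP_id.
Qed.

Lemma step_G1 n : hdim G W i.+1 1 n -> dimq NAB WAB n.
Proof.
apply: (@dimq_rel _ _ _ _ _ _ _ (fun c (u : chain M * chain M) =>
  Bnd A W (c - u.1) /\ Bnd B W (c - u.2))).
- exact: Cyc_subspace.
- exact: NAB_subspace.
- by move=> a u v u' v' [? ?] [? ?]; rewrite /= !lin_sub; split; [apply: BA.2|apply: BB.2].
- move=> c hc; exists (c, c); last by rewrite /= subrr; split; apply: subspace0.
  split; first by split; [exact: CycGA|exact: CycGB].
  by rewrite /= subrr; apply: subspace0.
- move=> [a b] [[/= ha hb]]; have [wa pa ka] := ha; have [wb pb kb] := hb.
  have pab : cP i.+1 1 (a - b) = a - b by rewrite cPB pa pb.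
  move=> /(BndP hQ _ pab) [q [wq pq hq]].
  have [||al [be [wal pal hal hbe e]]] := cinQ_split (i := i.+1) (j := 1%N) _ _ hq.
  + by apply: (subspaceB sW); [apply: (subspaceB sW)|apply: kd_ws].
  + by rewrite cPB pab -kd_cP pq.
  have eb : a - al = b + (kd q + be).
    have -> : a = al + (be + kd q + b) by rewrite !addrA -e !subrK.
    by rewrite addrAC subrr add0r addrC [be + _]addrC.
  exists (a - al).
    split; [exact: (subspaceB sW)|by rewrite cPB pa pal|apply/cinG; split].
      by rewrite kdB; apply: (subspaceB sA) => //; apply: cin_kd.
    rewrite eb !kdD kdd add0r; apply: (subspaceD sB) => //; exact: cin_kd.
  split; rewrite /=.
    by rewrite addrAC subrr sub0r; apply: (subspaceN BA); apply: Bnd_cin.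
  rewrite eb addrAC subrr add0r; apply: (subspaceD BB); [exact: Bnd_kd|exact: Bnd_cin].
- move=> c [a b] hc _ /= [hca hcb]; split=> [h|[/= h1 h2]].
    split; rewrite /= -[X in Bnd _ _ X](subKr c).
      by apply: (subspaceB BA) => //; apply: BndGA.
    by apply: (subspaceB BB) => //; apply: BndGB.
  apply: mv_kernel_AB => //; first exact: (subspace_subr BA h1 hca).
  exact: (subspace_subr BB h2 hcb).
Qed.

Lemma step_Q n : dimq UAB NAB n -> dimq NQ (Bnd Q W) n.
Proof.
apply: (@dimq_rel _ _ _ _ _ _ _ (fun (u : chain M * chain M) c => Bnd Q W (c - (u.1 - u.2)))).
- exact: UAB_subspace.
- exact: NQ_subspace.
- by move=> a u v u' v' h h'; rewrite /= !lin_sub; apply: BQ.2.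
- move=> u hu; exists (u.1 - u.2); last by rewrite subrr; apply: subspace0.
  split; first exact: UAB_Q.
  by exists u; split=> //; rewrite subrr; apply: subspace0.
- by move=> c [hc [u [hu bu]]]; exists u.
- move=> u c hu hc huc; split=> [[_ h]|h].
    exact: (subspace_subr BQ h huc).
  by split=> //; rewrite -[X in Bnd _ _ X](subKr c); apply: (subspaceB BQ).
Qed.

(** The connecting map as a relation: write [kd q = a + b] with [a] in [A] and [b] in [B], and send
    [q] to the class of [a]. It reaches all of [NG] because H_(i,2)(A) vanishes. *)
Lemma step_connecting n : dimq (Cyc Q W i.+1 1) NQ n -> dimq NG (Bnd G W) n.
Proof.
pose rel q c := exists a, [/\ ws W a, cP i 2 a = a, cin A a, cin B (kd q - a) & Bnd G W (c - a)].
apply: (@dimq_rel _ _ _ _ _ _ _ rel).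
- exact: Cyc_subspace.
- exact: NG_subspace.
- move=> k u v u' v' [a [wa pa ha hb hg]] [a' [wa' pa' ha' hb' hg']].
  exists (k *: a + a'); split.
  + exact: sW.2.
  + by rewrite cP_linear pa pa'.
  + exact: sA.2.
  + by rewrite kd_linear lin_sub; apply: sB.2.
  + by rewrite lin_sub; apply: BG.2.
- move=> q hq; have [a [b [wa pa ha hb e]]] := cinQ_split2 hq; exists a.
    have ea : a = kd q - b by rewrite e addrK.
    split.
      split=> //; apply/cinG; split; first exact: cin_kd.
      by rewrite ea kdB kdd sub0r; apply: (subspaceN sB); apply: cin_kd.
    rewrite ea; apply: (subspaceB BB); last exact: Bnd_cin.
    by apply: Bnd_kd => //; case: hq.
  exists a; split=> //; last by rewrite subrr; apply: subspace0.
  by rewrite e addrAC subrr add0r.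
- move=> c [hc hbc]; have [wc pc kc] := hc.
  have [d [a [wd pd ha ea]]] := Bnd_homog hA pc (vA (CycGA hc)).
  have [e [b [we pe hb eb]]] := Bnd_homog hB pc hbc.
  have ek : kd (e - d) = a - b.
    by rewrite kdB -[kd e](addrK b) -eb ea addrAC [kd d + a]addrC addrK.
  exists (e - d).
    split; [exact: (subspaceB sW)|by rewrite cPB pd pe|rewrite ek].
    by apply: (subspaceB sQ); [apply: cinAQ|apply: cinBQ].
  have eaa : a = c - kd d by rewrite ea addrAC subrr add0r.
  exists a; split=> //.
  + by rewrite eaa; apply: (subspaceB sW) => //; apply: kd_ws.
  + by rewrite eaa cPB pc -kd_cP pd.
  + by rewrite ek addrAC subrr add0r; apply: (subspaceN sB).
  + by rewrite eaa opprB addrCA subrr addr0; apply: Bnd_kd.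
- move=> q c hq [hc hbc] [a [wa pa ha hqa hca]].
  have hca' : Bnd G W c <-> Bnd G W a.
    split=> h; first by rewrite -[a](subKr c); apply: (subspaceB BG).
    exact: (subspace_subr BG h hca).
  rewrite hca'; split=> [[_ [u [[hu1 hu2] hu]]]|h].
    have [d wd hd] := hu; have [wq pq kq] := hq.
    have [w1 p1 k1] := hu1; have [w2 p2 k2] := hu2.
    have [|al [be [wal pal hal hbe e]]] := cinQ_split (i := i.+1) (j :=
      1%N) _ (cP_id _ _ _) (cin_cP hQ i.+1 1 hd).
      apply: cP_ws; apply: (subspaceB sW); last exact: kd_ws.
      by do 2!apply: (subspaceB sW) => //.
    have ek : kd q = kd (u.1 + al) + (kd be - kd u.2).
      have : kd (q - (u.1 - u.2)) = kd (al + be).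
        by rewrite -e !cPB pq p1 p2 [RHS]kdB kd_cP kdd cP_0 subr0.
      rewrite !kdB !kdD => /eqP; rewrite subr_eq => /eqP ->.
      by rewrite addrC addrA -!addrA; congr (_ + _); rewrite addrCA; congr (_ + _); rewrite addrC.
    exists (u.1 + al); first exact: (subspaceD sW).
    apply/cinG; split.
      by apply: (subspaceB sA) => //; rewrite kdD; apply: (subspaceD sA) => //; apply: cin_kd.
    have -> : a - kd (u.1 + al) = (kd be - kd u.2) - (kd q - a).
      by rewrite ek opprB [- (_ + _)]opprD addrCA [- kd (u.1 + al) + _]addrC addNKr.
    by apply: (subspaceB sB) => //; apply: (subspaceB sB) => //; apply: cin_kd.
  have [d [g [wd pd hg ea]]] := Bnd_homog hG pa h; have [wq pq kq] := hq.
  move/cinG: hg => [hgA hgB].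
  split=> //; exists (d, d - q); rewrite /=; split; last first.
    by rewrite subKr subrr; apply: subspace0.
  split; split=> //=.
  + by rewrite -[kd d](addrK g) -ea; apply: (subspaceB sA).
  + exact: (subspaceB sW).
  + by rewrite cPB pd pq.
  + rewrite kdB -[kd d](addrK g) -ea addrAC -[a - kd q]opprB; apply: (subspaceB sB) => //.
    exact: (subspaceN sB).
Qed.

Lemma step_G2 n : dimq (Cyc G W i 2) NG n -> hdim B W i 2 n.
Proof.
apply: (@dimq_rel _ _ _ _ _ _ _ (fun c b => Bnd B W (c - b))).
- exact: Cyc_subspace.
- exact: Cyc_subspace.
- by move=> a u v u' v' h h'; rewrite lin_sub; apply: BB.2.
- by move=> c hc; exists c; [exact: CycGB | rewrite subrr; apply: subspace0].
- by move=> b /(mv_surj vQ) [c [hc _ h]]; exists c.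
- move=> c b hc _ h; split=> [[_ h']|h'].
    by rewrite -[b](subKr c); apply: (subspaceB BB).
  by split=> //; apply: (subspace_subr BB h' h).
Qed.

(** The alternating sum of dimensions along the exact sequence, written without subtraction. Each
    middle term is split by [dimq_between], and the pieces are matched by the four steps above. *)
Lemma mv_five a1 b1 q1 g1 b2 g2 :
  hdim A W i.+1 1 a1 -> hdim B W i.+1 1 b1 -> hdim Q W i.+1 1 q1 ->
  hdim G W i.+1 1 g1 -> hdim B W i 2 b2 -> hdim G W i 2 g2 ->
  (g2 + a1 + b1 = b2 + q1 + g1)%N.
Proof.
move=> hA1 hB1 hQ1 hG1 hB2 hG2.
have hAB : dimq UAB WAB (a1 + b1).
  exact: (dimq_pair (Cyc_subspace hA _ _ _) (Cyc_subspace hB _ _ _) hA1 hB1).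
have sWAB : subspace WAB.
  by split; [split; apply: subspace0 | move=> k u v [? ?] [? ?]; split; [apply: BA.2|apply: BB.2]].
have [| |m1 [m2 [hm1 hm2 e1]]] := dimq_between UAB_subspace NAB_subspace sWAB _ _ hAB.
- by move=> v [].
- by move=> v hv [w1 w2]; split=> //; apply: (subspaceB BQ); [apply: BndAQ|apply: BndBQ].
have e2 : g1 = m1 := dimq_uniq sWAB (step_G1 hG1) hm1.
have [| |n1 [n2 [hn1 hn2 e3]]] := dimq_between (Cyc_subspace hQ W i.+1 1) NQ_subspace BQ _ _ hQ1.
- by move=> v [].
- by move=> v hv bv; split=> //; exists 0; split;
  [exact: subspace0 UAB_subspace|rewrite /= subrr subr0].
have e4 : m2 = n1 := dimq_uniq BQ (step_Q hm2) hn1.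
have [| |k1 [k2 [hk1 hk2 e5]]] := dimq_between (Cyc_subspace hG W i 2) NG_subspace BG _ _ hG2.
- by move=> v [].
- by move=> v hv /BndGB.
have e6 : n2 = k1 := dimq_uniq BG (step_connecting hn2) hk1.
have e7 : k2 = b2 := hdim_eq hB (step_G2 hk2) hB2.
rewrite e5 e3 -e4 e6 -e7 -addnA e1 e2.
lia.
Qed.

End FiveTerms.
End MayerVietoris.

(** * Graded ideals of polynomial rings *)

Section Homogeneous.
Variables (K : fieldType) (n : nat).
Implicit Types (p q : {mpoly K[n]}) (m : 'X_{1..n}).

Lemma mpoly_span (P : {mpoly K[n]} -> Prop) :
  P 0 -> (forall c m p, P p -> P (c *: 'X_[m] + p)) -> forall p, P p.
Proof. by move=> P0 PS; apply: mpolyind => // c m p _ _; apply: PS. Qed.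

Lemma pihomog_mul d e p q : q \is d.-homog ->
  pihomog mdeg (e + d) (p * q) = pihomog mdeg e p * q.
Proof.
move=> hq; elim/mpoly_span: p => [|c m p IH]; first by rewrite !(mul0r, linear0).
rewrite mulrDl !linearD /= IH mulrDl; congr (_ + _).
rewrite -scalerAl !linearZ /= -scalerAl; congr (_ *: _).
have hm : 'X_[m] * q \is (mdeg m + d).-homog by apply: dhomogM; rewrite ?dhomogX.
rewrite pihomogX; case: eqP => [e1|/eqP ne]; first by rewrite -e1 pihomog_dE.
by rewrite mul0r (pihomog_ne0 _ hm) // eqn_add2r.
Qed.

Lemma pihomog_mul_lt d e p q : q \is d.-homog -> (e < d)%N ->
  pihomog mdeg e (p * q) = 0.
Proof.
move=> hq ltd; elim/mpoly_span: p => [|c m p IH]; first by rewrite !(mul0r, linear0).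
rewrite mulrDl !linearD /= IH addr0 -scalerAl linearZ /=.
have hm : 'X_[m] * q \is (mdeg m + d).-homog by apply: dhomogM; rewrite ?dhomogX.
by rewrite (pihomog_ne0 _ hm) ?scaler0 // gtn_eqF // ltn_addl.
Qed.

Lemma pihomog0E p : pihomog mdeg 0 p = (p@_0%MM)%:MP.
Proof.
elim/mpoly_span: p => [|c m p IH]; first by rewrite linear0 mcoeff0 mpolyC0.
rewrite linearD linearZ /= IH mcoeffD mcoeffZ mpolyCD pihomogX mcoeffX mdeg_eq0.
congr (_ + _); case: eqP => [->|_]; last by rewrite scaler0 mulr0 mpolyC0.
by rewrite mulr1 mpolyX0 alg_mpolyC.
Qed.

Lemma pihomog_coef0 e p : (0 < e)%N -> (pihomog mdeg e p)@_0%MM = 0.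
Proof.
move=> e0; apply: (dhomog_nemf_coeff (pihomogP mdeg e p)).
by rewrite /= mdeg0 eq_sym -lt0n.
Qed.

Lemma dhomog_prodn (J : Type) (r : seq J) (F : J -> {mpoly K[n]}) (g : J -> nat) :
  (forall j, F j \is (g j).-homog) -> \prod_(j <- r) F j \is (\sum_(j <- r) g j)%N.-homog.
Proof.
move=> h; elim: r => [|j r IH]; first by rewrite !big_nil dhomog1.
by rewrite !big_cons; apply: dhomogM.
Qed.

End Homogeneous.

(** * Substitution homomorphisms *)

Section Substitution.
Variables (K : fieldType) (n n' : nat) (h : 'I_n -> {mpoly K[n']}).

Definition psubst : {mpoly K[n]} -> {mpoly K[n']} := mmap (@mpolyC n' K) h.

HB.instance Definition _ := GRing.RMorphism.copy psubst (mmap (@mpolyC n' K) h).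

Lemma psubstZ c p : psubst (c *: p) = c *: psubst p.
Proof. by rewrite /psubst mmapZ mul_mpolyC. Qed.

HB.instance Definition _ := GRing.isScalable.Build K _ _ _ psubst psubstZ.

Lemma psubstX i : psubst 'X_i = h i.
Proof. by rewrite /psubst mmapX mmap1U. Qed.

Lemma psubst_mon m : psubst 'X_[m] = \prod_i h i ^+ m i.
Proof. by rewrite /psubst mmapX. Qed.

(** Forms of a common degree [d] multiply all degrees by [d]; kernels of such substitutions are
    therefore homogeneous. Both [d = 1] and [d = 2] occur, the latter for the Segre
    parametrization. *)
Lemma psubst_pihomog d e p : (0 < d)%N -> (forall i, h i \is d.-homog) ->
  pihomog mdeg (d * e) (psubst p) = psubst (pihomog mdeg e p).
Proof.
move=> d0 hh; elim/mpoly_span: p => [|c m p IH]; first by rewrite !linear0.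
rewrite !linearD !linearZ /= IH pihomogX; congr (_ *: _ + _).
have hm : psubst 'X_[m] \is (d * mdeg m).-homog.
  rewrite psubst_mon mdegE big_distrr; apply: dhomog_prodn => i.
  exact: dhomogMn.
case: eqP => [<-|/eqP ne]; first by rewrite pihomog_dE.
by rewrite linear0 (pihomog_ne0 _ hm) // eqn_pmul2l.
Qed.

End Substitution.

Lemma psubst_comp (K : fieldType) n1 n2 n3 (h : 'I_n1 -> {mpoly K[n2]}) (h' : 'I_n2 ->
  {mpoly K[n3]}) (h'' : 'I_n1 -> {mpoly K[n3]}) :
  (forall i, psubst h' (h i) = h'' i) ->
  forall p, psubst h' (psubst h p) = psubst h'' p.
Proof.
move=> e p; elim/mpoly_span: p => [|c m p IH]; first by rewrite !linear0.
rewrite !linearD !linearZ /= IH !psubst_mon rmorph_prod; congr (_ *: _ + _).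
by apply: eq_bigr => i _; rewrite rmorphXn /= e.
Qed.

Lemma psubst_id (K : fieldType) n (h : 'I_n -> {mpoly K[n]}) :
  (forall i, h i = 'X_i) -> forall p, psubst h p = p.
Proof.
move=> e p; elim/mpoly_span: p => [|c m p IH]; first by rewrite !linear0.
rewrite linearD linearZ /= IH psubst_mon mpolyXE_id; congr (_ *: _ + _).
by apply: eq_bigr => i _; rewrite e.
Qed.

Section RingModule.
Variables (K : fieldType) (n : nat) (I : finType) (xi : I -> {mpoly K[n]}).
Hypothesis hxi : forall k, xi k \is 1%N.-homog.

Definition mulx (a p : {mpoly K[n]}) := a * p.
Lemma mulx_linear a : linear (mulx a).
Proof. by move=> c p q; rewrite /mulx mulrDr scalerAr. Qed.
HB.instance Definition _ a := GRing.isLinear.Build K _ _ _ (mulx a) (mulx_linear a).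

Lemma xi_C k l p : mulx (xi k) (mulx (xi l) p) = mulx (xi l) (mulx (xi k) p).
Proof. by rewrite /mulx mulrCA. Qed.

Lemma xi_p e k p : pihomog mdeg e.+1 (mulx (xi k) p) = mulx (xi k) (pihomog mdeg e p).
Proof. by rewrite /mulx ![xi k * _]mulrC -addn1 pihomog_mul. Qed.

Lemma xi_p0 k p : pihomog mdeg 0 (mulx (xi k) p) = 0.
Proof. by rewrite /mulx mulrC (pihomog_mul_lt _ (hxi k)). Qed.

(** The index set [I] of the operators is not tied to the variables of the ring: an index may act by
    any linear form, 0 included. This allows S_H to be a module over the index set of S. *)
Definition rmod : gmod K I :=
  @GMod K I {mpoly K[n]} (fun k => mulx (xi k)) (fun e => pihomog mdeg e)
    xi_C xi_p xi_p0 (fun e p => @pihomog_id n K mdeg e p).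

Section FreeModule.
Variables (r : nat) (deg : 'I_r -> nat).
Notation fM := {ffun 'I_r -> {mpoly K[n]}}.

Definition fmul k (u : fM) : fM := [ffun a => xi k * u a].
Lemma fmul_linear k : linear (fmul k).
Proof. by move=> c p q; apply/ffunP => a; rewrite !ffunE mulrDr scalerAr. Qed.
HB.instance Definition _ k := GRing.isLinear.Build K _ _ _ (fmul k) (fmul_linear k).

(** The coordinate [a] lives in degrees at least [deg a]; the test guards against the truncation of
    [e - deg a] to 0. *)
Definition fproj e (u : fM) : fM :=
  [ffun a => if (deg a <= e)%N then pihomog mdeg (e - deg a) (u a) else 0].
Lemma fproj_linear e : linear (fproj e).
Proof.
move=> c p q; apply/ffunP => a; rewrite !ffunE; case: ifP => _; first by rewrite linearP.
by rewrite scaler0 addr0.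
Qed.
HB.instance Definition _ e := GRing.isLinear.Build K _ _ _ (fproj e) (fproj_linear e).

Lemma fmulC k l u : fmul k (fmul l u) = fmul l (fmul k u).
Proof. by apply/ffunP => a; rewrite !ffunE mulrCA. Qed.

Lemma fproj_mul e k u : fproj e.+1 (fmul k u) = fmul k (fproj e u).
Proof.
apply/ffunP => a; rewrite !ffunE; case: (ltngtP (deg a) e.+1) => [|lt|eq].
- by rewrite ltnS => le; rewrite le subSn //; exact: xi_p.
- by rewrite leqNgt (ltnW lt) /= mulr0.
- by rewrite eq subnn ltnn mulr0; exact: xi_p0.
Qed.

Lemma fproj0_mul k u : fproj 0 (fmul k u) = 0.
Proof.
by apply/ffunP => a; rewrite !ffunE sub0n; case: ifP => // _; exact: xi_p0.
Qed.

Lemma fproj_id e u : fproj e (fproj e u) = fproj e u.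
Proof. by apply/ffunP => a; rewrite !ffunE; case: ifP => // ->; rewrite pihomog_id. Qed.

Definition fmod : gmod K I :=
  @GMod K I fM (fun k => fmul k) (fun e => fproj e) fmulC fproj_mul fproj0_mul fproj_id.

End FreeModule.
End RingModule.

Record hideal (K : fieldType) n (J : {mpoly K[n]} -> Prop) := HIdeal {
  hi0 : J 0;
  hiD : forall p q, J p -> J q -> J (p + q);
  hiM : forall a p, J p -> J (a * p);
  hip : forall e p, J p -> J (pihomog mdeg e p)
}.

Lemma hideal_sub (K : fieldType) n (J : {mpoly K[n]} -> Prop) : hideal J -> subspace J.
Proof.
move=> hJ; split; first exact: hi0 hJ.
by move=> a p q hp hq; apply: (hiD hJ) => //; rewrite -mul_mpolyC; apply: (hiM hJ).
Qed.

Lemma hideal_gsub (K : fieldType) n (I : finType) (xi : I -> {mpoly K[n]})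
    (hxi : forall k, xi k \is 1%N.-homog) (J : {mpoly K[n]} -> Prop) :
  hideal J -> @gsub K I (rmod hxi) J.
Proof.
move=> hJ; split; first exact: hideal_sub.
- by move=> k p; apply: (hiM hJ).
- by move=> e p; apply: (hip hJ).
Qed.

Lemma psubst_ker (K : fieldType) n n' (h : 'I_n -> {mpoly K[n']}) d :
  (0 < d)%N -> (forall i, h i \is d.-homog) -> hideal (fun p => psubst h p = 0).
Proof.
move=> d0 hh; split; first exact: linear0.
- by move=> p q hp hq; rewrite linearD /= hp hq addr0.
- by move=> a p hp; rewrite rmorphM /= hp mulr0.
- by move=> e p hp; rewrite -(psubst_pihomog _ _ d0 hh) hp linear0.
Qed.

Lemma psubst_preim (K : fieldType) n n' (h : 'I_n -> {mpoly K[n']}) (J : {mpoly K[n']} -> Prop) :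
  (forall i, h i \is 1%N.-homog) -> hideal J -> hideal (fun p => J (psubst h p)).
Proof.
move=> hh hJ; split; first by rewrite linear0; apply: hi0 hJ.
- by move=> p q hp hq; rewrite linearD; apply: (hiD hJ).
- by move=> a p hp; rewrite rmorphM; apply: (hiM hJ).
- move=> e p hp; have := psubst_pihomog e p (ltn0Sn 0) hh.
  by rewrite mul1n => <-; apply: (hip hJ).
Qed.

(** * Ideals generated by variables *)

Section KilledVariables.
Variables (K : fieldType) (n : nat).

Definition kill (A : {set 'I_n}) (i : 'I_n) : {mpoly K[n]} :=
  if i \in A then 0 else 'X_i.

Lemma kill_homog A i : kill A i \is 1%N.-homog.
Proof. by rewrite /kill; case: ifP => _; rewrite ?dhomog0 // dhomogX /= mdeg1. Qed.

(** The ideal generated by the variables in [A], presented as the kernel of setting them to 0, so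
    that membership is an equation. *)
Definition varideal A p := psubst (kill A) p = 0.

Lemma varideal_hideal A : hideal (varideal A).
Proof. exact: (@psubst_ker _ _ _ _ 1 _ (kill_homog A)). Qed.

Lemma kill_mon A m : psubst (kill A) 'X_[m] =
  if [exists i, (i \in A) && (m i != 0)%N] then 0 else 'X_[m].
Proof.
rewrite psubst_mon; case: existsP => [[i /andP[iA mi]]|nex].
  by rewrite (bigD1 i) //= /kill iA expr0n (negbTE mi) mul0r.
rewrite [in RHS]mpolyXE_id; apply: eq_bigr => i _; rewrite /kill; case: ifP => // iA.
have : m i == 0%N by apply/negPn/negP => mi; apply: nex; exists i; rewrite iA.
by move/eqP->; rewrite !expr0.
Qed.

Lemma kill1_decomp z p : exists q, p = psubst (kill [set z]) p + 'X_z * q.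
Proof.
elim/mpoly_span: p => [|c m p [q IH]]; first by exists 0; rewrite linear0 mulr0 addr0.
rewrite linearD linearZ /= kill_mon; case: existsP => [[i /andP[]]|_].
  rewrite inE => /eqP -> mz; exists (c *: 'X_[m - U_(z)] + q).
  rewrite scaler0 add0r mulrDr addrCA -IH -scalerAr -mpolyXD addmC submK //.
  by rewrite lep1mP.
by exists q; rewrite -addrA -IH.
Qed.

Lemma kill_comp A B p : psubst (kill A) (psubst (kill B) p) = psubst (kill (A :|: B)) p.
Proof.
apply: psubst_comp => i; rewrite /kill inE orbC.
by case: (i \in B); rewrite ?linear0 //= psubstX.
Qed.

Lemma kill_comm A B p : psubst (kill A) (psubst (kill B) p) = psubst (kill B) (psubst (kill A) p).
Proof. by rewrite !kill_comp setUC. Qed.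

Lemma kill_all p : psubst (kill [set: 'I_n]) p = (p@_0%MM)%:MP.
Proof.
elim/mpoly_span: p => [|c m p IH]; first by rewrite linear0 mcoeff0 mpolyC0.
rewrite linearD linearZ /= IH kill_mon mcoeffD mpolyCD mcoeffZ mcoeffX.
congr (_ + _); case: existsP => [[i /andP[_ mi]]|nex].
  rewrite (_ : m == 0%MM = false) ?mulr0 ?mpolyC0 ?scaler0 //.
  by apply: contraNF mi => /eqP ->; rewrite mnmE.
rewrite (_ : m = 0%MM) ?eqxx ?mulr1 ?mpolyX0 ?alg_mpolyC //.
by apply/mnmP => i; rewrite mnmE; apply/eqP/negPn/negP => mi; apply: nex; exists i; rewrite inE.
Qed.

End KilledVariables.

(** * Exactness for free modules, and the comparison with Tor *)

Definition zerop (M : zmodType) (m : M) : Prop := m = 0.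

Lemma cin_zerop (K : fieldType) (I : finType) (M : gmod K I) (c : chain M) :
  cin (@zerop M) c <-> c = 0.
Proof.
split=> [h|-> T]; last by rewrite /zerop ffunE.
by apply/ffunP => T; rewrite h ffunE.
Qed.

Lemma vanishing_ext (K : fieldType) (I : finType) (M : gmod K I) (B B' : M -> Prop) W i j :
  (forall m, B m <-> B' m) -> vanishing B W i j -> vanishing B' W i j.
Proof.
move=> e v c [wc pc kc]; have [|d wd hd] := v c; first by split=> // T; apply/e.
by exists d => // T; apply/e.
Qed.

(** * Dimension shifting *)

Section Shift.
Variables (K : fieldType) (I : finType) (M' M : gmod K I).
Variables (B' : M' -> Prop) (B : M -> Prop) (g : {linear M' -> M}).
Hypotheses (hB' : gsub B') (hB : gsub B).
Hypothesis gX : forall k m, g (gm_X M' k m) = gm_X M k (g m).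
Hypothesis gp : forall e m, g (gm_p M' e m) = gm_p M e (g m).
Hypothesis imB : forall m, B m <-> exists m', m = g m'.
Hypothesis kerB : forall m', B' m' <-> g m' = 0.
Let sB := cin_subspace hB.

Lemma cin_im W (c : chain M) : ws W c -> cin B c -> exists2 c', ws W c' & c = cmap g c'.
Proof.
move=> wc h; have /fin_all_exists [f hf] : forall T, exists m, c T = g m by move=> T; apply/imB.
exists [ffun T : {set I} => if T \subset W then f T else 0].
  by move=> T /negbTE nT; rewrite ffunE nT.
apply/ffunP => T; rewrite !ffunE; case: ifP => [//|nT].
by rewrite linear0 wc ?nT.
Qed.

Lemma cin_cmap (c : chain M') : cin B (cmap g c).
Proof. by move=> T; apply/imB; exists (c T); rewrite ffunE. Qed.

Lemma cin_ker (c : chain M') : cin B' c <-> cmap g c = 0.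
Proof.
split=> [h|h T]; first by apply/ffunP => T; rewrite !ffunE; apply/kerB.
by apply/kerB; move/ffunP/(_ T): h; rewrite !ffunE.
Qed.

(** The connecting map of 0 -> M'/B' -> M -> M/B -> 0, where [B] is the image and [B'] the kernel of
    [g]. It is an isomorphism when the homology of [M] vanishes in the two bidegrees around it, and
    relates [b] to [c] when [kd c = g b]. *)
Lemma hdim_shift W i j n :
  vanishing (@zerop M) W i.+1 j.+1 -> vanishing (@zerop M) W i.+2 j ->
  hdim B' W i.+1 j.+1 n -> hdim B W i.+2 j n.
Proof.
move=> v1 v2; apply: (@dimq_rel _ _ _ _ _ _ _ (fun b c => kd c = cmap g b)).
- exact: Cyc_subspace.
- exact: Cyc_subspace.
- by move=> a u v u' v' e e'; rewrite kd_linear cmap_linear e e'.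
- move=> b [wb pb kb].
  have [|c wc hc] := v1 (cmap g b).
    split; [exact: cmap_ws|by rewrite -cmap_cP // pb|].
    by apply/cin_zerop; rewrite -cmap_kd //; apply/cin_ker.
  move/cin_zerop: hc => /eqP; rewrite subr_eq0 => /eqP ec.
  have ec' : kd (cP i.+2 j c) = cmap g b by rewrite kd_cP -ec -cmap_cP // pb.
  exists (cP i.+2 j c) => //; split; [exact: cP_ws|exact: cP_id|].
  by rewrite ec'; exact: cin_cmap.
- move=> c [wc pc /(cin_im (kd_ws wc)) [b wb eb]].
  have eb' : kd c = cmap g (cP i.+1 j.+1 b) by rewrite -pc kd_cP eb cmap_cP.
  exists (cP i.+1 j.+1 b) => //; split; [exact: cP_ws|exact: cP_id|].
  by apply/cin_ker; rewrite cmap_kd // -eb' kdd.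
- move=> b c [wb pb kb] [wc pc kc] e; split=> [[b' wb' /cin_ker hb']|[d wd /(cin_im) h]].
    have wcd : ws W (c - cmap g b').
      by apply: (subspaceB (ws_subspace M W)) => //; apply: cmap_ws.
    have [|d wd /cin_zerop hd] := v2 (cP i.+2 j (c - cmap g b')).
      split; [exact: cP_ws|exact: cP_id|apply/cin_zerop].
      rewrite kd_cP kdB e -cmap_kd // -cmapB.
      by rewrite hb' cP_0.
    exists d => //; move: hd => /eqP; rewrite subr_eq0 cPB pc => /eqP <-.
    by rewrite subKr -cmap_cP //; exact: cin_cmap.
  have [|b' wb' eb'] := h W.
    by apply: (subspaceB (ws_subspace M W)) => //; apply: kd_ws.
  exists b' => //; apply/cin_ker; rewrite cmapB -e cmap_kd // -eb'.
  by rewrite kdB kdd subr0 subrr.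
Qed.

End Shift.

Section Exactness.
Variables (K : fieldType) (n : nat) (I : finType) (xi : I -> {mpoly K[n]}).
Hypothesis hxi : forall k, xi k \is 1%N.-homog.
Variable kv : 'I_n -> I.
Hypothesis xi_kv : forall a, xi (kv a) = 'X_a.
Notation R := (rmod hxi).

Definition vset : {set I} := kv @: [set: 'I_n].

Lemma vsetP k : reflect (exists a, k = kv a) (k \in vset).
Proof.
by apply: (iffP imsetP) => [[a _ ->]|[a ->]]; exists a.
Qed.

Lemma kv_in a : kv a \in vset. Proof. by apply/vsetP; exists a. Qed.

Lemma addX_varideal (A : {set 'I_n}) z p :
  addX (M := R) (varideal A) (kv z) p <-> varideal (z |: A) p.
Proof.
rewrite /varideal; split=> [[b [q [hb ->]]]|hp].
  rewrite setUC -kill_comp kill_comm linearD /= hb add0r rmorphM /= xi_kv psubstX.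
  have -> : psubst (kill K [set z]) (kill K A z * psubst (kill K A) q) = 0.
    have e : psubst (kill K [set z]) (kill K A z) = 0.
      rewrite {2}/kill; case: ifP => _; first by rewrite linear0.
      by rewrite psubstX /kill inE eqxx.
    by rewrite rmorphM /= e mul0r.
  by [].
have [q eq] := kill1_decomp z p.
exists (psubst (kill K [set z]) p), q; split; last by rewrite {1}eq /= /mulx xi_kv.
by rewrite kill_comp setUC.
Qed.

(* From the maximal ideal, where positive degrees vanish, the variables are
   removed one at a time with [vanishing_nzd]. *)
Lemma vanishing_var (A : {set 'I_n}) i j : vanishing (M := R) (varideal A) vset i j.+1.
Proof.
elim: {A}_.+1 {-2}A (ltnSn #|~: A|) i => // k IH A leA i.
have [AT|] := eqVneq (~: A) set0.
  have -> : A = setT by rewrite -[A]setCK AT setC0.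
  move=> c [wc pc _]; apply: Bnd_cin => T; rewrite -pc ffunE; case: ifP => _.
    by rewrite /varideal kill_all /= pihomog_coef0 ?mpolyC0.
  by rewrite /varideal linear0.
case/set0Pn => z; rewrite inE => zA.
apply: (@vanishing_nzd _ _ _ _ (hideal_gsub hxi (varideal_hideal K A)) _ (kv z)).
- exact: kv_in.
- move=> p; rewrite /colonX /varideal /= /mulx xi_kv rmorphM /= psubstX /kill (negbTE zA).
  move/eqP; rewrite mulf_eq0 => /orP[/eqP|/eqP//].
  by move=> /(congr1 (mcoeff U_(z)%MM)) e; have := oner_neq0 K;
    rewrite -[1]/(true%:R) -(eqxx U_(z)%MM) -mcoeffX e mcoeff0 eqxx.
apply: (@vanishing_ext K I R (varideal (z |: A))); first by move=> m; rewrite addX_varideal.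
apply: IH; rewrite setCU setIC -setDE.
by move: leA; rewrite (cardsD1 z) inE zA.
Qed.

Lemma vanishing_zero i j : vanishing (M := R) (@zerop _) vset i j.+1.
Proof.
have := @vanishing_var set0 i j; apply: (@vanishing_ext K I R (varideal set0)) => p.
by rewrite /varideal psubst_id // => a; rewrite /kill inE.
Qed.

(** Such a cycle is zero: it has constant coefficients, and for [k = kv a] in [T] the coefficient of
    ['X_a] in [kd c] at [T :\ k] is, up to sign, the constant [c T]. *)
Lemma vanishing_zero0 i : vanishing (M := R) (@zerop _) vset i.+1 0.
Proof.
move=> c [wc pc /cin_zerop kc]; apply: Bnd_cin; apply/cin_zerop/ffunP => T.
rewrite [RHS]ffunE.
have hc T' : c T' = ((c T')@_0%MM)%:MP.
  by rewrite -pc ffunE; case: ifP => _; rewrite ?mcoeff0 ?mpolyC0 //= pihomog0E mcoeffC eqxx mulr1.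
case TW: (T \subset vset); last by apply: wc; rewrite TW.
have [cT|/negbTE cT] := boolP (#|T| == i.+1); last by rewrite -pc ffunE cT.
have /card_gt0P [k kT] : (0 < #|T|)%N by rewrite (eqP cT).
have /vsetP [a ka] : k \in vset by apply: (subsetP TW).
move/ffunP/(_ (T :\ k))/(congr1 (mcoeff U_(a)%MM)): kc.
rewrite !ffunE mcoeff0 raddf_sum /= (bigD1 k) ?inE ?eqxx //= big1 ?addr0.
  rewrite mcoeffZ setD1K // hc /mulx ka xi_kv ['X_a * _]mulrC mcoeffCM mcoeffX eqxx mulr1.
  move/eqP; rewrite mulf_eq0 => /orP[/eqP e|/eqP->]; last by rewrite mpolyC0.
  by have := sg_sq K k (T :\ k); rewrite ka e mul0r => /eqP; rewrite eq_sym oner_eq0.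
move=> l /andP[lT lk]; rewrite mcoeffZ.
have [/vsetP [b lb]|lW] := boolP (l \in vset); last first.
  by rewrite wc ?linear0 ?mcoeff0 ?mulr0 // subUset sub1set (negbTE lW).
rewrite /mulx lb xi_kv hc ['X_b * _]mulrC mcoeffCM mcoeffXU.
case: eqP => [e|_]; last by rewrite !mulr0.
by move: lk; rewrite lb ka e eqxx.
Qed.

(** A free module is treated coordinate by coordinate: coordinate [a] is a cycle of the ring in
    coefficient degree [j - deg a], and is 0 if [j < deg a]. *)
Lemma vanishing_free r (deg : 'I_r -> nat) i j :
  vanishing (M := fmod hxi deg) (@zerop _) vset i.+1 j.
Proof.
move=> c [wc pc /cin_zerop kc].
pose ca a : chain R := [ffun T => c T a].
have kca a T : kd (ca a) T = kd c T a.
  by rewrite !ffunE sum_ffunE; apply: eq_bigr => k _; rewrite !ffunE.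
have /fin_all_exists [d hd] : forall a, exists d : chain R, ws vset d /\ ca a = kd d.
  move=> a; have [le|gt] := leqP (deg a) j; last first.
    exists 0; split; first by move=> T _; rewrite ffunE.
    rewrite kd0; apply/ffunP => T; rewrite !ffunE -pc !ffunE.
    by case: ifP => _; rewrite !ffunE // leqNgt gt.
  have [d wd] : Bnd (M := R) (@zerop _) vset (ca a).
    have hC : Cyc (M := R) (@zerop _) vset i.+1 (j - deg a) (ca a).
      split.
      - by move=> T nT; rewrite ffunE wc // ffunE.
      - apply/ffunP => T; rewrite !ffunE -{2}pc !ffunE.
        by case: ifP => _; rewrite !ffunE // le.
      - by apply/cin_zerop/ffunP => T; rewrite kca kc !ffunE.
    case: (j - deg a)%N hC => [|j'] hC; [exact: vanishing_zero0 hC | exact: vanishing_zero hC].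
  by move=> /cin_zerop/eqP; rewrite subr_eq0 => /eqP e; exists d.
exists ([ffun T => [ffun a => d a T]] : chain (fmod hxi deg)).
  by move=> T nT; apply/ffunP => a; rewrite !ffunE; case: (hd a) => wd _; rewrite wd.
apply/cin_zerop/eqP; rewrite subr_eq0; apply/eqP/ffunP => T; apply/ffunP => a.
have [_ /ffunP/(_ T)] := hd a; rewrite !ffunE sum_ffunE => ->.
by apply: eq_bigr => k _; rewrite !ffunE.
Qed.

End Exactness.

Section AtEmpty.
Variables (K : fieldType) (I : finType) (M : gmod K I).

Definition at0 (u : M) : chain M := [ffun T : {set I} => if T == set0 then u else 0].

Lemma at0_linear a u v : at0 (a *: u + v) = a *: at0 u + at0 v.
Proof. by apply/ffunP => T; rewrite !ffunE; case: ifP => _; rewrite // scaler0 addr0. Qed.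

Lemma at0_0 : at0 0 = 0.
Proof. by apply/ffunP => T; rewrite !ffunE if_same. Qed.

Lemma at0D u v : at0 (u + v) = at0 u + at0 v.
Proof. by rewrite -[u]scale1r at0_linear !scale1r. Qed.

Lemma at0B u v : at0 (u - v) = at0 u - at0 v.
Proof. by rewrite addrC -scaleN1r at0_linear scaleN1r addrC. Qed.

Lemma at0_sum (J : Type) (r : seq J) (F : J -> M) :
  at0 (\sum_(j <- r) F j) = \sum_(j <- r) at0 (F j).
Proof.
by elim: r => [|j r IH]; rewrite ?big_nil ?at0_0 // !big_cons at0D IH.
Qed.

Lemma at0_inj : injective at0.
Proof. by move=> u v /ffunP/(_ set0); rewrite !ffunE eqxx. Qed.

Lemma chainBE (c d : chain M) T : (c - d) T = c T - d T.
Proof. by rewrite !ffunE. Qed.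

Lemma kd_at0 u : kd (at0 u) = 0.
Proof.
apply/ffunP => T; rewrite !ffunE big1 // => k _; rewrite ffunE.
have /negbTE -> : k |: T != set0 by apply/set0Pn; exists k; rewrite setU11.
by rewrite linear0 scaler0.
Qed.

Lemma at0_ws W u : ws W (at0 u).
Proof. by move=> T nT; rewrite ffunE; case: eqP nT => // ->; rewrite sub0set. Qed.

Lemma cP_at0 j u : cP 0 j (at0 u) = at0 (gm_p M j u).
Proof.
by apply/ffunP => T; rewrite !ffunE -cards_eq0; case: (#|T|); rewrite // linear0.
Qed.

Lemma cX_at0 z u : cX z (at0 u) = at0 (gm_X M z u).
Proof. by apply/ffunP => T; rewrite !ffunE; case: ifP => // _; rewrite linear0. Qed.

Lemma at0E j c : cP 0 j c = c -> c = at0 (c set0).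
Proof.
move=> pc; apply/ffunP => T; rewrite !ffunE; case: eqP => [->//|nT].
by rewrite -pc ffunE cards_eq0; case: eqP.
Qed.

End AtEmpty.

Lemma cmap_at0 (K : fieldType) (I : finType) (M M' : gmod K I) (g : {linear M -> M'}) u :
  cmap g (at0 u) = at0 (g u).
Proof. by apply/ffunP => T; rewrite !ffunE; case: ifP => // _; rewrite linear0. Qed.

Lemma mpoly_euler (K : fieldType) n (p : {mpoly K[n]}) :
  exists q : 'I_n -> {mpoly K[n]}, p = (p@_0%MM)%:MP + \sum_a 'X_a * q a.
Proof.
elim/mpoly_span: p => [|c m p [q IH]].
  by exists (fun=> 0); rewrite mcoeff0 mpolyC0 add0r big1 // => a _; rewrite mulr0.
rewrite mcoeffD mcoeffZ mcoeffX mpolyCD.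
case: (eqVneq m 0%MM) => [->|m0].
  by exists q; rewrite mulr1 mpolyX0 alg_mpolyC -addrA -IH.
have /existsP [a ma] : [exists a, m a != 0%N].
  apply: contraT => /existsPn h; case/eqP: m0; apply/mnmP => i.
  by rewrite mnmE; apply/eqP/negPn/h.
exists (fun b => if b == a then c *: 'X_[m - U_(a)] + q b else q b).
rewrite mulr0 mpolyC0 add0r (bigD1 a) //= eqxx mulrDr -scalerAr -mpolyXD addmC submK ?lep1mP //.
rewrite [X in _ = _ + (_ + X)](eq_bigr (fun b => 'X_b * q b)) => [|b /negbTE-> //].
by rewrite {1}IH (bigD1 a) //= addrCA !addrA.
Qed.

Section Constants.
Variables (K : fieldType) (n : nat) (I : finType) (xi : I -> {mpoly K[n]}).
Hypothesis hxi : forall k, xi k \is 1%N.-homog.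
Variable kv : 'I_n -> I.
Hypothesis xi_kv : forall a, xi (kv a) = 'X_a.
Variables (r : nat) (deg : 'I_r -> nat).
Notation M := (fmod hxi deg).
Notation W := (vset kv).

Definition cst (u : M) : 'rV[K]_r := \row_a (u a)@_0%MM.
Definition emb (v : 'rV[K]_r) : M := [ffun a => (v 0 a)%:MP].
Definition in_strand d (v : 'rV[K]_r) := forall a, v 0 a != 0 -> deg a = d.

Lemma cst_linear k u v : cst (k *: u + v) = k *: cst u + cst v.
Proof. by apply/rowP => a; rewrite !mxE !ffunE mcoeffD mcoeffZ. Qed.

Lemma cst0 : cst 0 = 0.
Proof. by apply/rowP => a; rewrite !mxE ffunE mcoeff0. Qed.

Lemma cstB u v : cst (u - v) = cst u - cst v.
Proof. by rewrite addrC -scaleN1r cst_linear scaleN1r addrC. Qed.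

Lemma cst_emb v : cst (emb v) = v.
Proof. by apply/rowP => a; rewrite mxE ffunE mcoeffC eqxx mulr1. Qed.

Lemma cst_strand d u : fproj deg d u = u -> in_strand d (cst u).
Proof.
move=> pu a; rewrite mxE -pu ffunE; case: ifP => [le|_]; last by rewrite mcoeff0 eqxx.
case: (ltngtP (deg a) d) le => // lt _; rewrite pihomog_coef0 ?eqxx //.
by rewrite subn_gt0.
Qed.

Lemma emb_strand d v : in_strand d v -> fproj deg d (emb v) = emb v.
Proof.
move=> h; apply/ffunP => a; rewrite !ffunE.
have [->|/h ->] := eqVneq (v 0 a) 0; first by rewrite mpolyC0 linear0 if_same.
by rewrite leqnn subnn pihomog0E mcoeffC eqxx mulr1.
Qed.

Lemma cst_kd (c : chain M) T : cst (kd c T) = 0.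
Proof.
apply/rowP => a; rewrite !mxE ffunE sum_ffunE raddf_sum big1 // => k _ /=.
rewrite ffunE mcoeffZ ffunE rmorphM /=.
by rewrite (dhomog_nemf_coeff (hxi k)) ?mul0r ?mulr0 //= mdeg0.
Qed.

(** An element without constant terms is a sum of ['X_a w_a], which is the boundary of the sum of
    the [e_a w_a]. Together with [cst_kd]: the boundaries in exterior degree 0 are exactly the
    kernel of the passage to F (x) K. *)
Lemma cst0_kd (u : M) : cst u = 0 -> exists2 c : chain M, ws W c & kd c = at0 u.
Proof.
move=> u0; have /fin_all_exists [q hq] : forall b, exists q : 'I_n -> {mpoly K[n]},
    u b = \sum_a 'X_a * q a.
  move=> b; have [q eq] := mpoly_euler (u b); exists q; rewrite {1}eq.
  by have /rowP/(_ b) := u0; rewrite !mxE => ->; rewrite mpolyC0 add0r.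
pose w a : M := [ffun b => q b a].
exists (\sum_a wedge (kv a) (at0 (w a))).
  apply: (subspace_sum (ws_subspace M W)) => a _.
  by apply: wedge_ws; [exact: kv_in|exact: at0_ws].
have kds (r' : seq 'I_n) : kd (\sum_(a <- r') wedge (kv a) (at0 (w a))) = \sum_(a <- r') at0
  (gm_X M (kv a) (w a)).
  elim: r' => [|a r' IH]; first by rewrite !big_nil kd0.
  by rewrite !big_cons kdD IH kd_wedge kd_at0 cX_at0 wedge0 subr0.
rewrite kds -at0_sum; congr at0; apply/ffunP => b.
rewrite sum_ffunE hq; apply: eq_bigr => a _.
by rewrite !ffunE xi_kv.
Qed.

End Constants.

(** * Tor computed by a free resolution, as Koszul homology *)

Section TorKoszul.
Variables (K : fieldType) (n : nat) (I : finType) (xi : I -> {mpoly K[n]}).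
Hypothesis hxi : forall k, xi k \is 1%N.-homog.
Variable kv : 'I_n -> I.
Hypothesis xi_kv : forall a, xi (kv a) = 'X_a.
Notation W := (vset kv).
Variables (J : {mpoly K[n]} -> Prop) (F : graded_free_resolution J).
Hypothesis hJ : hideal J.

Definition frM k : gmod K I := fmod hxi (@fr_deg _ _ _ F k).

Definition frD k (u : frM k.+1) : frM k := [ffun b => \sum_a u a * fr_diff F k a b].

Lemma frD_linear k : linear (@frD k).
Proof.
move=> c u v; apply/ffunP => b; rewrite !ffunE scaler_sumr -big_split.
by apply: eq_bigr => a _; rewrite !ffunE mulrDl scalerAl.
Qed.
HB.instance Definition _ k := GRing.isLinear.Build K _ _ _ (@frD k) (@frD_linear k).

Definition fraug (u : frM 0) : rmod hxi := \sum_a u a * fr_aug F a 0.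

Lemma fraug_linear : linear fraug.
Proof.
move=> c u v; rewrite /fraug scaler_sumr -big_split.
by apply: eq_bigr => a _; rewrite !ffunE mulrDl scalerAl.
Qed.
HB.instance Definition _ := GRing.isLinear.Build K _ _ _ fraug fraug_linear.

Lemma frD_X k z u : frD (gm_X (frM k.+1) z u) = gm_X (frM k) z (frD u).
Proof.
apply/ffunP => b; rewrite !ffunE mulr_sumr; apply: eq_bigr => a _.
by rewrite ffunE mulrA.
Qed.

Lemma fraug_X z u : fraug (gm_X (frM 0) z u) = gm_X (rmod hxi) z (fraug u).
Proof.
rewrite /fraug /= /mulx mulr_sumr; apply: eq_bigr => a _.
by rewrite ffunE mulrA.
Qed.

Lemma frD_p k e u : frD (gm_p (frM k.+1) e u) = gm_p (frM k) e (frD u).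
Proof.
apply/ffunP => b; rewrite !ffunE linear_sum /=.
rewrite -[RHS](_ : \sum_a (if (fr_deg b <= e)%N then pihomog mdeg (e - fr_deg b) (u a * fr_diff
  F k a b) else 0) = _); last first.
  by case: ifP => // _; rewrite big1.
apply: eq_bigr => a _; rewrite ffunE.
have [->|/fr_diff_homog [le hom]] := eqVneq (fr_diff F k a b) 0.
  by rewrite !mulr0 linear0 if_same.
case: leqP => lea.
  rewrite (leq_trans le lea) -(pihomog_mul _ _ hom); congr (pihomog _ _ _).
  by rewrite addnBA // subnK.
rewrite mul0r; case: leqP => // leb.
by rewrite (pihomog_mul_lt _ hom) // ltn_sub2r // (leq_ltn_trans leb).
Qed.

Lemma fraug_p e u : fraug (gm_p (frM 0) e u) = gm_p (rmod hxi) e (fraug u).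
Proof.
rewrite /fraug linear_sum; apply: eq_bigr => a _; rewrite ffunE /=.
have hom := fr_aug_homog a.
case: leqP => lea; first by rewrite -(pihomog_mul _ _ hom) subnK.
by rewrite mul0r (pihomog_mul_lt _ hom).
Qed.

(** The image of F_(k+1) in F_k, described as a kernel by exactness ([frB_im]). Thus F_0 modulo
    [frB] is R/J, and F_(k+1) modulo [frB] is the k-th image [frB k], a syzygy module. *)
Definition frB k : frM k -> Prop :=
  match k with
  | 0 => fun u => J (fraug u)
  | k'.+1 => fun u => frD u = 0
  end.

Lemma frB_gsub k : gsub (@frB k).
Proof.
case: k => [|k]; split.
- split; first by rewrite /= linear0; apply: hi0 hJ.
  by move=> a u v hu hv; rewrite /= linearP; apply: (hideal_sub hJ).2.
- by move=> z m /= hm; rewrite fraug_X; apply: (hiM hJ).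
- by move=> e m /= hm; rewrite fraug_p; apply: (hip hJ).
- split; first by rewrite /= linear0.
  by move=> a u v /= hu hv; rewrite linearP /= hu hv scaler0 addr0.
- by move=> z m /= hm; rewrite frD_X hm linear0.
- by move=> e m /= hm; rewrite frD_p hm linear0.
Qed.

Lemma frD_row k (u : frM k.+1) : \row_b frD u b = (\row_a u a) *m fr_diff F k.
Proof. by apply/rowP => b; rewrite !mxE ffunE; apply: eq_bigr => a _; rewrite mxE. Qed.

Lemma frB_im k u : @frB k u <-> exists w, u = frD w.
Proof.
have rowK r (v : {ffun 'I_r -> {mpoly K[n]}}) w : \row_a v a = \row_a w a -> v =1 w.
  by move=> /rowP e a; have := e a; rewrite !mxE.
have im (v : frM k) : (exists w, \row_a v a = w *m fr_diff F k) <-> exists w, v = frD w.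
  split=> [[w e]|[w ->]]; last by exists (\row_a w a); rewrite frD_row.
  exists [ffun a => w 0 a]; apply/ffunP/rowK.
  rewrite frD_row e; congr (_ *m _); apply/rowP => a; by rewrite !mxE ffunE.
rewrite -im; case: k u {im} => [|k] u /=.
  rewrite -fr_exact0 mxE /fraug.
  by rewrite (eq_bigr (fun a => (\row_a u a) 0 a * fr_aug F a 0)) // => a _; rewrite mxE.
rewrite -fr_exactS -frD_row; split=> [->|e].
  by apply/rowP => b; rewrite !mxE ffunE.
by apply/ffunP => b; move/rowP/(_ b): e; rewrite mxE [X in _ = X]mxE => ->; rewrite ffunE.
Qed.

Lemma hdim_res_shift k i j m :
  hdim (@frB k.+1) W i.+1 j.+1 m -> hdim (@frB k) W i.+2 j m.
Proof.
apply: (@hdim_shift _ _ _ _ _ _ (@frD k)).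
- exact: frB_gsub.
- exact: frB_gsub.
- exact: frD_X.
- exact: frD_p.
- exact: frB_im.
- by [].
- exact: vanishing_free.
- exact: vanishing_free.
Qed.

(** Shifting stops in exterior degree 1: a further step would need H_0 of a free module to vanish.
    The passage from there to F (x) K is [hdim_tor1]. *)
Lemma hdim_res_iter i k j m :
  hdim (@frB (k + i)) W 1 (j + i) m -> hdim (@frB k) W i.+1 j m.
Proof.
elim: i k j => [|i IH] k j; first by rewrite !addn0.
by rewrite -!addSnnS => /IH; apply: hdim_res_shift.
Qed.

Lemma hdim_res_aug i j m : hdim (@frB 0) W i j m -> hdim (M := rmod hxi) J W i j m.
Proof.
have iso := @hdim_iso _ _ _ (rmod hxi) (@frB 0) J fraug (frB_gsub 0) (hideal_gsub hxi hJ)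
  fraug_X fraug_p.
apply: (proj1 (iso _ _ W i j m)); first by [].
move=> p; have [u hu] := fr_aug_surj F p; exists [ffun a => u 0 a].
  rewrite /= /fraug (eq_bigr (fun a => u 0 a * fr_aug F a 0)); first by move: hu; rewrite mxE.
  by move=> a _; rewrite ffunE.
Qed.

Lemma cst_frD k (u : frM k.+1) : cst (frD u) = cst u *m tor_diff F k.
Proof.
apply/rowP => b; rewrite !mxE ffunE raddf_sum; apply: eq_bigr => a _ /=.
by rewrite !mxE rmorphM.
Qed.

Lemma tor_strandP k d (v : 'rV[K]_(fr_rank F k)) :
  (v <= tor_strand F k d)%MS <-> in_strand (@fr_deg _ _ _ F k) d v.
Proof.
split=> [/submxP [w ->] a|h].
  by rewrite mul_mx_diag !mxE; case: (fr_deg a =P d) => [//|_]; rewrite mulr0 eqxx.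
apply/submxP; exists v; apply/rowP => a; rewrite mul_mx_diag !mxE.
have [->|/h ->] := eqVneq (v 0 a) 0; first by rewrite mul0r.
by rewrite eqxx mulr1.
Qed.

Lemma tor_boundaryP k d (v : 'rV[K]_(fr_rank F k)) :
  (v <= tor_strand F k.+1 d *m tor_diff F k)%MS <->
  exists2 s, in_strand (@fr_deg _ _ _ F k.+1) d s & v = s *m tor_diff F k.
Proof.
split=> [/submxP [w ->]|[s /tor_strandP hs ->]]; last exact: submxMr.
by exists (w *m tor_strand F k.+1 d); [apply/tor_strandP; apply: submxMl | rewrite mulmxA].
Qed.

(** With this inclusion the truncated difference of ranks in [tor_dim] is the dimension of a
    quotient. Degrees and the complex property are inherited from F by taking constant terms of
    liftings. *)
Lemma tor_boundary_cycle k d :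
  (tor_strand F k.+1 d *m tor_diff F k <= tor_cycles F k :&: tor_strand F k d)%MS.
Proof.
apply/row_subP => a; set v := row a _.
have /tor_boundaryP [s hs ->] : (v <= tor_strand F k.+1 d *m tor_diff F k)%MS.
  exact: row_sub.
have es := emb_strand hxi hs.
have ev : s *m tor_diff F k = cst (frD (emb hxi (@fr_deg _ _ _ F k.+1) s : frM k.+1)) by
  rewrite cst_frD cst_emb.
rewrite sub_capmx; apply/andP; split; last first.
  by apply/tor_strandP; rewrite ev; apply: cst_strand; rewrite -[in RHS]es; apply/esym;
    exact: frD_p.
case: k {a v es} s hs ev => [|k] s hs ev; first exact: submx1.
apply/sub_kermxP; rewrite ev -cst_frD.
have /= -> : @frB k.+1 (frD (emb hxi (@fr_deg _ _ _ F k.+2) s : frM k.+2)) by apply/frB_im; eexists.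
exact: cst0.
Qed.

Lemma tor_dimE k d :
  dimq (fun v : 'rV[K]_(fr_rank F k) => v <= tor_cycles F k :&: tor_strand F k d)%MS
       (fun v => exists2 s, in_strand (@fr_deg _ _ _ F k.+1) d s & v = s *m tor_diff F k)
       (tor_dim F k d).
Proof.
have := dimq_rowspace (tor_boundary_cycle k d); apply: dimq_ext => //.
- by move=> v _; exact: tor_boundaryP.
- by split=> [|a u v hu hv]; [exact: sub0mx|apply: addmx_sub => //; apply: scalemx_sub].
Qed.

Lemma row_subspace m1 m2 (A : 'M[K]_(m1, m2)) : subspace (fun v : 'rV_m2 => (v <= A)%MS).
Proof.
by split=> [|a u v hu hv]; [exact: sub0mx|apply: addmx_sub => //; apply: scalemx_sub].
Qed.

Lemma frD_hom k d (w : frM k.+1) (u : frM k) : gm_p (frM k) d u = u -> u = frD w ->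
  u = frD (gm_p (frM k.+1) d w).
Proof. by move=> pu e; rewrite frD_p -e pu. Qed.

Lemma cst_p k d (u v : frM k) : cst u = cst v -> cst (gm_p (frM k) d u) = cst (gm_p (frM k) d v).
Proof.
move=> ec; apply/rowP => a; have /rowP/(_ a) := ec; rewrite !mxE.
rewrite !ffunE; case: ifP => // le e'.
by case: (posnP (d - fr_deg a)) => [->|lt];
  [rewrite !pihomog0E !mcoeffC e' | rewrite !pihomog_coef0].
Qed.

(** In exterior degree 0 the Koszul boundaries divide F_0 by the maximal ideal, and [frB] divides by
    the image of F_1; what remains is the cokernel of the differential of F (x) K. *)
Lemma hdim_tor0 j : hdim (@frB 0) W 0 j (tor_dim F 0 j).
Proof.
have := tor_dimE 0 j.
apply: (@dimq_rel _ _ _ _ _ _ _ (fun v (c : chain (frM 0)) => cst (c set0) = v)).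
- exact: row_subspace.
- exact: Cyc_subspace (frB_gsub 0) _ _ _.
- by move=> a u v c d hc hd; rewrite !ffunE cst_linear hc hd.
- move=> v; rewrite sub_capmx => /andP[_ /tor_strandP hv].
  exists (at0 (emb hxi (@fr_deg _ _ _ F 0) v : frM 0)); last by rewrite ffunE eqxx cst_emb.
  split; [exact: at0_ws|by rewrite cP_at0 /= emb_strand|].
  by rewrite kd_at0; apply: subspace0 (cin_subspace (frB_gsub 0)).
- move=> c [wc pc _]; exists (cst (c set0)) => //.
  rewrite sub_capmx submx1 /=; apply/tor_strandP; apply: cst_strand.
  by rewrite -{2}pc ffunE cards0 eqxx.
move=> v c _ [wc pc _] e; split=> [[s hs ev]|[c' wc' h]].
  have [c' wc' hc'] : exists2 c' : chain (frM 0), ws W c' &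
      kd c' = at0 (c set0 - frD (emb hxi (@fr_deg _ _ _ F 1) s : frM 1)).
    by apply: cst0_kd => //; rewrite cstB cst_frD cst_emb e ev subrr.
  exists c' => // T; rewrite hc' at0B -(at0E pc) subKr.
  rewrite ffunE; case: ifP => _; last by apply: subspace0; apply: gs_sub (frB_gsub 0).
  by apply/frB_im; eexists.
have /frB_im [w ew] := h set0.
have p0 : gm_p (frM 0) j (c set0) = c set0 by rewrite -{2}pc ffunE cards0 eqxx.
have ec : cst (c set0) = cst (frD w).
  by rewrite -ew chainBE cstB cst_kd subr0.
exists (cst (gm_p (frM 1) j w)).
  by apply: cst_strand; exact: fproj_id.
rewrite -cst_frD frD_p -e -{1}p0.
exact: cst_p.
Qed.

(** A zigzag in the double complex of F and the Koszul complex: a cycle [c] of exterior degree 1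
    modulo [frB k] has [kd c = frD b] at the empty set, and corresponds to the constant part of
    [b]. *)
Lemma hdim_tor1 k j : hdim (@frB k) W 1 j (tor_dim F k.+1 j.+1).
Proof.
have hB := frB_gsub k.
have := tor_dimE k.+1 j.+1.
pose rel (v : 'rV[K]_(fr_rank F k.+1)) (c : chain (frM k)) :=
  exists b : frM k.+1, [/\ gm_p (frM k.+1) j.+1 b = b, kd c = at0 (frD b) & v = cst b].
have v1 := @vanishing_free _ _ _ _ hxi _ xi_kv _ (@fr_deg _ _ _ F k) 0 j.
apply: (@dimq_rel _ _ _ _ _ _ _ rel).
- exact: row_subspace.
- exact: Cyc_subspace.
- move=> a u v c d [b [pb eb ->]] [b' [pb' eb' ->]]; exists (a *: b + b'); split.
  + by rewrite linearP pb pb'.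
  + by rewrite kd_linear eb eb' linearP at0_linear.
  + by rewrite cst_linear.
- move=> v; rewrite sub_capmx => /andP[/sub_kermxP kv0 /tor_strandP hv].
  pose b : frM k.+1 := emb hxi (@fr_deg _ _ _ F k.+1) v.
  have pb : gm_p (frM k.+1) j.+1 b = b by exact: emb_strand.
  have [|c wc ec] := cst0_kd xi_kv (u := frD b); first by rewrite cst_frD cst_emb.
  have ec' : kd (cP 1 j c) = at0 (frD b) by rewrite kd_cP ec cP_at0 -frD_p pb.
  exists (cP 1 j c); last by exists b; split; rewrite // cst_emb.
  split; [exact: cP_ws|exact: cP_id|rewrite ec' => T].
  rewrite ffunE; case: ifP => _; last by apply: subspace0; apply: gs_sub.
  by apply/frB_im; eexists.
- move=> c [wc pc kc]; have /frB_im [w ew] := kc set0.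
  have pk : cP 0 j.+1 (kd c) = kd c by rewrite -kd_cP pc.
  have p0 : gm_p (frM k) j.+1 (kd c set0) = kd c set0.
    by rewrite -{2}pk [RHS]ffunE cards0 eqxx.
  exists (cst (gm_p (frM k.+1) j.+1 w)).
    rewrite sub_capmx; apply/andP; split.
      by apply/sub_kermxP; rewrite -cst_frD -(frD_hom p0 ew) cst_kd.
    by apply/tor_strandP; apply: cst_strand; exact: fproj_id.
  exists (gm_p (frM k.+1) j.+1 w); split=> //; first by rewrite gm_pp.
  by rewrite -(frD_hom p0 ew); exact: at0E pk.
move=> v c _ [wc pc kc] [b [pb eb ->]]; split=> [[s hs es]|[c'' wc'' hc'']].
  (* If the constant part of [b] is a boundary from [s], then [b - frD s] is [kd d]. The chain
     [f = frD d] takes values in [frB k] and has the same boundary as [c], so [c - f] bounds in the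
     free module F_k. *)
  have [|d wd ed] := cst0_kd xi_kv (u := b - frD (emb hxi (@fr_deg _ _ _ F k.+2) s : frM k.+2)).
    by rewrite cstB cst_frD cst_emb es subrr.
  pose f : chain (frM k) := cmap (@frD k) (cP 1 j d).
  have ef : kd f = kd c.
    rewrite -cmap_kd; last exact: frD_X.
    rewrite kd_cP ed cP_at0 cmap_at0 eb; congr at0; rewrite -[LHS]/(frD _) frD_p linearB /=.
    have -> : frD (frD (emb hxi (@fr_deg _ _ _ F k.+2) s : frM k.+2)) = 0 :> frM k.
      by have : @frB k.+1 (frD (emb hxi (@fr_deg _ _ _ F k.+2) s : frM k.+2)) by apply/frB_im;
        eexists.
    by rewrite subr0 -frD_p pb.
  have [|c'' wc'' /cin_zerop hc''] := v1 (c - f).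
    split.
    - by apply: (subspaceB (ws_subspace _ W)) => //; apply: cmap_ws; apply: cP_ws.
    - rewrite cPB pc /f -cmap_cP ?cP_id //; exact: frD_p.
    - by apply/cin_zerop; rewrite kdB ef subrr.
  exists c'' => //; move: hc'' => /eqP; rewrite subr_eq0 => /eqP <-.
  rewrite subKr => T; rewrite ffunE; apply/frB_im; by eexists.
(* Conversely [c] is a boundary plus [frD b']. Then [frD b = frD beta] for [beta = kd b'], whose
   constant part is 0; by exactness [b - beta] is some [frD w], and [w] gives the boundary in F (x)
   K. *)
pose x := cP 1 j (kd c'').
have kx : kd x = 0 by rewrite kd_cP kdd cP_0.
have [|b0 wb0 eb0] := cin_im (@frB_im k) (c := cP 1 j (c - kd c'')) (W := W) _ (cin_cP hB 1 j hc'').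
  by apply: cP_ws; apply: (subspaceB (ws_subspace _ W)) => //; apply: kd_ws.
pose b' := cP 1 j b0; pose beta := kd b' set0.
have eb' : c - x = cmap (@frD k) b'.
  by rewrite cmap_cP -?eb0 ?cP_id ?cPB ?pc //; exact: frD_p.
have ekb : kd b' = at0 beta by apply: (at0E (j := j.+1)); rewrite -kd_cP cP_id.
have e0 : frD b = frD beta.
  apply: at0_inj; rewrite -eb -cmap_at0 -ekb cmap_kd; last exact: frD_X.
  by rewrite -eb' kdB kx subr0.
have pbeta : gm_p (frM k.+1) j.+1 beta = beta.
  by apply: at0_inj; rewrite -cP_at0 -ekb -kd_cP cP_id.
have /frB_im [w ew] : @frB k.+1 (b - beta) by rewrite /= linearB /= e0 subrr.
have pbb : gm_p (frM k.+1) j.+1 (b - beta) = b - beta by rewrite linearB /= pb pbeta.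
exists (cst (gm_p (frM k.+2) j.+1 w)).
  by apply: cst_strand; exact: fproj_id.
by rewrite -cst_frD -(frD_hom pbb ew) cstB cst_kd subr0.
Qed.

(** The left side does not mention F: this is also the independence of the Betti numbers from the
    resolution. *)
Theorem hdim_tor i j : hdim (M := rmod hxi) J W i j (tor_dim F i (i + j)).
Proof.
apply: hdim_res_aug; case: i => [|i]; first exact: hdim_tor0.
apply: hdim_res_iter; rewrite add0n addSn addnC; exact: hdim_tor1.
Qed.

End TorKoszul.

(** * Complete graphs *)

Section Segre.
Variables (K : fieldType) (V : finType).
Notation S := (vertex_ring K V).
Notation ix u := (lshift #|V| (enum_rank u)).
Notation iy u := (rshift #|V| (enum_rank u)).

Lemma vertex_indexP (P : 'I_(#|V| + #|V|) -> Prop) :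
  (forall u : V, P (ix u)) -> (forall u : V, P (iy u)) -> forall i, P i.
Proof.
move=> hx hy i; rewrite -(splitK i); case: (split i) => r /=.
  by rewrite -(enum_valK r); apply: hx.
by rewrite -(enum_valK r); apply: hy.
Qed.

Definition by_vertex T (f g : V -> T) (i : 'I_(#|V| + #|V|)) : T :=
  match split i with inl r => f (enum_val r) | inr r => g (enum_val r) end.

Lemma by_vertexl T (f g : V -> T) u : by_vertex f g (ix u) = f u.
Proof. by rewrite /by_vertex (unsplitK (inl _)) enum_rankK. Qed.

Lemma by_vertexr T (f g : V -> T) u : by_vertex f g (iy u) = g u.
Proof. by rewrite /by_vertex (unsplitK (inr _)) enum_rankK. Qed.

Notation T := {mpoly K[2 + #|V|]}.
Definition svar : T := 'X_(lshift #|V| ord0).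
Definition tvar : T := 'X_(lshift #|V| ord_max).
Definition avar (u : V) : T := 'X_(rshift 2 (enum_rank u)).

(* x_u |-> s a_u, y_u |-> t a_u for u in U, the other variables going to 0: the
   kernel is J_(K_U) plus the variables outside U, and is obviously prime. *)
Definition segre_var (U : {set V}) : 'I_(#|V| + #|V|) -> T :=
  by_vertex (fun u => if u \in U then svar * avar u else 0)
            (fun u => if u \in U then tvar * avar u else 0).

Definition segre U (p : S) := psubst (segre_var U) p = 0.

Lemma segre_homog U i : segre_var U i \is 2.-homog.
Proof.
have h j (u : V) : ('X_j : T) * avar u \is 2.-homog.
    have hx (k : 'I_(2 + #|V|)) : ('X_k : T) \is 1.-homog by rewrite dhomogX /= mdeg1.
    exact: (dhomogM (hx j) (hx _)).
by elim/vertex_indexP: i => u; rewrite /segre_var ?by_vertexl ?by_vertexr; (case: ifP => _;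
  [exact: h | exact: dhomog0]).
Qed.

Lemma segre_hideal U : hideal (segre U).
Proof. exact: (@psubst_ker _ _ _ _ 2 _ (segre_homog U)). Qed.

Lemma segre_x U u : psubst (segre_var U) (xvar K u) = if u \in U then svar * avar u else 0.
Proof. by rewrite psubstX /segre_var by_vertexl. Qed.

Lemma segre_y U u : psubst (segre_var U) (yvar K u) = if u \in U then tvar * avar u else 0.
Proof. by rewrite psubstX /segre_var by_vertexr. Qed.

Implicit Type U : {set V}.

Lemma mpX_neq0 n (i : 'I_n) : ('X_i : {mpoly K[n]}) != 0.
Proof.
apply/eqP => /(congr1 (mcoeff U_(i)%MM)).
by rewrite mcoeffXU eqxx mcoeff0 => /eqP; rewrite oner_eq0.
Qed.

Lemma segre_binomial U a b : segre U (xvar K a * yvar K b - xvar K b * yvar K a).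
Proof.
rewrite /segre rmorphB !rmorphM /= !segre_x !segre_y.
by case: (a \in U); case: (b \in U); rewrite ?(mul0r, mulr0, subrr) //; ring.
Qed.

Lemma segre_nzd U u p : u \in U -> segre U (xvar K u * p) -> segre U p.
Proof.
rewrite /segre => uU; rewrite rmorphM /= segre_x uU => /eqP.
by rewrite !mulf_eq0 (negbTE (mpX_neq0 _)) (negbTE (mpX_neq0 _)) => /eqP.
Qed.

(** Setting a_u to 0 turns the parametrization for [U] into the one for [U :\ u]. *)
Lemma segre_sub U u p : segre U p -> segre (U :\ u) p.
Proof.
rewrite /segre => h.
have e i : psubst (kill K [set rshift 2 (enum_rank u)]) (segre_var U i) = segre_var (U :\ u) i.
  have k0 (j : 'I_2) : psubst (kill K [set rshift 2 (enum_rank u)]) 'X_(lshift #|V| j) =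
    'X_(lshift #|V| j).
    by rewrite psubstX /kill inE eq_lrshift.
  have ka w : psubst (kill K [set rshift 2 (enum_rank u)]) (avar w) = if w == u then 0 else avar w.
    by rewrite psubstX /kill inE (inj_eq (@rshift_inj _ _)) (inj_eq enum_rank_inj).
  elim/vertex_indexP: i => w; rewrite /segre_var ?by_vertexl ?by_vertexr inE andbC;
    case: (w \in U); rewrite ?linear0 //= rmorphM /= k0 ka in_set1;
    by case: eqP; rewrite ?mulr0.
by rewrite -(psubst_comp e) h linear0.
Qed.

Lemma segre_kill U u p : psubst (segre_var U) (psubst (kill K [set ix u;
  iy u]) p) = psubst (segre_var (U :\ u)) p.
Proof.
apply: psubst_comp => i; rewrite /kill !inE.
elim/vertex_indexP: i => w; rewrite ?eq_lshift ?eq_rshift ?eq_lrshift ?eq_rlshift ?orbF /=.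
  rewrite (inj_eq enum_rank_inj) /segre_var by_vertexl !inE; case: eqP => _ /=;
    first by rewrite linear0.
  by rewrite psubstX by_vertexl.
rewrite (inj_eq enum_rank_inj) /segre_var by_vertexr !inE; case: eqP => _ /=;
  first by rewrite linear0.
by rewrite psubstX by_vertexr.
Qed.

(** All the x_w, and the y_w outside [U]: the generators of the colon ideal by y_u of the Segre
    ideal plus x_u, for u in [U]. *)
Definition colon_vars (U : {set V}) : {set 'I_(#|V| + #|V|)} :=
  [set i | by_vertex (fun _ => true) (fun u => u \notin U) i].

(** Specializing s to 0, t to 1 and a_u to y_u turns the parametrization into the substitution that
    kills [colon_vars U]. *)
Lemma segre_colon U p : segre U p -> varideal (colon_vars U) p.
Proof.
rewrite /segre /varideal => h.
pose th : 'I_(2 + #|V|) -> S := fun j =>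
  match split j with inl r => if r == ord0 then 0 else 1 | inr r => yvar K (enum_val r) end.
have e i : psubst th (segre_var U i) = kill K (colon_vars U) i.
  have ea w : psubst th (avar w) = yvar K w by rewrite psubstX /th (unsplitK (inr _)) enum_rankK.
  elim/vertex_indexP: i => w; rewrite /kill inE /segre_var ?by_vertexl ?by_vertexr.
    case: ifP => _; rewrite ?linear0 // rmorphM /= psubstX.
    by rewrite {1}/th (unsplitK (inl _)) /= mul0r.
  case: ifP => _; rewrite ?linear0 // rmorphM /= ea psubstX.
  by rewrite {1}/th (unsplitK (inl _)) /= mul1r.
by rewrite -(psubst_comp e) h linear0.
Qed.

Lemma varideal_gen n (A : {set 'I_n}) (C : {mpoly K[n]} -> Prop) p :
  subspace C -> (forall a q, a \in A -> C ('X_a * q)) -> varideal A p -> C p.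
Proof.
move=> sC hA pA; rewrite -[p]subr0 -pA; elim/mpoly_span: p {pA} => [|c m p IH].
  by rewrite linear0 subr0; apply: subspace0.
rewrite linearD linearZ /= opprD addrACA -scalerBr; apply: sC.2 => //.
rewrite kill_mon; case: existsP => [[i /andP[iA mi]]|_]; last first.
  by rewrite subrr; apply: subspace0.
rewrite subr0 (_ : m = U_(i) + (m - U_(i)))%MM; first by rewrite mpolyXD; apply: hA.
by rewrite addmC submK ?lep1mP.
Qed.

(** * The regularity bound for Segre ideals *)

Section Regularity.
Variables (I : finType) (xi : I -> S).
Hypothesis hxi : forall k, xi k \is 1%N.-homog.
Variable kv : 'I_(#|V| + #|V|) -> I.
Hypothesis xi_kv : forall a, xi (kv a) = 'X_a.
Notation R := (rmod hxi).

Lemma segre_addXX U u p :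
  addX (M := R) (addX (M := R) (segre U) (kv (ix u))) (kv (iy u)) p <-> segre (U :\ u) p.
Proof.
have xy0 : segre (U :\ u) (xvar K u) /\ segre (U :\ u) (yvar K u).
  by rewrite /segre segre_x segre_y !inE eqxx.
split=> [[_ [q [[b [q' [hb ->]]] ->]]]|h].
  rewrite /= /mulx !xi_kv; have hi := segre_hideal (U :\ u).
  apply: (hiD hi); last by rewrite mulrC; apply: (hiM hi); case: xy0.
  apply: (hiD hi); first exact: segre_sub.
  by rewrite mulrC; apply: (hiM hi); case: xy0.
have [q1 e1] := kill1_decomp (ix u) p.
have [q2 e2] := kill1_decomp (iy u) (psubst (kill K [set ix u]) p).
exists (psubst (kill K [set iy u]) (psubst (kill K [set ix u]) p) + 'X_(ix u) * q1), q2.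
split; last by rewrite /= /mulx xi_kv addrAC -e2 -e1.
exists (psubst (kill K [set iy u]) (psubst (kill K [set ix u]) p)), q1.
split; last by rewrite /= /mulx xi_kv.
by rewrite /segre kill_comp setUC segre_kill.
Qed.

(* x_w y_u = x_u y_w modulo the kernel. *)
Lemma segre_colonX U u p : u \in U ->
  colonX (M := R) (addX (M := R) (segre U) (kv (ix u))) (kv (iy u)) p <->
  varideal (colon_vars U) p.
Proof.
move=> uU; have hR := hideal_gsub hxi (segre_hideal U).
have sA := gs_sub (addX_gsub hR (kv (ix u))).
have hi := segre_hideal U.
split=> [[b [q [hb e]]]|].
  move: e; rewrite /= /mulx !xi_kv => /(congr1 (psubst (kill K (colon_vars U)))).
  rewrite rmorphD !rmorphM /= (segre_colon hb) add0r !psubstX.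
  have -> : kill K (colon_vars U) (ix u) = 0 by rewrite /kill inE by_vertexl.
  have -> : kill K (colon_vars U) (iy u) = 'X_(iy u) by rewrite /kill inE by_vertexr uU.
  rewrite mul0r => /eqP.
  by rewrite mulf_eq0 (negbTE (mpX_neq0 _)) => /eqP.
apply: varideal_gen => [|a q]; first exact: (gs_sub (colonX_gsub (addX_gsub hR _) _)).
rewrite inE /colonX /= /mulx xi_kv.
elim/vertex_indexP: a => w; rewrite ?by_vertexl ?by_vertexr => wU.
  exists ((xvar K w * yvar K u - xvar K u * yvar K w) * q), (yvar K w * q).
  split; first by rewrite mulrC; apply: (hiM hi); exact: segre_binomial.
  rewrite /= /mulx xi_kv /xvar /yvar; ring.
exists ('X_(iy u) * ('X_(iy w) * q)), 0; split; last by rewrite linear0 addr0.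
apply: (hiM hi); rewrite mulrC; apply: (hiM hi).
by rewrite /segre segre_y (negbTE wU).
Qed.

(** Induction on [U] from the maximal ideal: x_u is a nonzerodivisor, and modulo x_u the element y_u
    leads to the ideal of [U :\ u] and to a colon ideal generated by variables. The colon enters one
    coefficient degree lower, where vanishing needs degree at least 1; hence the bound 2 here. *)
Lemma vanishing_segre U i j : vanishing (M := R) (segre U) (vset kv) i j.+2.
Proof.
elim: {U}_.+1 {-2}U (ltnSn #|U|) i => // k IH U leU i.
have [->|] := eqVneq U set0.
  move=> c [wc pc _]; apply: Bnd_cin => A; rewrite -pc ffunE; case: ifP => _;
    last by rewrite /segre linear0.
  rewrite /segre -(@psubst_comp _ _ _ _ (kill K setT) (segre_var setT)).
    by rewrite kill_all /= pihomog_coef0 // mpolyC0 linear0.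
  move=> a; rewrite /kill inE linear0.
  by elim/vertex_indexP: a => u; rewrite /segre_var ?by_vertexl ?by_vertexr inE.
case/set0Pn => u uU.
have hR := hideal_gsub hxi (segre_hideal U).
apply: (@vanishing_nzd _ _ _ _ hR _ (kv (ix u))).
- exact: kv_in.
- move=> p; rewrite /colonX /= /mulx xi_kv; exact: segre_nzd.
apply: (@vanishing_colon _ _ _ _ (addX_gsub hR _) _ (kv (iy u))).
  apply: (@vanishing_ext _ _ R (varideal (colon_vars U))) => [p|].
    by rewrite segre_colonX.
  exact: vanishing_var.
apply: (@vanishing_ext _ _ R (segre (U :\ u))) => [p|]; first by rewrite segre_addXX.
apply: IH; move: leU; by rewrite (cardsD1 u) uU.
Qed.

End Regularity.

(** * Binomials spanning the Segre ideal *)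

Section Toric.
Implicit Types (m : 'X_{1..#|V| + #|V|}) (p : S).

Definition vdeg m (u : V) : nat := m (ix u) + m (iy u).
Definition xdeg m : nat := \sum_u m (ix u).
(** Equality of the images under the parametrization: [vdeg] is the exponent of a_u and [xdeg] that
    of s, and the exponent of t is then determined. *)
Definition same_type m m' := (forall u, vdeg m u = vdeg m' u) /\ xdeg m = xdeg m'.

Lemma vdegD m m' u : vdeg (m + m') u = (vdeg m u + vdeg m' u)%N.
Proof. by rewrite /vdeg !mnmDE addnACA. Qed.

Lemma xdegD m m' : xdeg (m + m') = (xdeg m + xdeg m')%N.
Proof. by rewrite /xdeg -big_split; apply: eq_bigr => u _; rewrite mnmDE. Qed.

Lemma vdeg_x u w : vdeg U_(ix u) w = (u == w).
Proof. by rewrite /vdeg !mnm1E eq_lrshift addn0 eq_lshift (inj_eq enum_rank_inj). Qed.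

Lemma vdeg_y u w : vdeg U_(iy u) w = (u == w).
Proof. by rewrite /vdeg !mnm1E eq_rlshift add0n eq_rshift (inj_eq enum_rank_inj). Qed.

Lemma xdeg_x u : xdeg U_(ix u) = 1%N.
Proof.
rewrite /xdeg (bigD1 u) //= mnm1E eqxx big1 // => w wu.
by rewrite mnm1E eq_lshift (inj_eq enum_rank_inj) eq_sym (negbTE wu).
Qed.

Lemma xdeg_y u : xdeg U_(iy u) = 0%N.
Proof. by rewrite /xdeg big1 // => w _; rewrite mnm1E eq_rlshift. Qed.

Lemma mnm_split m i : m i != 0%N -> exists m', m = (U_(i) + m')%MM.
Proof. by move=> mi; exists (m - U_(i))%MM; rewrite addmC submK ?lep1mP. Qed.

Section Exchange.
Variables (C : S -> Prop) (P : (V -> nat) -> Prop).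
Hypothesis sC : subspace C.
Hypothesis Pext : forall f g, f =1 g -> P f -> P g.
Hypothesis exch : forall a b m,
  P (vdeg (U_(ix a) + U_(iy b) + m)%MM) ->
  C ((xvar K a * yvar K b - xvar K b * yvar K a) * 'X_[m]).

(* Monomials of the same type differ by swaps x_a y_b -> x_b y_a. *)
Lemma exchange m m' : same_type m m' -> P (vdeg m) -> C ('X_[m] - 'X_[m']).
Proof.
move=> st hP; rewrite -[m]add0m -[m']add0m; rewrite -[m]add0m in hP.
move: {2}(xdeg m') (erefl (xdeg m')) => r er.
elim: r 0%MM m m' er st hP => [|r IH] N m m' er [vd xd] hP.
  have x0 (k : 'X_{1..#|V| + #|V|}) : xdeg k = 0%N -> forall u, k (ix u) = 0%N.
    by move=> /eqP; rewrite sum_nat_eq0 => /forallP h u; apply/eqP/h.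
  have hm := x0 _ (etrans xd er); have hm' := x0 _ er.
  have -> : m = m'.
    apply/mnmP => i; elim/vertex_indexP: i => u; first by rewrite hm hm'.
    by have := vd u; rewrite /vdeg hm hm'.
  by rewrite subrr; apply: subspace0.
have xpos k : xdeg k = r.+1 -> exists u, k (ix u) != 0%N.
  move=> ek; apply/existsP; apply: contraT => /existsPn h.
  by move: ek; rewrite /xdeg big1 // => u _; apply/eqP/negPn/h.
have [b mb'] := xpos _ er; have [a ma] := xpos _ (etrans xd er).
have [m1' e1'] := mnm_split mb'; rewrite e1' xdegD xdeg_x in er.
case: er => er.
have [mb|/negPn/eqP mb] := boolP (m (ix b) != 0%N).
  have [m1 e1] := mnm_split mb; rewrite e1 e1' !addmA in hP *; apply: IH => //.
  move: vd xd; rewrite e1 e1' !xdegD => vd [/addnI xd]; split=> // u.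
  by have := vd u; rewrite !vdegD => /addnI.
(* x_b divides m' but not m, so y_b divides m because the degrees at b agree. Swapping x_a y_b into
   x_b y_a makes x_b a common factor. *)
have myb : m (iy b) != 0%N.
  by have := vd b; rewrite e1' vdegD vdeg_x eqxx /vdeg mb; case: (m (iy b)).
have [ma1 ea] := mnm_split ma.
have myb1 : ma1 (iy b) != 0%N by move: myb; rewrite ea mnmDE mnm1E eq_lrshift.
have [m0 e0] := mnm_split myb1.
have em : m = (U_(ix a) + U_(iy b) + m0)%MM by rewrite ea e0 addmA.
have step : C ('X_[N + m] - 'X_[N + U_(ix b) + (U_(iy a) + m0)]).
  have -> : ('X_[N + m] - 'X_[N + U_(ix b) + (U_(iy a) +
    m0)] : S) = (xvar K a * yvar K b - xvar K b * yvar K a) * 'X_[N + m0].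
    by rewrite em !mpolyXD /xvar /yvar; ring.
  by apply: exch; apply: Pext hP => u; rewrite em !vdegD; lia.
rewrite -['X_[N + m]](subrK 'X_[N + U_(ix b) + (U_(iy a) + m0)]) -addrA.
apply: subspaceD => //; rewrite e1' addmA; apply: IH => //.
  move: vd xd; rewrite em e1' !xdegD !xdeg_x !xdeg_y => vd xd; split;
    last by rewrite xdegD xdeg_y; lia.
  by move=> u; have := vd u; rewrite !vdegD !vdeg_x !vdeg_y; lia.
by apply: Pext hP => u; rewrite em !vdegD !vdeg_x !vdeg_y; lia.
Qed.

Definition tmon m : 'X_{1..2 + #|V|} :=
  [multinom match split j with
     | inl r => if r == ord0 then xdeg m else \sum_u m (iy u)
     | inr r => vdeg m (enum_val r) end | j < 2 + #|V|].

Lemma segre_mon m : psubst (segre_var setT) 'X_[m] = 'X_[tmon m].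
Proof.
rewrite psubst_mon big_split_ord /= [RHS]mpolyXE_id big_split_ord /= big_ord_recl big_ord1.
have e1 : \prod_(i < #|V|) segre_var setT (lshift #|V| i) ^+ m (lshift #|V| i) =
   \prod_u (svar * avar u) ^+ m (ix u).
  rewrite [RHS](reindex (@enum_val V V)) /=; last by apply: onW_bij; exact: enum_val_bij.
  by apply: eq_bigr => i _; rewrite -{1}(enum_valK i) /segre_var by_vertexl inE enum_valK.
have e2 : \prod_(i < #|V|) segre_var setT (rshift #|V| i) ^+ m (rshift #|V| i) =
   \prod_u (tvar * avar u) ^+ m (iy u).
  rewrite [RHS](reindex (@enum_val V V)) /=; last by apply: onW_bij; exact: enum_val_bij.
  by apply: eq_bigr => i _; rewrite -{1}(enum_valK i) /segre_var by_vertexr inE enum_valK.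
rewrite e1 e2 !mnmE (unsplitK (inl ord0)) (unsplitK (inl (lift ord0 ord0))) /=.
have e3 : \prod_(i < #|V|) 'X_(rshift 2 i) ^+ tmon m (rshift 2 i) = \prod_u (avar u) ^+ vdeg m u.
  rewrite [RHS](reindex (@enum_val V V)) /=; last by apply: onW_bij; exact: enum_val_bij.
  by apply: eq_bigr => i _; rewrite mnmE (unsplitK (inr i)) /avar enum_valK.
rewrite e3 /xdeg -!prodrXr -!big_split /=; apply: eq_bigr => u _.
rewrite !exprMn /vdeg exprD mulrACA; congr (_ * _ * _).
Qed.

Lemma tmon_type m m' : tmon m = tmon m' -> same_type m m'.
Proof.
move=> /mnmP e; split=> [u|].
  by have := e (rshift 2 (enum_rank u)); rewrite !mnmE (unsplitK (inr _)) enum_rankK.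
by have := e (lshift _ ord0); rewrite !mnmE (unsplitK (inl _)).
Qed.

(** Induction on the support. In the image of [p] the term of [m] must be cancelled by some [m'] of
    the same type, and subtracting a multiple of ['X_[m] - 'X_[m']] removes [m] without new
    monomials. As swaps preserve [vdeg], only binomials multiplied into degrees satisfying [P] are
    used; for the cone [P] asks that the apex occur. *)
Lemma toric p : segre setT p -> (forall m, m \in msupp p -> P (vdeg m)) -> C p.
Proof.
elim: {p}_.+1 {-2}p (ltnSn (size (msupp p))) => // k IH p lep hp hP.
case es : (msupp p) => [|m s].
  by move/eqP: es; rewrite msupp_eq0 => /eqP ->; apply: subspace0.
have mp : m \in msupp p by rewrite es mem_head.
have [m' [m'p nm tm]] : exists m', [/\ m' \in msupp p, m' != m & tmon m' = tmon m].
  move: hp; rewrite /segre => /(congr1 (mcoeff (tmon m))).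
  have -> : psubst (segre_var setT) p = \sum_(l <- msupp p) p@_l *: 'X_[tmon l].
    rewrite {1}[p]mpolyE linear_sum; apply: eq_bigr => l _.
    by rewrite linearZ /= segre_mon.
  rewrite mcoeff0 raddf_sum /= (bigD1_seq m) //= ?msupp_uniq //.
  rewrite mcoeffZ mcoeffX eqxx mulr1.
  have [/hasP [m' m'p /andP[nm /eqP tm]] _|/hasPn h] :=
    boolP (has (fun m' => (m' != m) && (tmon m' == tmon m)) (msupp p)).
    by exists m'.
  rewrite big_seq_cond big1 ?addr0 => [e|m' /andP[m'p nm]].
    by move: mp; rewrite mcoeff_msupp e eqxx.
  rewrite mcoeffZ mcoeffX.
  by have := h _ m'p; rewrite nm /= => /negbTE ->; rewrite mulr0.
pose q := p - p@_m *: ('X_[m] - 'X_[m']).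
have qE l : q@_l = p@_l - p@_m * ((m == l)%:R - (m' == l)%:R).
  by rewrite /q mcoeffB mcoeffZ mcoeffB !mcoeffX.
have qm : q@_m = 0 by rewrite qE eqxx (negbTE nm) subr0 mulr1 subrr.
have qsub l : l \in msupp q -> l \in msupp p.
  apply: contraLR => lp; rewrite mcoeff_msupp negbK qE (memN_msupp_eq0 lp).
  case: (m =P l) => [e|_]; first by rewrite e (negbTE lp) in mp.
  case: (m' =P l) => [e|_]; first by rewrite e (negbTE lp) in m'p.
  by rewrite subrr mulr0 subr0 eqxx.
have -> : p = q + p@_m *: ('X_[m] - 'X_[m']) by rewrite subrK.
apply: (subspaceD sC); last first.
  apply: (subspaceZ sC); apply: exchange; last exact: hP.
  exact: tmon_type.
apply: IH.
- rewrite -ltnS; apply: leq_trans lep; rewrite ltnS (perm_size (perm_to_rem mp)) /= ltnS.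
  apply: uniq_leq_size; first exact: msupp_uniq.
  move=> l lq; rewrite mem_rem_uniq ?msupp_uniq // inE qsub // andbT.
  by apply: contraTneq lq => ->; rewrite mcoeff_msupp qm eqxx.
- have hi := segre_hideal setT; apply: (subspaceB (hideal_sub hi)) => //.
  apply: (subspaceZ (hideal_sub hi)).
  by rewrite /segre linearB /= !segre_mon tm subrr.
- by move=> l /qsub; exact: hP.
Qed.

End Exchange.
End Toric.
End Segre.

(** * The linear strand *)

Lemma perm_swap_ind (T : eqType) (P : seq T -> Prop) :
  (forall p a b q, P (p ++ a :: b :: q) -> P (p ++ b :: a :: q)) ->
  forall s t, perm_eq s t -> P s -> P t.
Proof.
move=> hP s t; elim: t s P hP => [|x t IH] s P hP.
  by move=> /perm_nilP ->.
move=> st; have xs : x \in s by rewrite (perm_mem st) mem_head.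
have {xs} [p [q es]] : exists p q, s = p ++ x :: q.
  by case/splitPr: xs => p q; exists p, q.
have front p' : P (p' ++ x :: q) -> P (x :: p' ++ q).
  elim/last_ind: p' q {es} => [//|p' y IHp] q'.
  by rewrite !cat_rcons => /hP h; exact: (IHp (y :: q') h).
rewrite es => /front h; apply: (IH (p ++ q) (fun l => P (x :: l))) => //.
  by move=> p' a b q' h'; apply: (hP (x :: p')).
by move: st; rewrite es perm_catC /= perm_cons; apply: perm_trans; rewrite perm_catC.
Qed.

Section Sign.
Variables (K : fieldType) (I : finType).

(** For a list without repetition, the sign of the permutation that sorts it along [enum I], as a
    product over its inversions. *)
Fixpoint sgnl (s : seq I) : K :=
  if s is k :: s' then sg K k [set x in s'] * sgnl s' else 1.

Lemma sgnl_sq s : sgnl s * sgnl s = 1.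
Proof. by elim: s => [|k s IH] /=; rewrite ?mulr1 // mulrACA IH sg_sq mulr1. Qed.

Lemma set_swap p (a b : I) q : [set x in p ++ a :: b :: q] = [set x in p ++ b :: a :: q].
Proof. by apply/setP => x; rewrite !inE !mem_cat !inE; congr (_ || _); rewrite orbCA. Qed.

Lemma uniq_swap p (a b : I) q : uniq (p ++ a :: b :: q) = uniq (p ++ b :: a :: q).
Proof.
by apply: perm_uniq; rewrite perm_cat2l -[a :: b :: q]/([:: a; b] ++ q) -[b :: a :: q]/([:: b;
  a] ++ q) perm_cat2r (perm_catC [:: a] [:: b]).
Qed.

Lemma sgnl_swap p a b q : uniq (p ++ a :: b :: q) ->
  sgnl (p ++ a :: b :: q) = - sgnl (p ++ b :: a :: q).
Proof.
elim: p => [|k p IH] /=.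
  rewrite !set_cons inE => /and3P[/norP[nab aq] bq _].
  by rewrite !mulrA [_ * sg K b _]mulrC [_ * sg K a _]mulrC sg_swap ?inE // 1?eq_sym // mulNr.
by move=> /andP[_ /IH ->]; rewrite set_swap mulrN.
Qed.

(* A chain as an alternating function on lists, for which the Koszul
   differential has no signs: see [hat_kd]. *)
Definition hat (M : gmod K I) (w : chain M) (s : seq I) : M :=
  if uniq s then sgnl s *: w [set x in s] else 0.

Lemma hat_linear (M : gmod K I) a (w w' : chain M) s :
  hat (a *: w + w') s = a *: hat w s + hat w' s.
Proof.
rewrite /hat; case: ifP => _; last by rewrite scaler0 addr0.
by rewrite !ffunE scalerDr !scalerA mulrC.
Qed.

Lemma hat_swap (M : gmod K I) (w : chain M) p a b q :
  hat w (p ++ a :: b :: q) = - hat w (p ++ b :: a :: q).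
Proof.
rewrite /hat uniq_swap; case: ifP => u; last by rewrite oppr0.
by rewrite sgnl_swap 1?uniq_swap // set_swap scaleNr.
Qed.

Lemma hat_kd (M : gmod K I) (w : chain M) s :
  hat (kd w) s = \sum_k gm_X M k (hat w (k :: s)).
Proof.
rewrite /hat /=; case: ifP => u; last by rewrite big1 // => k _; rewrite andbF linear0.
rewrite ffunE scaler_sumr (bigID (fun k => k \in s)) /= big1 ?add0r.
  rewrite [RHS](bigID (fun k => k \in s)) /= [X in _ = X + _]big1 ?add0r.
    apply: eq_big => k; first by rewrite inE andbb.
    by rewrite inE => /andP[ks _]; rewrite scalerA ks linearZ /= set_cons [sgnl s * _]mulrC.
  by move=> k ->; rewrite linear0.
by move=> k; rewrite inE andNb.
Qed.

Lemma hat0 (M : gmod K I) s : hat (0 : chain M) s = 0.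
Proof. by rewrite /hat ffunE scaler0 if_same. Qed.

Lemma hat_eq0 (M : gmod K I) (w : chain M) (T : {set I}) : hat w (enum T) = 0 -> w T = 0.
Proof.
rewrite /hat enum_uniq set_enum => /(congr1 (fun m => sgnl (enum T) *: m)).
by rewrite scaler0 scalerA sgnl_sq scale1r.
Qed.

End Sign.

(** * The quadrics of a binomial edge ideal *)

Section Quadrics.
Variables (K : fieldType) (V : finType) (e : rel V).
Notation S := (vertex_ring K V).
Notation ix u := (lshift #|V| (enum_rank u)).
Notation iy u := (rshift #|V| (enum_rank u)).
Notation bei := (binomial_edge_ideal (K := K) e).

Lemma binomial_homog (u w : V) : xvar K u * yvar K w - xvar K w * yvar K u \is 2.-homog.
Proof.
have hx (k : 'I_(#|V| + #|V|)) : ('X_k : S) \is 1.-homog by rewrite dhomogX /= mdeg1.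
by apply: rpredB; exact: (dhomogM (hx _) (hx _)).
Qed.

Lemma bei_pihomog d p : bei p -> exists c : V -> V -> S,
  pihomog mdeg d p = \sum_u \sum_(w | e u w) c u w * (xvar K u * yvar K w - xvar K w * yvar K u)
  /\ forall u w, if (2 <= d)%N then c u w \is (d - 2).-homog else c u w == 0.
Proof.
move=> [c ->]; exists (fun u w => if (2 <= d)%N then pihomog mdeg (d - 2) (c u w) else 0).
split; last by move=> u w; case: (leqP 2 d) => _ /=; [exact: pihomogP|rewrite eqxx].
rewrite linear_sum; apply: eq_bigr => u _; rewrite linear_sum; apply: eq_bigr => w _ /=.
case: ltnP => d2; last by rewrite mul0r (pihomog_mul_lt _ (binomial_homog _ _)).
by rewrite -(pihomog_mul _ _ (binomial_homog _ _)) subnK.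
Qed.

Lemma bei_hideal : hideal bei.
Proof.
split.
- exists (fun _ _ => 0); rewrite big1 // => u _; rewrite big1 // => w _; exact: mul0r.
- move=> _ _ [c ->] [d ->]; exists (fun u w => c u w + d u w).
  rewrite -big_split; apply: eq_bigr => u _; rewrite -big_split; apply: eq_bigr => w _.
  by rewrite mulrDl.
- move=> a _ [c ->]; exists (fun u w => a * c u w).
  rewrite mulr_sumr; apply: eq_bigr => u _; rewrite mulr_sumr; apply: eq_bigr => w _.
  by rewrite mulrA.
- by move=> d p /(bei_pihomog d) [c [-> _]]; exists c.
Qed.

Lemma bei_deg1 p : bei p -> pihomog mdeg 1 p = 0.
Proof.
move=> /(bei_pihomog 1) [c [-> h]]; rewrite big1 // => u _; rewrite big1 // => w _.
by have /= /eqP -> := h u w; rewrite mul0r.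
Qed.

Lemma bei_edge u w : e u w -> bei (xvar K u * yvar K w - xvar K w * yvar K u).
Proof.
move=> euw; exists (fun u' w' => ((u' == u) && (w' == w))%:R).
rewrite (bigD1 u) //= (bigD1 w) //= !eqxx mul1r !big1 ?addr0 //.
  by move=> u' /negbTE nu; rewrite big1 // => w' _; rewrite nu mul0r.
by move=> w' /andP[_ /negbTE nw]; rewrite nw andbF mul0r.
Qed.

Definition quad (q : V -> V -> K) : S := \sum_b \sum_c q b c *: (xvar K b * yvar K c).

Definition alt_edge (q : V -> V -> K) :=
  [/\ forall b, q b b = 0, forall b c, q b c = - q c b & forall b c, ~~ e b c -> q b c = 0].

Hypothesis e_sym : ssrbool.symmetric e.
Hypothesis e_irr : irreflexive e.

Lemma quad_bei q : alt_edge q -> bei (quad q).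
Proof.
(* Each edge is listed in both orientations with opposite generators; using one of them only avoids
   a division by 2. *)
move=> [q0 qN qe]; exists (fun u w => if before u w then (q u w)%:MP else 0).
pose lt (p : V * V) := before p.1 p.2.
rewrite /quad !pair_bigA /= [LHS](bigID lt) /= [X in _ + X](bigID (fun p => p.1 == p.2)) /=.
rewrite [X in _ + (X + _)]big1 ?add0r; last first.
  by move=> [b c] /= /andP[_ /eqP ->]; rewrite q0 scale0r.
have swap_inj : injective (fun p : V * V => (p.2, p.1)) by move=> [? ?] [? ?] [-> ->].
rewrite [X in _ + X](reindex_inj swap_inj) /=.
rewrite [X in _ + X](eq_bigl lt); last first.
  move=> [b c]; rewrite /lt /=; case: (eqVneq c b) => [->|nbc]; first by rewrite before_irr andbF.
  by rewrite andbT (before_total nbc).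
rewrite -big_split /= pair_big_dep /= [RHS](bigID lt) /= [X in _ = _ + X]big1 ?addr0; last first.
  by move=> [b c] /= /andP[_ /negbTE]; rewrite /lt /= => ->; rewrite mul0r.
rewrite [LHS](bigID (fun p => e p.1 p.2)) /= [X in _ + X]big1 ?addr0; last first.
  move=> [b c] /= /andP[_ nbc]; rewrite (qe b c) // (qe c b) 1?e_sym // !scale0r addr0 //.
apply: eq_big => [[b c]|[b c]] /=; first by rewrite andbC.
move=> /andP[bc _]; rewrite /lt /= in bc; rewrite bc (qN c b) scaleNr -scalerBr.
by rewrite mul_mpolyC.
Qed.

Lemma bei_quad p : bei p -> pihomog mdeg 2 p = p -> exists2 q, alt_edge q & p = quad q.
Proof.
move=> /(bei_pihomog 2) [c [e2 h]]; rewrite e2 => <-.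
pose k u w := (c u w)@_0%MM.
have ck u w : c u w = (k u w)%:MP.
  by have /= := h u w; rewrite homog_piE pihomog0E => /eqP/esym.
exists (fun b c => (e b c)%:R * (k b c - k c b)).
  split=> [b|b d|b d /negbTE ->]; first by rewrite subrr mulr0.
    by rewrite e_sym -mulrN opprB.
  by rewrite mul0r.
rewrite /quad.
pose f b d : S := (e b d)%:R *: (k b d *: (xvar K b * yvar K d)).
pose g b d : S := (e b d)%:R *: (k b d *: (xvar K d * yvar K b)).
transitivity (\sum_b \sum_d (f b d - g b d)).
  apply: eq_bigr => b _; rewrite big_mkcond; apply: eq_bigr => d _; rewrite /f /g.
  by case: ifP => _; rewrite ?scale1r ?scale0r ?subr0 // ck mul_mpolyC scalerBr.
under eq_bigr do rewrite sumrB.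
rewrite sumrB [X in _ - X]exchange_big -sumrB; apply: eq_bigr => b _.
rewrite -sumrB; apply: eq_bigr => d _; rewrite /f /g e_sym -scalerBr -scalerBl scalerA //.
Qed.

Lemma mon_xy b c : xvar K b * yvar K c = 'X_[U_(ix b) + U_(iy c)].
Proof. by rewrite mpolyXD. Qed.

Lemma quad_coef q b c : (quad q)@_(U_(ix b) + U_(iy c)) = q b c.
Proof.
rewrite /quad raddf_sum (bigD1 b) //= raddf_sum (bigD1 c) //= mcoeffZ mon_xy mcoeffX eqxx mulr1.
have neq b' c' : ((U_(ix b') + U_(iy c') == U_(ix b) + U_(iy c))%MM) = (b' == b) && (c' == c).
  apply/eqP/andP => [/mnmP h|[/eqP -> /eqP ->]//].
  have := h (ix b); have := h (iy c); rewrite !mnmDE !mnm1E !eq_lrshift !eq_rlshift !eqxx.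
  rewrite eq_lshift eq_rshift !(inj_eq enum_rank_inj).
  by case: (c' == c) => //; case: (b' == b).
rewrite !big1 ?addr0 // => [b' nb|c' nc].
  by rewrite raddf_sum big1 // => c' _ /=; rewrite mcoeffZ mon_xy mcoeffX neq (negbTE nb) mulr0.
by rewrite mcoeffZ mon_xy mcoeffX neq (negbTE nc) andbF mulr0.
Qed.

Lemma quad_xx q b c : (quad q)@_(U_(ix b) + U_(ix c)) = 0.
Proof.
rewrite raddf_sum big1 // => b' _; rewrite raddf_sum big1 // => c' _ /=.
rewrite mcoeffZ mon_xy mcoeffX; case: eqP => [/mnmP/(_ (iy c'))|_]; last by rewrite mulr0.
by rewrite !mnmDE !mnm1E !eq_lrshift eqxx.
Qed.

Lemma quad_yy q b c : (quad q)@_(U_(iy b) + U_(iy c)) = 0.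
Proof.
rewrite raddf_sum big1 // => b' _; rewrite raddf_sum big1 // => c' _ /=.
rewrite mcoeffZ mon_xy mcoeffX; case: eqP => [/mnmP/(_ (ix b'))|_]; last by rewrite mulr0.
by rewrite !mnmDE !mnm1E !eq_rlshift eqxx.
Qed.

Lemma quad_homog q : pihomog mdeg 2 (quad q) = quad q.
Proof.
rewrite linear_sum; apply: eq_bigr => b _; rewrite linear_sum; apply: eq_bigr => c _.
by rewrite linearZ /= mon_xy pihomogX /= mdegD !mdeg1.
Qed.

Lemma quad_eq q q' : q =2 q' -> quad q = quad q'.
Proof. by move=> h; apply: eq_bigr => b _; apply: eq_bigr => c _; rewrite h. Qed.

End Quadrics.

Lemma mcoeff_XM (K : fieldType) n (i : 'I_n) (p : {mpoly K[n]}) m :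
  ('X_i * p)@_m = if m i != 0%N then p@_(m - U_(i)) else 0.
Proof.
case: ifP => [mi|/negbFE/eqP mi].
  have em : m = (U_(i) + (m - U_(i)))%MM by rewrite addmC submK ?lep1mP.
  by rewrite [in LHS]em mulrC mcoeffMX.
elim/mpoly_span: p => [|c l p IH]; first by rewrite mulr0 mcoeff0.
rewrite mulrDr mcoeffD IH addr0 -scalerAr mcoeffZ -mpolyXD mcoeffX.
case: eqP => [e|_]; last by rewrite mulr0.
by move: mi; rewrite -e mnmDE mnm1E eqxx.
Qed.

Lemma dimq_supported (K : fieldType) (D : finType) (A : {set D}) :
  dimq (fun g : {ffun D -> K^o} => forall x, x \notin A -> g x = 0) (@zerop _) #|A|.
Proof.
pose dl (j : 'I_#|A|) : {ffun D -> K^o} := [ffun x => (x == enum_val j)%:R].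
have comb (c : 'I_#|A| -> K) x : (\sum_j c j *: dl j) x = \sum_(j | x == enum_val j) c j.
  rewrite sum_ffunE [RHS]big_mkcond; apply: eq_bigr => j _; rewrite !ffunE.
  by case: ifP => _; [exact: mulr1|exact: mulr0].
exists dl; split.
- by move=> j x xA; rewrite ffunE; case: eqP => // e; rewrite e enum_valP in xA.
- move=> g hg; exists (fun j => g (enum_val j)); apply/eqP; rewrite subr_eq0; apply/eqP/ffunP => x.
  rewrite comb; have [xA|xA] := boolP (x \in A); last first.
    by rewrite hg // big1 // => j /eqP e; rewrite e enum_valP in xA.
  rewrite (bigD1 (enum_rank_in xA x)) ?enum_rankK_in //= big1 ?addr0 // => j /andP[/eqP ex].
  by case/eqP; apply: enum_val_inj; rewrite enum_rankK_in.
- move=> c /ffunP h j; have := h (enum_val j); rewrite comb ffunE.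
  rewrite (bigD1 j) //= big1 ?addr0 // => j' /andP[/eqP/enum_val_inj e].
  by rewrite e eqxx.
Qed.

Section Triple.
Variables (K : fieldType) (n : nat) (h : 'I_n -> {mpoly K[n]}).
Let F := \sum_i 'X_i * h i.

Lemma triple_coef j1 j2 j3 : j1 != j2 -> j1 != j3 -> j2 != j3 ->
  F@_(U_(j1) + U_(j2) + U_(j3)) =
  (h j1)@_(U_(j2) + U_(j3)) + (h j2)@_(U_(j1) + U_(j3)) + (h j3)@_(U_(j1) + U_(j2)).
Proof.
move=> n12 n13 n23; set m := (_ + _ + _)%MM.
have mE i : m i = ((j1 == i) + (j2 == i) + (j3 == i))%N by rewrite !mnmDE !mnm1E.
rewrite raddf_sum (bigD1 j1) //= (bigD1 j2) ?(eq_sym j2) //= (bigD1 j3) /=;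
  last by rewrite !(eq_sym j3) n13.
rewrite big1 ?addr0 => [|i /andP[/andP[i1 i2] i3]]; last first.
  by rewrite mcoeff_XM mE ![_ == i]eq_sym (negbTE i1) (negbTE i2) (negbTE i3).
have [m1 m2 m3] : [/\ m j1 != 0, m j2 != 0 & m j3 != 0]%N.
  by split; rewrite mE eqxx ?addnS ?addSn.
rewrite !mcoeff_XM m1 m2 m3 addrA.
have -> : (m - U_(j1) = U_(j2) + U_(j3))%MM by rewrite /m -addmA addmC addmK.
have -> : (m - U_(j2) = U_(j1) + U_(j3))%MM.
  by rewrite /m -addmA [(U_(j2) + _)%MM]addmC addmA addmK.
by have -> : (m - U_(j3) = U_(j1) + U_(j2))%MM by rewrite /m addmK.
Qed.

(** For a square factor the repeated variable contributes a single term. The resulting vanishing of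
    coefficients therefore carries no factor 2 and holds in every characteristic. *)
Lemma double_coef j1 j3 : j1 != j3 ->
  F@_(U_(j1) + U_(j1) + U_(j3)) =
  (h j1)@_(U_(j1) + U_(j3)) + (h j3)@_(U_(j1) + U_(j1)).
Proof.
move=> n13; set m := (_ + _ + _)%MM.
have mE i : m i = ((j1 == i) + (j1 == i) + (j3 == i))%N by rewrite !mnmDE !mnm1E.
rewrite raddf_sum (bigD1 j1) //= (bigD1 j3) ?(eq_sym j3) //=.
rewrite big1 ?addr0 => [|i /andP[i1 i3]]; last first.
  by rewrite mcoeff_XM mE ![_ == i]eq_sym (negbTE i1) (negbTE i3).
have [m1 m3] : [/\ m j1 != 0 & m j3 != 0]%N.
  by split; rewrite mE eqxx ?addnS ?addSn.
rewrite !mcoeff_XM m1 m3.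
have -> : (m - U_(j1) = U_(j1) + U_(j3))%MM.
  by rewrite /m -addmA addmC addmK.
by have -> : (m - U_(j3) = U_(j1) + U_(j1))%MM by rewrite /m addmK.
Qed.

End Triple.

Section LinearStrand.
Variables (K : fieldType) (V : finType) (e : rel V).
Hypotheses (e_sym : ssrbool.symmetric e) (e_irr : irreflexive e).
Notation S := (vertex_ring K V).
Notation N := (#|V| + #|V|)%N.
Notation ix u := (lshift #|V| (enum_rank u)).
Notation iy u := (rshift #|V| (enum_rank u)).
Notation J := (binomial_edge_ideal (K := K) e).
Variables (I : finType) (xi : I -> S).
Hypothesis hxi : forall k, xi k \is 1%N.-homog.
Variable kv : 'I_N -> I.
Hypothesis kv_inj : injective kv.
Hypothesis xi_kv : forall a, xi (kv a) = 'X_a.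
Notation R := (rmod hxi).
Notation W := (vset kv).
Variable i : nat.

Definition vt : 'I_N -> V := by_vertex id id.
Definition bt : 'I_N -> bool := by_vertex (fun=> true) (fun=> false).
Definition mk (b : bool) (u : V) : 'I_N := if b then ix u else iy u.

Lemma vt_mk b u : vt (mk b u) = u.
Proof. by case: b; rewrite /vt /mk ?by_vertexl ?by_vertexr. Qed.

Lemma bt_mk b u : bt (mk b u) = b.
Proof. by case: b; rewrite /bt /mk ?by_vertexl ?by_vertexr. Qed.

Lemma mk_vt j : mk (bt j) (vt j) = j.
Proof. by elim/vertex_indexP: j => u; rewrite /bt /vt ?by_vertexl ?by_vertexr. Qed.

(** The exterior degree is [i]; the differential identifies H_(i+1,1) with this space. *)
Definition qcyc (w : chain R) := [/\ ws W w, cP i 2 w = w, cin (M := R) J w & kd w = 0].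

(* The coefficient of x_b y_c. *)
Definition om (w : chain R) (b c : V) (s : seq 'I_N) : K :=
  (hat w (map kv s))@_(U_(ix b) + U_(iy c)).

Lemma om_swap w b c p x y q : om w b c (p ++ x :: y :: q) = - om w b c (p ++ y :: x :: q).
Proof. by rewrite /om !map_cat /= hat_swap mcoeffN. Qed.

Lemma om_front w b c p x y q : om w b c (p ++ x :: y :: q) = om w b c (x :: y :: p ++ q).
Proof.
elim/last_ind: p q => [//|p z IH] q.
rewrite !cat_rcons om_swap -cat_rcons om_swap opprK cat_rcons IH //.
Qed.

Lemma hat_kdW (w : chain R) s : ws W w ->
  hat (kd w) (map kv s) = \sum_j 'X_j * (hat w (kv j :: map kv s) : S) :> S.
Proof.
move=> ww; rewrite hat_kd (bigID (fun k => k \in W)) /= [X in _ + X]big1 ?addr0; last first.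
  move=> k kW; rewrite /hat; case: ifP => _; rewrite ?linear0 //.
  rewrite ww ?scaler0 ?linear0 //; apply: contra kW => /subsetP; apply.
  by rewrite inE mem_head.
rewrite /vset big_imset /=; last by move=> x y _ _ /kv_inj.
rewrite big_mkcond; apply: eq_bigr => j _.
by rewrite inE /= /mulx xi_kv.
Qed.

Lemma sub_vset_map (T0 : {set I}) : T0 \subset W -> exists s, enum T0 = map kv s.
Proof.
move=> TW; have : all (fun k => k \in W) (enum T0).
  by apply/allP => k; rewrite mem_enum; apply: subsetP.
elim: (enum T0) => [|k l IH] /=; first by exists [::].
by move=> /andP[/vsetP [a ->] /IH [s ->]]; exists (a :: s).
Qed.

Section Cycle.
Variable w : chain R.
Hypothesis hw : qcyc w.

Lemma hat_quad s : exists2 q, alt_edge e q & hat w s = quad q.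
Proof.
have [_ pw jw _] := hw; apply: bei_quad => //.
  rewrite /hat; case: ifP => _; last exact: hi0 (bei_hideal _ _).
  by apply: (subspaceZ (hideal_sub (bei_hideal _ _))); exact: jw.
rewrite /hat; case: ifP => _; last by rewrite linear0.
rewrite linearZ /= -pw ffunE; case: ifP => _; last by rewrite linear0.
by rewrite /= pihomog_id.
Qed.

Lemma hatE s : hat w (map kv s) = quad (fun b c => om w b c s).
Proof.
rewrite /om; have [q _ ->] := hat_quad (map kv s).
by apply: quad_eq => b c; rewrite quad_coef.
Qed.

Lemma om_alt s : alt_edge e (fun b c => om w b c s).
Proof.
rewrite /om; have [q [q0 qN qe] ->] := hat_quad (map kv s).
by split=> [b|b c|b c nbc]; rewrite !quad_coef; auto.
Qed.

Lemma om_bc b c s : om w b c s = - om w c b s.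
Proof. by case: (om_alt s). Qed.

Lemma hat_sum s : \sum_j 'X_j * (hat w (kv j :: map kv s) : S) = 0 :> S.
Proof. by have [ww _ _ kw] := hw; rewrite -hat_kdW // kw hat0. Qed.

Lemma hat_sum_quad s : \sum_j 'X_j * quad (fun b c => om w b c (j :: s)) = 0.
Proof. by rewrite -[RHS](hat_sum s); apply: eq_bigr => j _; rewrite -hatE. Qed.

(** The coefficient of x_a x_b y_c in the cycle condition: the quadrics have no terms x x, so only
    two summands survive, and only one if a = b. *)
Lemma om_x a b c s : om w b c (ix a :: s) = - om w a c (ix b :: s).
Proof.
have [->|nab] := eqVneq a b.
  have := double_coef (fun j => quad (fun b c => om w b c (j :: s))) (j1 := ix b) (j3 := iy c).
  rewrite hat_sum_quad mcoeff0 quad_coef quad_xx addr0 eq_lrshift => <- //.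
  by rewrite oppr0.
have := @triple_coef _ _ (fun j => quad (fun b c => om w b c (j :: s))) (ix a) (ix b) (iy c).
rewrite hat_sum_quad mcoeff0 !quad_coef quad_xx addr0 !eq_lrshift eq_lshift (inj_eq enum_rank_inj).
by move=> /(_ nab isT isT)/esym/eqP; rewrite addr_eq0 => /eqP.
Qed.

Lemma om_y a b c s : om w b c (iy a :: s) = - om w b a (iy c :: s).
Proof.
have [->|nac] := eqVneq a c.
  have := @double_coef _ _ (fun j => quad (fun b c => om w b c (j :: s))) (iy c) (ix b).
  rewrite hat_sum_quad mcoeff0 addmC quad_coef quad_yy addr0 eq_rlshift => <- //.
  by rewrite oppr0.
have := @triple_coef _ _ (fun j => quad (fun b c => om w b c (j :: s))) (iy a) (iy c) (ix b).
rewrite hat_sum_quad mcoeff0 [(U_(iy c) + _)%MM]addmC [(U_(iy a) + U_(ix b))%MM]addmC.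
rewrite !quad_coef quad_yy addr0 !eq_rlshift eq_rshift (inj_eq enum_rank_inj).
by move=> /(_ nac isT isT)/esym/eqP; rewrite addr_eq0 => /eqP.
Qed.

Lemma om_b t a b c s : om w b c (mk t a :: s) = - om w a c (mk t b :: s).
Proof.
case: t => /=; first exact: om_x.
by rewrite om_bc om_y opprK om_bc.
Qed.

Lemma om_c t a b c s : om w b c (mk t a :: s) = - om w b a (mk t c :: s).
Proof.
case: t => /=; last exact: om_y.
by rewrite om_bc om_x opprK om_bc.
Qed.

(** Transposing [u] and [v] while the bits stay in place is a product of three transpositions with
    [b], each of which changes the sign. *)
Lemma om_uv t t' u v b c p q :
  om w b c (p ++ mk t u :: mk t' v :: q) = - om w b c (p ++ mk t v :: mk t' u :: q).
Proof.
rewrite !om_front om_b (om_swap _ _ _ [::]) opprK /= om_b.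
by rewrite (om_swap _ _ _ [::]) opprK /= om_b.
Qed.

Definition zk (ss : seq bool) (us : seq V) : seq 'I_N := [seq mk p.1 p.2 | p <- zip ss us].

(* A function of the vertices b, c, a_1, .., a_i and of i bits, telling x from
   y; it alternates in the vertices and is symmetric in the bits. *)
Definition G (us : seq V) (ss : seq bool) : K :=
  if us is b :: c :: us' then om w b c (zk ss us') else 0.

Lemma zk_cat ss us ss' us' : size ss = size us ->
  zk (ss ++ ss') (us ++ us') = zk ss us ++ zk ss' us'.
Proof. by move=> h; rewrite /zk zip_cat // map_cat. Qed.

Lemma size2_split T (l : seq T) p k : size l = (p + k.+2)%N ->
  exists l1 x y l2, [/\ l = l1 ++ x :: y :: l2, size l1 = p & size l2 = k].
Proof.
move=> h; have := size_drop p l; rewrite h addKn.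
case ed : (drop p l) => [|x [|y l2]] //= [sz].
exists (take p l), x, y, l2; split; rewrite -?ed ?cat_take_drop // size_takel // h leq_addr //.
Qed.

Lemma G_swap p u v q ss : size (p ++ u :: v :: q) = (size ss).+2 ->
  G (p ++ u :: v :: q) ss = - G (p ++ v :: u :: q) ss.
Proof.
case: p => [|b [|c p]] /=; first by rewrite om_bc.
  case: ss => [|t ss] //= _; rewrite /zk /= -/(zk _ _); exact: om_c.
rewrite size_cat /= => -[]; rewrite addnS => [[]] ; rewrite -addnS => h.
have [|s1 [x [y [s2 [-> h1 h2]]]]] := @size2_split _ ss (size p) (size q); first by lia.
by rewrite !zk_cat // /zk /= om_uv.
Qed.

(** Exchanging two bits is exchanging two variables and then their two vertices; the two signs
    cancel. *)
Lemma G_swap_bits us p t t' q : size us = (size (p ++ t :: t' :: q)).+2 ->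
  G us (p ++ t :: t' :: q) = G us (p ++ t' :: t :: q).
Proof.
case: us => [|b [|c us]] //= [].
rewrite size_cat /= => h.
have [|u1 [x [y [u2 [-> h1 h2]]]]] := @size2_split _ us (size p) (size q); first by lia.
by rewrite !zk_cat // /zk /= om_uv om_swap opprK.
Qed.

Lemma G_perm us us' ss : size us = (size ss).+2 -> perm_eq us us' -> G us ss = 0 -> G us' ss = 0.
Proof.
move=> sz h g0; apply: (@perm_swap_ind _ (fun l =>
  size l = (size ss).+2 -> G l ss = 0) _ us us' h) => //.
  move=> p a b q IH sz'; rewrite G_swap // IH ?oppr0 //.
  by move: sz'; rewrite !size_cat.
by rewrite -(perm_size h).
Qed.

Lemma G_perm_bits us ss ss' : size us = (size ss).+2 -> perm_eq ss ss' -> G us ss = 0 ->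
  G us ss' = 0.
Proof.
move=> sz h g0; apply: (@perm_swap_ind _ (fun l =>
  size us = (size l).+2 -> G us l = 0) _ ss ss' h) => //.
  move=> p a b q IH sz'; rewrite G_swap_bits // IH //.
  by move: sz'; rewrite !size_cat.
by rewrite -(perm_size h).
Qed.

(** Any two of the vertices can be moved to the front, where they index the coefficient of x_b y_c
    in an element of the ideal; that coefficient is 0 off the edges. Hence the support on
    cliques. *)
Lemma G_pair us ss b c : size us = (size ss).+2 -> b \in us -> c \in rem b us ->
  ~~ e b c -> G us ss = 0.
Proof.
move=> sz bu cu nbc.
have h : perm_eq (b :: c :: rem c (rem b us)) us.
  rewrite perm_sym; apply: perm_trans (perm_to_rem bu) _.
  by rewrite perm_cons perm_to_rem.
apply: (G_perm _ h); first by rewrite (perm_size h).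
by rewrite /=; case: (om_alt (zk ss (rem c (rem b us)))) => _ _; apply.
Qed.

Lemma G_uniq us ss : size us = (size ss).+2 -> ~~ uniq us -> G us ss = 0.
Proof.
move=> sz nu; have [b bu] : exists b, b \in rem b us.
  elim: us nu {sz} => [//|x us IH] /=; rewrite negb_and negbK => /orP[xu|/IH [b bu]].
    by exists x; rewrite eqxx.
  exists b; case: eqP => [_|_]; last by rewrite inE bu orbT.
  exact: mem_rem bu.
by apply: (G_pair sz (mem_rem bu) bu); rewrite e_irr.
Qed.

Lemma G_clique us ss : size us = (size ss).+2 -> ~~ is_clique e [set x in us] -> G us ss = 0.
Proof.
move=> sz; rewrite /is_clique negb_forall => /existsP [b].
rewrite negb_imply inE => /andP[bu]; rewrite negb_forall => /existsP [c].
rewrite negb_imply inE => /andP[cu]; rewrite negb_imply => /andP[nbc ne].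
apply: (G_pair sz bu _ ne).
have := perm_mem (perm_to_rem bu) c; by rewrite inE cu eq_sym (negbTE nbc) => /esym.
Qed.

(** The representative of the bit lists with [m] ones. By symmetry in the bits only [m] matters, and
    its [i.+1] values give the factor in the linear strand. *)
Definition bits (m : nat) : seq bool := nseq m true ++ nseq (i - m) false.

Lemma qcyc_eq0 :
  (forall T : {set V}, is_clique e T -> #|T| = i.+2 ->
   forall m, (m <= i)%N -> G (enum T) (bits m) = 0) -> w = 0.
Proof.
move=> h0; have [ww pw _ _] := hw.
have hG us ss : size us = i.+2 -> size ss = i -> G us ss = 0.
  move=> su st; have sz : size us = (size ss).+2 by rewrite su st.
  have [uu|nu] := boolP (uniq us); last exact: G_uniq.
  have [cl|ncl] := boolP (is_clique e [set x in us]); last exact: G_clique.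
  have pu : perm_eq (enum [set x in us]) us.
    apply: uniq_perm => //; first exact: enum_uniq.
    by move=> x; rewrite mem_enum inE.
  apply: (G_perm _ pu); first by rewrite (perm_size pu).
  have le : (count id ss <= i)%N by rewrite -st count_size.
  have ps : perm_eq (bits (count id ss)) ss.
    rewrite perm_sym /bits -st; elim: (ss) => [//|[] ss' IH] /=.
      by rewrite add1n subSS perm_cons.
    rewrite add0n subSn ?count_size //= perm_sym.
    by rewrite -cat1s perm_catCA /= perm_cons perm_sym.
  apply: (G_perm_bits _ ps); first by rewrite (perm_size pu) (perm_size ps).
  by apply: h0 => //; rewrite cardE (perm_size pu).
apply/ffunP => T0; rewrite [RHS]ffunE.
case TW : (T0 \subset W); last by rewrite ww // TW.
have [cT|/negbTE cT] := eqVneq #|T0| i; last by rewrite -pw ffunE cT.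
have [s es] := sub_vset_map TW.
have ss : size s = i by rewrite -(size_map kv) -es -cardE.
apply: hat_eq0; rewrite es hatE /quad big1 // => b _; rewrite big1 // => c _.
have -> : om w b c s = 0; last by rewrite scale0r.
have := hG (b :: c :: map vt s) (map bt s); rewrite /= !size_map ss => /(_ erefl erefl).
rewrite /zk zip_map -map_comp (eq_map (g := id)) ?map_id // => j /=.
exact: mk_vt.
Qed.

End Cycle.

(** * Cycles with prescribed values on cliques *)

Section Construction.
Variable g : {set V} -> nat -> K.

Definition Gg (us : seq V) (m : nat) : K :=
  if [&& uniq us, is_clique e [set x in us] & size us == i.+2]
  then sgnl K us * g [set x in us] m else 0.

Lemma Gg_swap p u v q m : Gg (p ++ u :: v :: q) m = - Gg (p ++ v :: u :: q) m.
Proof.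
rewrite /Gg uniq_swap set_swap !size_cat /=; case: ifP => [/andP[uu _]|_]; last by rewrite oppr0.
by rewrite sgnl_swap 1?uniq_swap // mulNr.
Qed.

Definition omg b c (s : seq 'I_N) : K := Gg (b :: c :: map vt s) (count bt s).

Lemma omg_swap b c p x y q : omg b c (p ++ x :: y :: q) = - omg b c (p ++ y :: x :: q).
Proof.
rewrite /omg !map_cat /= -!cat_cons Gg_swap; congr (- Gg _ _).
by rewrite !count_cat /=; lia.
Qed.

Lemma omg_alt s : alt_edge e (fun b c => omg b c s).
Proof.
split=> [b|b c|b c nbc].
- by rewrite /omg /Gg /= inE eqxx.
- exact: (Gg_swap [::]).
- rewrite /omg /Gg; case: ifP => // /and3P[/= /andP[bn _] /forallP/(_ b) cl _].
  move: cl; rewrite !inE eqxx /= => /forallP/(_ c); rewrite !inE eqxx orbT /= (negbTE nbc).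
  by move: bn; rewrite inE negb_or => /andP[-> _].
Qed.

Lemma omg_b t a b c s : omg b c (mk t a :: s) = - omg a c (mk t b :: s).
Proof.
rewrite /omg /= !vt_mk !bt_mk (Gg_swap [::] b c) /= (Gg_swap [:: c] b a) /=.
by rewrite (Gg_swap [::] c a) /= opprK.
Qed.

Lemma omg_c t a b c s : omg b c (mk t a :: s) = - omg b a (mk t c :: s).
Proof. by rewrite /omg /= !vt_mk !bt_mk (Gg_swap [:: b] c a). Qed.

Lemma omg_b0 t b c s : omg b c (mk t b :: s) = 0.
Proof. by rewrite /omg /Gg /= vt_mk !inE eqxx orbT. Qed.

Lemma omg_c0 t b c s : omg b c (mk t c :: s) = 0.
Proof. by rewrite /omg /Gg /= vt_mk !inE eqxx andbF. Qed.

Lemma omg_size b c s : size s != i -> omg b c s = 0.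
Proof. by move=> /negbTE h; rewrite /omg /Gg /= !eqSS size_map h !andbF. Qed.

(** The list [enum (kv @^-1: L)], carried to [I] by [kv], need not follow the order of [I]. The sign
    corrects this, so that [hat] returns [omg] on every list. *)
Definition wg : chain R :=
  [ffun L : {set I} => if L \subset W
     then sgnl K (map kv (enum (kv @^-1: L))) *: quad (fun b c => omg b c (enum (kv @^-1: L)))
     else 0].

Lemma quadZ a q : a *: quad q = quad (fun b c : V => a * q b c) :> S.
Proof.
rewrite scaler_sumr; apply: eq_bigr => b _; rewrite scaler_sumr; apply: eq_bigr => c _.
by rewrite scalerA.
Qed.

Lemma quad0 (q : V -> V -> K) : (forall b c, q b c = 0) -> quad q = 0.
Proof. by move=> h; rewrite /quad big1 // => b _; rewrite big1 // => c _; rewrite h scale0r. Qed.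

Lemma hat_wg s : hat wg (map kv s) = quad (fun b c => omg b c s).
Proof.
rewrite /hat (map_inj_uniq kv_inj); case: ifP => us; last first.
  rewrite quad0 // => b c; rewrite /omg /Gg; case: ifP => // /and3P[/= /and3P[_ _ uv] _ _].
  have : uniq s by apply: (@map_uniq _ _ vt).
  by rewrite us.
set L := [set x in map kv s].
have LW : L \subset W by apply/subsetP => k; rewrite inE => /mapP [a _ ->]; exact: kv_in.
rewrite ffunE LW; set s' := enum _.
have ps : perm_eq s' s.
  apply: uniq_perm => //; first exact: enum_uniq.
  by move=> x; rewrite mem_enum !inE mem_map.
rewrite scalerA quadZ; apply: quad_eq => b c.
have -> : omg b c s' = sgnl K (map kv s') * (sgnl K (map kv s) * omg b c s).
  suff -> : sgnl K (map kv s) * omg b c s = sgnl K (map kv s') * omg b c s'.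
    by rewrite mulrA sgnl_sq mul1r.
  apply: (@perm_swap_ind _ (fun l =>
    uniq l -> sgnl K (map kv l) * omg b c l = sgnl K (map kv s') * omg b c s') _ _ _ ps) => //.
  move=> p x y q IH ul; rewrite -IH 1?uniq_swap // omg_swap !map_cat /= sgnl_swap ?mulrNN //.
  by rewrite -[kv y :: _]/(map kv (y :: x :: q)) -map_cat map_inj_uniq.
by rewrite !mulrA -[_ * sgnl K (map kv s') * sgnl K (map kv s')]mulrA sgnl_sq mulr1 sgnl_sq mul1r.
Qed.

Lemma sum_vertex (T : nmodType) (f : 'I_N -> T) : \sum_j f j = \sum_u f (ix u) + \sum_u f (iy u).
Proof.
rewrite big_split_ord /=; congr (_ + _).
  rewrite [RHS](reindex (@enum_val V V)) /=; last by apply: onW_bij; exact: enum_val_bij.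
  by apply: eq_bigr => k _; rewrite enum_valK.
rewrite [RHS](reindex (@enum_val V V)) /=; last by apply: onW_bij; exact: enum_val_bij.
by apply: eq_bigr => k _; rewrite enum_valK.
Qed.

Lemma wg_ws : ws W wg.
Proof. by move=> T /negbTE nT; rewrite ffunE nT. Qed.

Lemma wg_qcyc : qcyc wg.
Proof.
split.
- exact: wg_ws.
- apply/ffunP => T; rewrite !ffunE; case TW: (T \subset W); last by rewrite linear0 if_same.
  case: eqP => [cT|nT]; first by rewrite linearZ /= quad_homog.
  rewrite quad0 ?scaler0 // => b c; apply: omg_size; apply/eqP => sz; apply: nT.
  rewrite -sz -cardE -(card_imset _ kv_inj); congr #|pred_of_set _|.
  apply/setP => k; apply/idP/imsetP => [kT|[a]]; last by rewrite inE => ? ->.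
  by have /vsetP [a ka] := subsetP TW _ kT; exists a; rewrite // inE -ka.
- move=> T; rewrite ffunE; case: ifP => _; last exact: hi0 (bei_hideal _ _).
  apply: (subspaceZ (hideal_sub (bei_hideal _ _))); apply: quad_bei => //.
  exact: omg_alt.
- apply/ffunP => T; rewrite [RHS]ffunE.
  case TW: (T \subset W); last by apply: (kd_ws wg_ws); rewrite TW.
  have [s es] := sub_vset_map TW; apply: hat_eq0; rewrite es (hat_kdW _ wg_ws).
  under eq_bigr => j _ do rewrite -[kv j :: map kv s]/(map kv (j :: s)) hat_wg.
  (* The x-terms pair the symmetric product x_u x_b with a coefficient alternating in u and b; the
     y-terms do the same with y_u y_c. *)
  rewrite sum_vertex [X in X + _](_ : _ = 0) ?add0r.
    pose F u c : S := \sum_b omg b c (mk false u :: s) *: (yvar K u * (xvar K b * yvar K c)).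
    transitivity (\sum_u \sum_c F u c).
      apply: eq_bigr => u _; rewrite mulr_sumr exchange_big; apply: eq_bigr => b _.
      rewrite mulr_sumr; apply: eq_bigr => c _; by rewrite [RHS]scalerAr.
    apply: sum_antisym => [u|u c]; first by rewrite /F big1 // => b _; rewrite omg_c0 scale0r.
    rewrite /F -sumrN; apply: eq_bigr => b _; rewrite omg_c scaleNr; congr (- (_ *: _)).
    by ring.
  pose F u b : S := \sum_c omg b c (mk true u :: s) *: (xvar K u * (xvar K b * yvar K c)).
  transitivity (\sum_u \sum_b F u b).
    apply: eq_bigr => u _; rewrite mulr_sumr; apply: eq_bigr => b _.
    rewrite mulr_sumr; apply: eq_bigr => c _; by rewrite [RHS]scalerAr.
  apply: sum_antisym => [u|u b]; first by rewrite /F big1 // => c _; rewrite omg_b0 scale0r.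
  rewrite /F -sumrN; apply: eq_bigr => c _; rewrite omg_b scaleNr; congr (- (_ *: _)).
  by ring.
Qed.

Lemma size_bits m : (m <= i)%N -> size (bits m) = i.
Proof. by move=> le; rewrite size_cat !size_nseq subnKC. Qed.

Lemma count_bits m : count id (bits m) = m.
Proof. by rewrite count_cat !count_nseq /= mul1n mul0n addn0. Qed.

Lemma G_wg (T : {set V}) m : is_clique e T -> #|T| = i.+2 -> (m <= i)%N ->
  G wg (enum T) (bits m) = sgnl K (enum T) * g T m.
Proof.
move=> cl cT le; have sT : size (enum T) = i.+2 by rewrite -cardE.
have : Gg (enum T) m = sgnl K (enum T) * g T m.
  by rewrite /Gg enum_uniq set_enum cl sT eqxx.
case eT : (enum T) sT => [|b [|c us]] //= [su] <-.
have szu : size (bits m) = size us by rewrite size_bits.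
rewrite /om hat_wg quad_coef /omg /zk -!map_comp.
rewrite (eq_map (g := snd)) => [|[t u]]; last exact: vt_mk.
rewrite -/unzip2 unzip2_zip ?szu //; congr (Gg _ _).
rewrite -[RHS](count_bits m) -[in RHS](unzip1_zip (s := bits m) (t := us)) ?szu //.
rewrite !count_map; apply: eq_count => [[t u]] /=; exact: bt_mk.
Qed.

End Construction.

Definition cliques (l : nat) : {set {set V}} := [set T : {set V} | is_clique e T & #|T| == l].

Lemma qcyc_subspace : subspace qcyc.
Proof.
have sJ := cin_subspace (hideal_gsub hxi (bei_hideal K e)).
split.
  split; [by move=> T _; rewrite ffunE|exact: cP_0|exact: subspace0 sJ|exact: kd0].
move=> a u v [wu pu ju ku] [wv pv jv kv']; split.
- exact: (ws_subspace R W).2.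
- by rewrite cP_linear pu pv.
- exact: sJ.2.
- by rewrite kd_linear ku kv' scaler0 addr0.
Qed.

Lemma G_linear a w w' us ss : G (a *: w + w') us ss = a * G w us ss + G w' us ss.
Proof.
case: us => [|b [|c us]] /=; rewrite ?mulr0 ?addr0 //.
by rewrite /om hat_linear mcoeffD mcoeffZ.
Qed.

Lemma G0 us ss : G 0 us ss = 0.
Proof. by case: us => [|b [|c us]] //=; rewrite /om hat0 mcoeff0. Qed.

(** Coordinates of a cycle are its values on the sorted lists of the cliques of [i.+2] vertices, one
    for each number of ones among the bits. They determine the cycle by [qcyc_eq0], and [wg]
    realizes arbitrary values. *)
Lemma dimq_qcyc : dimq qcyc (@zerop _) (num_cliques e i.+2 * i.+1).
Proof.
pose A : {set {set V} * 'I_i.+1} := setX (cliques i.+2) setT.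
have -> : (num_cliques e i.+2 * i.+1)%N = #|A| by rewrite cardsX cardsT card_ord.
have := dimq_supported K A.
pose rel (g : {ffun {set V} * 'I_i.+1 -> K^o}) (w : chain R) :=
  forall (T : {set V}) (m : 'I_i.+1), T \in cliques i.+2 ->
    g (T, m) = sgnl K (enum T) * G w (enum T) (bits m).
apply: (@dimq_rel _ _ _ _ _ _ _ rel).
- split; first by move=> x _; rewrite ffunE.
  by move=> a u v hu hv x xA; rewrite !ffunE hu // hv // scaler0 addr0.
- exact: qcyc_subspace.
- move=> a u v u' v' h h' T m cT; rewrite !ffunE (h _ _ cT) (h' _ _ cT) G_linear.
  by rewrite mulrDr mulrCA.
- move=> g hg; exists (wg (fun T m => g (T, inord m))); first exact: wg_qcyc.
  move=> T m; rewrite inE => /andP[cl /eqP cT].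
  have le : (m <= i)%N by rewrite -ltnS.
  by rewrite (G_wg _ cl cT le) mulrA sgnl_sq mul1r inord_val.
- move=> w hw; exists [ffun x => if x \in A then sgnl K (enum x.1) * G w (enum x.1) (bits x.2)
  else 0].
    by move=> x /negbTE xA; rewrite ffunE xA.
  by move=> T m cT; rewrite ffunE inE cT inE.
- move=> g w hg hw hr; rewrite /zerop; split=> [g0|w0].
    apply: qcyc_eq0 => // T cl cT m le.
    have := hr T (Ordinal (n := i.+1) (m := m) le);
      rewrite inE cl cT eqxx g0 ffunE /= => /(_ isT)/esym/(congr1 (fun x => sgnl K (enum T) * x)).
    by rewrite mulrA sgnl_sq mul1r mulr0.
  apply/ffunP => [[T m]]; rewrite [RHS]ffunE.
  have [TA|/hg//] := boolP ((T, m) \in A).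
  by move: TA; rewrite inE => /andP[cT _]; rewrite hr // w0 G0 mulr0.
Qed.

(** The isomorphism is [kd], by exactness of the Koszul complex of the ring. As the ideal has no
    linear forms, a chain with linear coefficients that bounds modulo it is a genuine boundary. *)
Lemma hdim_linear_S : hdim (M := R) J W i.+1 1 (i.+1 * num_cliques e i.+2).
Proof.
have hJ := hideal_gsub hxi (bei_hideal K e).
rewrite mulnC; have := dimq_qcyc.
apply: (@dimq_rel _ _ _ _ _ _ _ (fun w c => kd c = w)).
- exact: qcyc_subspace.
- exact: Cyc_subspace.
- by move=> a u v u' v' e1 e2; rewrite kd_linear e1 e2.
- move=> w [ww pw jw kw].
  have [|c wc /cin_zerop/eqP] := @vanishing_zero _ _ _ _ hxi _ xi_kv i 1 w.
    by split=> //; apply/cin_zerop.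
  rewrite subr_eq0 => /eqP ec.
  have ec' : kd (cP i.+1 1 c) = w by rewrite kd_cP -ec pw.
  exists (cP i.+1 1 c) => //; split; [exact: cP_ws|exact: cP_id|by rewrite ec'].
- move=> c [wc pc jc]; exists (kd c) => //; split=> //; last exact: kdd.
    exact: kd_ws.
  by rewrite -kd_cP pc.
- move=> w c _ [wc pc jc] <-; split=> [k0|[d wd hd]].
    have [|d wd /cin_zerop/eqP] := @vanishing_zero _ _ _ _ hxi _ xi_kv i.+1 0 c.
      by split=> //; apply/cin_zerop.
    rewrite subr_eq0 => /eqP ed.
    by exists d => //; rewrite ed subrr; apply: subspace0 (cin_subspace hJ).
  have : cP i.+1 1 (c - kd d) = 0.
    apply/ffunP => T; rewrite [LHS]ffunE [RHS]ffunE; case: ifP => // _.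
    exact: (bei_deg1 (hd T)).
  by rewrite cPB pc -kd_cP => /eqP; rewrite subr_eq0 => /eqP ->; exact: kdd.
Qed.

End LinearStrand.

Lemma hdim_linear (K : fieldType) (V : finType) (e : rel V) (I : finType)
    (xi : I -> vertex_ring K V) (hxi : forall k, xi k \is 1%N.-homog)
    (kv : 'I_(#|V| + #|V|) -> I) (i : nat) :
  ssrbool.symmetric e -> irreflexive e -> injective kv ->
  (forall a, xi (kv a) = 'X_a) ->
  hdim (M := rmod hxi) (binomial_edge_ideal (K := K) e) (vset kv) i 1 (i * num_cliques e i.+1).
Proof.
move=> es ei kv_inj xi_kv; case: i => [|i]; last exact: hdim_linear_S.
have hJ := hideal_gsub hxi (bei_hideal K e).
rewrite mul0n; apply/(hdim0P _ _ _ hJ) => c [wc pc _].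
(* In exterior degree 0 every linear form is a boundary. *)
have [|d wd hd] := @vanishing_zero _ _ _ _ hxi _ xi_kv 0 0 c.
  by split=> //; apply/cin_zerop; rewrite -pc kd_cP0.
move/cin_zerop: hd => hd; exists d => // T.
by rewrite hd ffunE; exact: hi0 (bei_hideal _ _).
Qed.

(** * Cones *)

(** The sequence shifted by one place; the value 0 at the start is the convention for negative
    homological degrees. *)
Definition bshift (b : nat -> nat) (i : nat) : nat := if i is i'.+1 then b i' else 0.

Lemma hdim_kill_var (K : fieldType) (I : finType) (M : gmod K I) (B : M -> Prop)
    (W : {set I}) z j (b : nat -> nat) :
  gsub B -> z \notin W -> (forall m, B (gm_X M z m)) ->
  (forall i, hdim B W i j (b i)) ->
  forall i, hdim B (z |: W) i j (b i + bshift b i).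
Proof.
move=> hB zW zB h [|i] /=; first by rewrite addn0; apply: hdim_kill0.
exact: hdim_kill.
Qed.

(** * Clique numbers of complete graphs and of cones *)

Section CliqueCounts.
Variable V : finType.
Implicit Type e : rel V.

Definition complete_rel : rel V := fun u w => u != w.

Lemma num_cliques_complete l : num_cliques complete_rel l = 'C(#|V|, l).
Proof.
rewrite -card_draws; congr #|pred_of_set _|; apply/setP => U; rewrite !inE.
suff -> : is_clique complete_rel U by []; apply/forallP => u; apply/implyP => _; apply/forallP => w.
by apply/implyP => _; apply/implyP.
Qed.

Lemma num_cliques0 e : num_cliques e 0 = 1%N.
Proof.
rewrite -(cards1 (set0 : {set V})); congr #|pred_of_set _|; apply/setP => U.
rewrite !inE cards_eq0 andbC; case: eqP => // ->.
by apply/forallP => u; rewrite inE.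
Qed.

Lemma cone_clique e (U : {set V}) : is_clique (cone e) (Some @: U) = is_clique e U.
Proof.
apply/forall_inP/forall_inP => h u uU; apply/forall_inP => w wU; apply/implyP => nuw.
  have /forall_inP/(_ (Some w)) := h (Some u) (imset_f _ uU).
  by rewrite imset_f // => /(_ isT)/implyP; apply; apply: contra nuw => /eqP [->].
case/imsetP: uU nuw => u' u'U ->; case/imsetP: wU => w' w'U -> nuw.
have /forall_inP/(_ w' w'U)/implyP := h u' u'U; apply.
by apply: contra nuw => /eqP ->.
Qed.

Lemma cone_clique_apex e (U : {set V}) :
  is_clique (cone e) (None |: Some @: U) = is_clique e U.
Proof.
rewrite -cone_clique; apply/forall_inP/forall_inP => h u uU; apply/forall_inP => w wU.
  have /forall_inP/(_ w) := h u (setU1r _ uU); apply.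
  exact: setU1r.
apply/implyP; case: u uU => [u|] uU; case: w wU => [w|] wU //.
rewrite !inE /= in uU wU => nuw.
have /forall_inP/(_ (Some w) wU)/implyP := h (Some u) uU; exact.
Qed.

(** A clique of the cone either avoids the apex or is the apex added to a clique of the base with
    one vertex less. *)
Lemma num_cliques_cone e l :
  num_cliques (cone e) l.+1 = (num_cliques e l.+1 + num_cliques e l)%N.
Proof.
rewrite /num_cliques -(cardsID [set U : {set option V} | None \in U]) addnC.
have Some_inj : injective (@Some V) by move=> ? ? [].
have pre (U : {set option V}) : None \notin U -> U = Some @: (Some @^-1: U).
  move=> nU; apply/setP => [[u|]]; last first.
    by rewrite (negbTE nU); apply/esym/imsetP => [[]].
  by rewrite mem_imset // inE.
congr (_ + _)%N.
- rewrite -(card_imset _ (imset_inj Some_inj)); congr #|pred_of_set _|.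
  apply/setP => U; apply/idP/imsetP => [|[U']].
    rewrite !inE => /and3P[nU cl cU]; exists (Some @^-1: U); last exact: pre.
    by rewrite inE -cone_clique -(card_imset _ Some_inj) -pre ?cl.
  rewrite !inE => /andP[cl cU] ->; rewrite cone_clique cl card_imset // cU !andbT.
  by apply/imsetP => [[]].
- have inj2 : injective (fun U : {set V} => None |: Some @: U).
    move=> U U' /setP h; apply/setP => u; have := h (Some u).
    by rewrite !inE /= !mem_imset.
  rewrite -(card_imset _ inj2); congr #|pred_of_set _|.
  have cN (U : {set V}) : #|None |: Some @: U| = #|U|.+1.
    rewrite cardsU1 card_imset // (_ : None \in _ = false) //.
    by apply/imsetP => [[]].
  apply/setP => U; apply/idP/imsetP => [|[U']].
    rewrite !inE => /andP[/andP[cl cU] nU].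
    have eU : U = None |: Some @: (Some @^-1: (U :\ None)).
      by rewrite -pre ?setD1K // !inE eqxx.
    exists (Some @^-1: (U :\ None)) => //.
    by rewrite inE -cone_clique_apex -eqSS -cN -eU cl cU.
  by rewrite !inE => /andP[cl cU] ->; rewrite cone_clique_apex cl cN eqSS cU !inE.
Qed.

End CliqueCounts.

Section Graded.
Variables (K : fieldType) (n n' : nat) (h : 'I_n -> {mpoly K[n']}).
Lemma psubst_deg1 p : (forall i, h i \is 1%N.-homog) -> forall e,
  pihomog mdeg e (psubst h p) = psubst h (pihomog mdeg e p).
Proof. by move=> hh e; rewrite -{1}[e]mul1n psubst_pihomog. Qed.
End Graded.

Lemma bei_psubst (K : fieldType) (V V' : finType) (e : rel V) (h : 'I_(#|V| + #|V|) ->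
  vertex_ring K V')
    (C : vertex_ring K V' -> Prop) p :
  hideal C ->
  (forall u w, e u w -> C (psubst h (xvar K u * yvar K w - xvar K w * yvar K u))) ->
  binomial_edge_ideal (K := K) e p -> C (psubst h p).
Proof.
move=> hC hg [c ->]; rewrite linear_sum; apply: (subspace_sum (hideal_sub hC)) => u _.
rewrite linear_sum; apply: (subspace_sum (hideal_sub hC)) => w euw.
by rewrite /= rmorphM; apply: (hiM hC); apply: hg.
Qed.

Lemma kill_coef (K : fieldType) n (A : {set 'I_n}) (p : {mpoly K[n]}) (m : 'X_{1..n}) :
  (forall a, a \in A -> m a = 0%N) -> (p - psubst (kill K A) p)@_m = 0.
Proof.
move=> hm; elim/mpoly_span: p => [|c l p IH]; first by rewrite linear0 subr0 mcoeff0.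
have -> : psubst (kill K A) (c *: 'X_[l] + p) =
    c *: psubst (kill K A) 'X_[l] + psubst (kill K A) p by exact: linearP.
rewrite opprD addrACA mcoeffD IH addr0 -scalerBr mcoeffZ kill_mon.
case: existsP => [[a /andP[aA la]]|_]; last by rewrite subrr mcoeff0 mulr0.
rewrite subr0 mcoeffX; case: eqP => [e|_]; last by rewrite mulr0.
by rewrite e hm in la.
Qed.

(** Every swap of a complete graph is allowed, so the toric argument applies with no condition on
    the degrees. *)
Lemma complete_segre (K : fieldType) (V : finType) p :
  binomial_edge_ideal (K := K) (@complete_rel V) p <-> segre (K := K) setT p.
Proof.
have hs := segre_hideal K [set: V].
split=> [[c ->]|hp].
  apply: (subspace_sum (hideal_sub hs)) => u _; apply: (subspace_sum (hideal_sub hs)) => w _.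
  by apply: (hiM hs); apply: segre_binomial.
have hb := bei_hideal K (@complete_rel V).
apply: (toric (P := fun=> True) (hideal_sub hb)) hp _ => // a b m _.
rewrite mulrC; apply: (hiM hb); have [->|nab] := eqVneq a b.
  by rewrite subrr; apply: hi0 hb.
exact: bei_edge.
Qed.

(** * The ideals around a cone, and its three kinds of strands *)

Section Cone.
Variables (K : fieldType) (V : finType).
Notation V' := (option V : finType).
Notation SH := (vertex_ring K V).
Notation S := (vertex_ring K V').
Notation I := (bool * option V : finType)%type.
Notation ix u := (lshift #|V'| (enum_rank u)).
Notation iy u := (rshift #|V'| (enum_rank u)).

Definition xiS (k : I) : S := if k.1 then xvar K k.2 else yvar K k.2.
Definition kvS : 'I_(#|V'| + #|V'|) -> I := by_vertex (fun u => (true, u)) (fun u => (false, u)).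

(** S_H carries the operators of S, those of the apex acting by 0; this allows S/J_B and S_H/J_H to
    be compared as modules with the same operators. *)
Definition xiH (k : I) : SH :=
  if k.2 is Some u then (if k.1 then xvar K u else yvar K u) else 0.
Definition kvH : 'I_(#|V| + #|V|) -> I :=
  by_vertex (fun u => (true, Some u)) (fun u => (false, Some u)).

Lemma xvar_homog (W : finType) (u : W) : xvar K u \is 1%N.-homog.
Proof. by rewrite dhomogX /= mdeg1. Qed.

Lemma yvar_homog (W : finType) (u : W) : yvar K u \is 1%N.-homog.
Proof. by rewrite dhomogX /= mdeg1. Qed.

Lemma xiS_homog k : xiS k \is 1%N.-homog.
Proof. by rewrite /xiS; case: ifP => _; rewrite ?xvar_homog ?yvar_homog. Qed.

Lemma xiH_homog k : xiH k \is 1%N.-homog.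
Proof.
by case: k => [b [u|]]; rewrite /xiH /= ?dhomog0 //; case: b; rewrite ?xvar_homog ?yvar_homog.
Qed.

Lemma xi_kvS a : xiS (kvS a) = 'X_a.
Proof. by elim/vertex_indexP: a => u; rewrite /kvS ?by_vertexl ?by_vertexr. Qed.

Lemma xi_kvH a : xiH (kvH a) = 'X_a.
Proof. by elim/vertex_indexP: a => u; rewrite /kvH ?by_vertexl ?by_vertexr. Qed.

Lemma kvS_inj : injective kvS.
Proof.
move=> a b; elim/vertex_indexP: a => u; elim/vertex_indexP: b => w;
  by rewrite /kvS ?by_vertexl ?by_vertexr => [[]] // ->.
Qed.

Lemma kvH_inj : injective kvH.
Proof.
move=> a b; elim/vertex_indexP: a => u; elim/vertex_indexP: b => w;
  by rewrite /kvH ?by_vertexl ?by_vertexr => [[]] // ->.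
Qed.

Lemma vset_kvS : vset kvS = setT.
Proof.
apply/setP => [[b u]]; rewrite inE; apply/vsetP; case: b.
  by exists (ix u); rewrite /kvS by_vertexl.
by exists (iy u); rewrite /kvS by_vertexr.
Qed.

Lemma kvH_None b : (b, None) \notin vset kvH.
Proof.
apply/negP => /vsetP [a]; elim/vertex_indexP: a => u;
  by rewrite /kvH ?by_vertexl ?by_vertexr.
Qed.

Lemma vset_kvH : setT = (true, None) |: ((false, None) |: vset kvH).
Proof.
apply/setP => [[b u]]; rewrite !inE; apply/esym; case: u => [u|]; last by case: b.
apply/orP; right; apply/orP; right; apply/vsetP; case: b.
  by exists (lshift _ (enum_rank u)); rewrite /kvH by_vertexl.
by exists (rshift _ (enum_rank u)); rewrite /kvH by_vertexr.
Qed.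

Definition rho_var : 'I_(#|V'| + #|V'|) -> SH :=
  by_vertex (fun u : V' => if u is Some w then xvar K w else 0)
            (fun u : V' => if u is Some w then yvar K w else 0).
Definition iota_var : 'I_(#|V| + #|V|) -> S :=
  by_vertex (fun u => xvar K (Some u)) (fun u => yvar K (Some u)).
Notation rho := (psubst rho_var).
Notation iota := (psubst iota_var).

Lemma rho_homog a : rho_var a \is 1%N.-homog.
Proof.
by elim/vertex_indexP: a => [[u|]|[u|]]; rewrite /rho_var ?by_vertexl ?by_vertexr
  ?dhomog0 ?xvar_homog ?yvar_homog.
Qed.

Lemma rho_x u : rho (xvar K u) = if u is Some w then xvar K w else 0.
Proof. by rewrite psubstX /rho_var by_vertexl. Qed.

Lemma rho_y u : rho (yvar K u) = if u is Some w then yvar K w else 0.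
Proof. by rewrite psubstX /rho_var by_vertexr. Qed.

Lemma iota_x u : iota (xvar K u) = xvar K (Some u).
Proof. by rewrite psubstX /iota_var by_vertexl. Qed.

Lemma iota_y u : iota (yvar K u) = yvar K (Some u).
Proof. by rewrite psubstX /iota_var by_vertexr. Qed.

Lemma rho_iota p : rho (iota p) = p.
Proof.
rewrite (psubst_comp (h'' := fun i => 'X_i)) ?psubst_id // => a.
by elim/vertex_indexP: a => u; rewrite /iota_var ?by_vertexl ?by_vertexr ?rho_x ?rho_y.
Qed.

Lemma iota_rho p : iota (rho p) = psubst (kill K [set ix None; iy None]) p.
Proof.
apply: psubst_comp => a; elim/vertex_indexP: a => u;
  rewrite /rho_var ?by_vertexl ?by_vertexr /kill !inE
   ?eq_lshift ?eq_rshift ?eq_lrshift ?eq_rlshift ?orbF (inj_eq enum_rank_inj);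
   by case: u => [u|]; rewrite ?linear0 ?iota_x ?iota_y.
Qed.

Variable e : rel V.
Hypotheses (e_sym : ssrbool.symmetric e) (e_irr : irreflexive e).
Notation beiS := (binomial_edge_ideal (K := K) (V := V')).
Notation beiH := (binomial_edge_ideal (K := K) (V := V)).
Notation complS := (@complete_rel V').
Notation complH := (@complete_rel V).

Lemma rho_bei (d : rel V') (d' : rel V) p :
  (forall u w, d (Some u) (Some w) -> d' u w) -> beiS d p -> beiH d' (rho p).
Proof.
move=> hd; have hb := bei_hideal K d'; apply: bei_psubst => // u w duw.
rewrite rmorphB !rmorphM /= !rho_x !rho_y.
case: u duw => [u|] duw; case: w duw => [w|] duw; rewrite ?mul0r ?mulr0 ?subrr; try exact: hi0 hb.
by apply: bei_edge; apply: hd.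
Qed.

Lemma iota_bei (d : rel V) (d' : rel V') p :
  (forall u w, d u w -> d' (Some u) (Some w)) -> beiH d p -> beiS d' (iota p).
Proof.
move=> hd; have hb := bei_hideal K d'; apply: bei_psubst => // u w duw.
rewrite rmorphB !rmorphM /= !iota_x !iota_y.
by apply: bei_edge; apply: hd.
Qed.

(** The ideal (x_v, y_v) + J_d, as a preimage under [rho]. It is J_B for [d = e] and J_Q for the
    complete relation. *)
Definition JB (d : rel V) (p : S) : Prop := beiH d (rho p).

Lemma JB_hideal d : hideal (JB d).
Proof. exact: psubst_preim rho_homog (bei_hideal _ _). Qed.

(** A swap at two vertices a, b other than the apex v is multiplied by a monomial containing x_v or
    y_v. It is then allowed, since x_v (x_a y_b - x_b y_a) = x_a (x_v y_b - x_b y_v) - x_b (x_v y_a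
    - x_a y_v), and similarly for y_v. *)
Lemma cone_toric p : segre setT p ->
  (forall m, m \in msupp p -> (0 < vdeg m None)%N) -> beiS (cone e) p.
Proof.
have hb := bei_hideal K (cone e).
apply: (toric (P := fun f => (0 < f None)%N) (hideal_sub hb)); first by move=> f g ->.
move=> a b m hm.
have edgeN (u w : V') q : cone e u w ->
  beiS (cone e) (q * (xvar K u * yvar K w - xvar K w * yvar K u)).
  by move=> h; apply: (hiM hb); apply: bei_edge.
have [ab|nab] := eqVneq a b; first by rewrite ab subrr mul0r; apply: hi0 hb.
case: a nab hm => [a|]; case: b => [b|] // nab hm; rewrite [_ * 'X_[m]]mulrC; try exact: edgeN.
have mv : (0 < vdeg m None)%N.
  by move: hm; rewrite !vdegD vdeg_x vdeg_y.
have [mx|] := boolP (m (ix None) != 0%N).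
  have [m' ->] := mnm_split mx.
  have -> : 'X_[U_(ix None) + m'] * (xvar K (Some a) * yvar K (Some b) - xvar K (Some b) * yvar
    K (Some a)) =
    ('X_[m'] * xvar K (Some a)) * (xvar K None * yvar K (Some b) - xvar K (Some b) * yvar K None)
    + (- 'X_[m'] * xvar K (Some b)) * (xvar K None * yvar K (Some a) - xvar K (Some a) * yvar K
      None).
    by rewrite mpolyXD -[X in X * 'X_[m']]/(xvar K None); ring.
  by apply: (hiD hb); apply: edgeN.
rewrite negbK => /eqP mx.
have my : m (iy None) != 0%N by move: mv; rewrite /vdeg mx lt0n.
have [m' ->] := mnm_split my.
have -> : 'X_[U_(iy None) + m'] * (xvar K (Some a) * yvar K (Some b) - xvar K (Some b) * yvar K
  (Some a)) =
    ('X_[m'] * yvar K (Some b)) * (xvar K (Some a) * yvar K None - xvar K None * yvar K (Some a))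
    + (- 'X_[m'] * yvar K (Some a)) * (xvar K (Some b) * yvar K None - xvar K None * yvar K
      (Some b)).
  by rewrite mpolyXD -[X in X * 'X_[m']]/(yvar K None); ring.
by apply: (hiD hb); apply: edgeN.
Qed.

(** For [p] in the intersection, [iota (rho p)] is in J_H extended to S, hence in J_G. The
    difference [p - iota (rho p)] is in J_A and all its monomials involve the apex, which is the
    case of [cone_toric]. *)
Lemma cone_inter p : beiS (cone e) p <-> beiS complS p /\ JB e p.
Proof.
have hA := bei_hideal K complS; have hG := bei_hideal K (cone e).
have GA q : beiS (cone e) q -> beiS complS q.
  move=> h; have := @bei_psubst K V' V' (cone e) (fun i => 'X_i) (beiS complS) q hA.
  rewrite !psubst_id //; apply=> // u w h'; rewrite psubst_id //; apply: bei_edge.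
  by apply/eqP => euw; move: h'; rewrite euw; case: (w) => //= x; rewrite e_irr.
split=> [h|[hA' hB]].
  split; first exact: GA.
  by apply: rho_bei h.
have hi : beiS (cone e) (iota (rho p)) by apply: iota_bei hB.
rewrite -[p](subrK (iota (rho p))); apply: (hiD hG) => //.
apply: cone_toric.
  apply: (subspaceB (hideal_sub (segre_hideal _ _))); first exact/complete_segre.
  by apply/complete_segre/GA.
move=> m; rewrite mcoeff_msupp lt0n; apply: contra => /eqP m0.
rewrite iota_rho kill_coef // => a; rewrite !inE => /orP[] /eqP ->.
  by move/eqP: m0; rewrite /vdeg addn_eq0 => /andP[/eqP].
by move/eqP: m0; rewrite /vdeg addn_eq0 => /andP[_ /eqP].
Qed.

Lemma cone_sum p : JB complH p <-> exists a b, [/\ beiS complS a, JB e b & p = a + b].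
Proof.
have hQ := bei_hideal K complH.
split=> [h|[a [b [ha hb ->]]]].
  exists (iota (rho p)), (p - iota (rho p)); split.
  - by apply: iota_bei h.
  - by rewrite /JB linearB /= rho_iota subrr; apply: hi0 (bei_hideal _ _).
  - by rewrite addrC subrK.
rewrite /JB linearD; apply: (hiD hQ).
  apply: rho_bei ha => u w; by apply: contra => /eqP ->.
have := @bei_psubst K V V e (fun i => 'X_i) (beiH complH) (rho b) hQ.
rewrite psubst_id //; apply=> // u w h'; rewrite psubst_id //; apply: bei_edge.
by apply/eqP => euw; rewrite euw e_irr in h'.
Qed.

Lemma JQ_segre p : JB complH p <-> segre (K := K) (setT :\ None) p.
Proof.
have -> : segre (K := K) (setT :\ None) p <-> segre setT (iota (rho p)).
  by rewrite /segre iota_rho segre_kill.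
rewrite -complete_segre; split=> h; first by apply: iota_bei h.
rewrite /JB -[rho p]rho_iota; apply: rho_bei h => u w.
by apply: contra => /eqP ->.
Qed.

Notation RS := (rmod xiS_homog).
Notation RH := (rmod xiH_homog).

Lemma hdim_JB d i j m : hdim (M := RS) (JB d) setT i j m <-> hdim (M := RH) (beiH d) setT i j m.
Proof.
have iso := @hdim_iso K _ RS RH (JB d) (beiH d) rho (hideal_gsub _ (JB_hideal d)) (hideal_gsub
  _ (bei_hideal K d)).
apply: iso.
- move=> [b u] p; rewrite /= /mulx rmorphM /= /xiS /xiH /=; congr (_ * _).
  by case: b; rewrite ?rho_x ?rho_y; case: u.
- by move=> k p; rewrite /= (psubst_deg1 _ rho_homog).
- by [].
- move=> p; exists (iota p); rewrite /= rho_iota subrr; exact: hi0 (bei_hideal _ _).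
Qed.

(** The two apex variables act by 0 and are adjoined one after the other; each adds a copy shifted
    by one, whence the coefficients 1, 2, 1. *)
Lemma hdim_cone d j (b : nat -> nat) :
  (forall i, hdim (M := RH) (beiH d) (vset kvH) i j (b i)) ->
  forall i, hdim (M := RS) (JB d) setT i j (b i + 2 * bshift b i + bshift (bshift b) i).
Proof.
move=> hb i; apply/hdim_JB; have hR := hideal_gsub xiH_homog (bei_hideal K d).
have z0 t m : beiH d (gm_X RH (t, None) m) by rewrite /= /mulx mul0r; apply: hi0 (bei_hideal _ _).
have h1 := hdim_kill_var hR (kvH_None false) (z0 false) hb.
have nT : (true, None) \notin (false, None) |: vset kvH.
  by rewrite !inE /= (negbTE (kvH_None true)).
have := hdim_kill_var hR nT (z0 true) h1 i; rewrite -vset_kvH.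
by congr hdim; case: i => [|i] /=; lia.
Qed.

Variables (FG : graded_free_resolution (beiS (cone e))) (FH : graded_free_resolution (beiH e)).

Lemma cone_sym : ssrbool.symmetric (cone e).
Proof. by move=> [u|] [w|] //=. Qed.

Lemma cone_irr : irreflexive (cone e).
Proof. by move=> [u|] //=. Qed.

Lemma hdim_G i j : hdim (M := RS) (beiS (cone e)) setT i j (tor_dim FG i (i + j)).
Proof. by rewrite -vset_kvS; apply: hdim_tor; [exact: xi_kvS|exact: bei_hideal]. Qed.

Lemma hdim_B i j : hdim (M := RS) (JB e) setT i j
  (tor_dim FH i (i + j) + 2 * bshift (fun l => tor_dim FH l (l + j)) i
   + bshift (bshift (fun l => tor_dim FH l (l + j))) i).
Proof.
apply: hdim_cone => l; apply: hdim_tor; [exact: xi_kvH|exact: bei_hideal].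
Qed.

Let hG := hideal_gsub xiS_homog (bei_hideal K (cone e)).
Let hA := hideal_gsub xiS_homog (bei_hideal K complS).
Let hB := hideal_gsub xiS_homog (JB_hideal e).
Let hQ := hideal_gsub xiS_homog (JB_hideal complH).

Lemma vanishing_A i j : vanishing (M := RS) (beiS complS) setT i j.+2.
Proof.
have := @vanishing_segre _ _ _ _ xiS_homog _ xi_kvS setT i j; rewrite vset_kvS.
by apply: (@vanishing_ext _ _ RS) => p; rewrite complete_segre.
Qed.

Lemma vanishing_Q i j : vanishing (M := RS) (JB complH) setT i j.+2.
Proof.
have := @vanishing_segre _ _ _ _ xiS_homog _ xi_kvS (setT :\ None) i j; rewrite vset_kvS.
by apply: (@vanishing_ext _ _ RS) => p; rewrite JQ_segre.
Qed.

Lemma linear_strand_cone i :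
  tor_dim FG i (i + 1) = (i * (num_cliques e i + num_cliques e i.+1))%N.
Proof.
have := hdim_linear xiS_homog i cone_sym cone_irr kvS_inj xi_kvS; rewrite vset_kvS.
move=> /(hdim_eq hG (hdim_G i 1)) ->; by rewrite num_cliques_cone addnC.
Qed.

(** Coefficient degree 3 is where the argument starts, as the connecting map comes from J_Q in one
    degree less and the homology of J_Q is known to vanish only from degree 2 on. *)
Lemma higher_strand_cone i j :
  tor_dim FG i (i + j.+3) =
  (tor_dim FH i (i + j.+3) + 2 * bshift (fun l => tor_dim FH l (l + j.+3)) i
   + bshift (bshift (fun l => tor_dim FH l (l + j.+3))) i)%N.
Proof.
apply: (hdim_eq hG (hdim_G i _)).
apply: (mv_iso hG hA hB hQ cone_inter cone_sum); last exact: hdim_B.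
- exact: vanishing_Q.
- exact: vanishing_Q.
- exact: vanishing_A.
Qed.

Lemma complete_irr (T : finType) : irreflexive (@complete_rel T).
Proof. by move=> u; rewrite /complete_rel eqxx. Qed.

Lemma complete_sym (T : finType) : ssrbool.symmetric (@complete_rel T).
Proof. by move=> u w; rewrite /complete_rel eq_sym. Qed.

(** The five-term count with all linear strands inserted, in additive form. The factor [i.-1],
    truncated at [i = 0], is correct there, since the doubly shifted strand then has no term. *)
Lemma quadratic_strand_cone i N : #|V| = N ->
  (tor_dim FG i (i + 2) + (i.+1 * 'C(N.+1, i.+2))
    + (i.+1 * num_cliques e i.+2 + 2 * (i * num_cliques e i.+1) + i.-1 * num_cliques e i) =
  (tor_dim FH i (i + 2) + 2 * bshift (fun l => tor_dim FH l (l + 2)) i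
   + bshift (bshift (fun l => tor_dim FH l (l + 2))) i)
  + (i.+1 * 'C(N, i.+2) + 2 * (i * 'C(N, i.+1)) + i.-1 * 'C(N, i))
  + i.+1 * (num_cliques e i.+1 + num_cliques e i.+2))%N.
Proof.
move=> <-.
have A1 : hdim (M := RS) (beiS complS) setT i.+1 1 (i.+1 * 'C(#|V|.+1, i.+2)).
  rewrite -[#|V|.+1]card_option -num_cliques_complete -vset_kvS.
  apply: hdim_linear; [exact: complete_sym | exact: complete_irr | exact: kvS_inj | exact: xi_kvS].
have lin (d : rel V) : ssrbool.symmetric d -> irreflexive d ->
   hdim (M := RS) (JB d) setT i.+1 1 (i.+1 * num_cliques d i.+2 +
     2 * (i * num_cliques d i.+1) + i.-1 * num_cliques d i).
  move=> ds di; have := hdim_cone (fun l => hdim_linear xiH_homog l ds di kvH_inj xi_kvH) i.+1.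
  by congr hdim; case: (i).
have B1 := lin _ e_sym e_irr; have Q1 := lin _ (@complete_sym _) (@complete_irr _).
rewrite !num_cliques_complete in Q1.
have G1 : hdim (M := RS) (beiS (cone e)) setT i.+1 1 (i.+1 * (num_cliques e i.+1 +
  num_cliques e i.+2)).
  by rewrite -linear_strand_cone; exact: hdim_G.
apply: (mv_five hG hA hB hQ cone_inter cone_sum _ _ _ A1 B1 Q1 G1 (hdim_B i 2) (hdim_G i 2)).
- exact: vanishing_A.
- exact: vanishing_Q.
(* The boundary of a chain with constant coefficients consists of linear forms; one that lies in J_Q
   is sent by [rho] to a linear form of a binomial edge ideal, that is to 0, and so lies in J_B. *)
- move=> c [wc pc kc]; split=> // T.
  have pk : cP i.+1 1 (kd c) = kd c by rewrite -kd_cP pc.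
  rewrite /JB (_ : rho (kd c T) = 0); first exact: hi0 (bei_hideal _ _).
  rewrite -pk ffunE; case: ifP => _; last exact: linear0.
  by rewrite /= -psubst_deg1 ?(bei_deg1 (kc T)) //; exact: rho_homog.
Qed.

End Cone.

Theorem theorem3p10 (K : fieldType) (n : nat) (H : rel 'I_n)
    (Hsym : ssrbool.symmetric H) (Hirr : irreflexive H) (Hnc : ~~ is_complete H)
    (FG : graded_free_resolution (binomial_edge_ideal (K := K) (cone H)))
    (FH : graded_free_resolution (binomial_edge_ideal (K := K) H))
    (bG := fun i d : int => (betti FG i d)%:Z)
    (bH := fun i d : int => (betti FH i d)%:Z)
    (k := fun i : nat => (num_cliques H i)%:Z) (i : nat) :
  [/\ bG i (i%:Z + 1) = i%:Z * (k i + k i.+1),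
      bG i (i%:Z + 2) =
        bH i (i%:Z + 2) + 2 * bH (i%:Z - 1) (i%:Z + 1)
        + bH (i%:Z - 2) i
        + (i%:Z - 1) * 'C(n.+1, i.+1)%:Z
        - (i%:Z - 1) * k i - (i%:Z - 1) * k i.+1
    & forall j : nat, (3 <= j)%N ->
      bG i (i%:Z + j%:Z) =
        bH i (i%:Z + j%:Z) + 2 * bH (i%:Z - 1) (i%:Z - 1 + j%:Z)
        + bH (i%:Z - 2) (i%:Z - 2 + j%:Z)].
Proof.
have shift1 l j : bH (l%:Z - 1) (l%:Z - 1 + j%:Z) = (bshift (fun l => tor_dim FH l (l + j)) l)%:Z.
  rewrite /bH; case: l => [|l]; first by [].
  by have -> : l.+1%:Z - 1 = l%:Z by lia.
have shift2 l j : bH (l%:Z - 2) (l%:Z - 2 + j%:Z) = (bshift (bshift (fun l =>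
  tor_dim FH l (l + j))) l)%:Z.
  rewrite /bH; case: l => [|[|l]]; [by []|by []|].
  by have -> : l.+2%:Z - 2 = l%:Z by lia.
split.
- rewrite /bG /k -PoszD /= (linear_strand_cone Hsym Hirr); lia.
(* The degrees in the statement are rewritten as homological index plus 2, the shape in which the
   shifted sequences occur. *)
- have e1 : i%:Z + 1 = i%:Z - 1 + 2%:Z by lia.
  have e2 : i%:Z = i%:Z - 2 + 2%:Z by lia.
  rewrite e1 shift1 [X in bH (_ - 2) X]e2 shift2 /bG /bH /k /=.
  (* By Pascal's rule, (i+1) (C(n,i+2) - C(n+1,i+2)) + 2i C(n,i+1) + (i-1) C(n,i) equals (i-1)
     C(n+1,i+1). *)
  have := quadratic_strand_cone Hsym Hirr FG FH i (card_ord n); rewrite !binS.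
  have k0 := num_cliques0 H; have c0 := bin0 n.
  move: (tor_dim FG i (i + 2)) (tor_dim FH i (i + 2)) (bshift _ i) (bshift (bshift _) i) => a b c d.
  (* For [i = 0] the integer [i - 1] is -1 while [i.-1] is 0; the discrepancy cancels because both
     k_0 and C(n,0) are 1. *)
  case: i {e1 e2} => [|i'] /=; [rewrite k0 c0; lia | nia].
- move=> [|[|[|j]]] // _; rewrite shift1 shift2 /bG /bH /=.
  rewrite (higher_strand_cone Hirr FG FH i j); rewrite 2!PoszD PoszM.
  by congr (_ + _ * _ + _).
Qed.
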